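(* Let $R$ be a commutative ring with unity, $1\neq 0$, with $\mathrm{char}(R)\neq 2$. Let $G$ be a nonabelian group, $\sigma:G\to\{\pm1\}$ a nontrivial group homomorphism, and $N=\ker(\sigma)$. Then $(RG)_{\varphi_\sigma}^{-}$ is commutative if and only if one of the following conditions holds, where in each item in which it appears $E$ denotes some (possibly trivial) elementary abelian $2$-group, the same one in $G$ and in $N$: \begin{enumerate} \item $R_2=\{0\}$, $G=\langle a,b \mid a^8=1,\ b^2=a^4,\ ab=ba^3\rangle\times E$ and $N=\langle a^2,ab\rangle\times E$; \item $\mathrm{char}(R)=4$, $G=\langle a,b\mid a^8=1,\ b^2=a^4,\ ab=ba^{-1}\rangle\times E$, and $N=\langle a^2,b\rangle\times E$ or $N=\langle a^2,ab\rangle\times E$; \item $R_2=\{0\}$ and $N$ is an elementary abelian $2$-group; \item $G$ is a Hamiltonian $2$-group and one of the following holds: (i) $N$ is abelian; (ii) $N$ is a Hamiltonian $2$-group and $\mathrm{char}(R)=4$; \item $G=\langle a,b\mid a^4=b^4=1,\ ab=b^{-1}a\rangle\times E$ and $N$ is equal to either $\langle a,b^2\rangle\times E$ or $\langle ab,b^2\rangle\times E$; \item $\mathrm{char}(R)=4$, $G=\langle a,b,c\mid a^4=b^4=1,\ c^2=a^2,\ ab=ba,\ ac=ca^{-1},\ bc=cb^{-1}\rangle\times E$ and $N$ is equal to either $\langle a,c\rangle\times\langle b^2\rangle\times E$ or $\langle a,bc\rangle\times\langle b^2\rangle\times E$; \item $R_2=\{0\}$, $G=\langle a,b,c\mid a^2=b^2=c^2=1,\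 abc=bca=cab\rangle\times E$ and $N$ is equal to either $\langle a,b\rangle\times E$, $\langle a,c\rangle\times E$ or $\langle b,c\rangle\times E$; \item $R_2=\{0\}$, $G=\langle a,b,c,d\mid a^4=b^2=c^2=d^2=1,\ ab=ba,\ ac=ca,\ ad=dab,\ bc=cb,\ bd=db,\ cd=da^2c\rangle\times E$ and $N=\langle b\rangle\times\langle c,d\rangle\times E$; \item $R_2=\{0\}$, $G=\langle a,b,c\mid a^4=b^4=c^2=1,\ ab=ba,\ ac=ca^{-1},\ bc=ca^2b^{-1}\rangle\times E$ and $N=\langle a,c\rangle\times\langle b^2\rangle\times E$; \item $R_2=\{0\}$, $G=\langle a,b,c\mid a^4=b^4=c^2=1,\ ab=ba,\ ac=ca,\ bc=ca^2b\rangle\times E$ and $N=\langle b,c\rangle\times E$ or $N=\langle ab,c\rangle\times E$. \end{enumerate}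
   Context: For a commutative ring $R$ with unity, a group $G$ and a group homomorphism $\sigma:G\to\{\pm1\}$ (an orientation), $\varphi_\sigma:RG\to RG$ is the involution $\varphi_\sigma(\sum_{g}\alpha_g g)=\sum_g \alpha_g\sigma(g)g^{-1}$ of the group ring $RG$. The set of antisymmetric elements is $(RG)_{\varphi_\sigma}^{-}=\{\alpha\in RG\mid \varphi_\sigma(\alpha)=-\alpha\}$; it is called commutative if $xy=yx$ for all $x,y$ in it. $R_2=\{r\in R\mid 2r=0\}$. A Hamiltonian $2$-group is a nonabelian $2$-group all of whose subgroups are normal (equivalently $Q_8\times E$ with $E$ an elementary abelian $2$-group). The equalities $G=\langle\dots\rangle\times E$, $N=\dots$ mean that there are elements $a,b,\dots$ of $G$ and a subgroup $E$ of $G$ for which $G$ is the internal direct product of $E$ and the subgroup generated by $a,b,\dots$, this subgroup having the displayed presentation on these generators, and for which $N$ is the displayed subgroup. *)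

(* Defs.v *)
From HB Require Import structures.
From mathcomp Require Import all_boot all_algebra.
From mathcomp Require Import presentation.
From mathcomp Require Import classical_sets finmap monalg.

Set Implicit Arguments.
Unset Strict Implicit.
Unset Printing Implicit Defensive.

Import GRing.Theory.

Local Open Scope fset_scope.
Local Open Scope classical_set_scope.
Local Open Scope ring_scope.

(* [monalg] provides the R-module of finitely supported functions on any      *)
(* choiceType, but its product needs monoids without nontrivial units; the    *)
(* convolution product over an arbitrary group is therefore built here.       *)
Definition group_ring (R : comNzRingType) (G : groupType) : Type :=
  {malg R[G]}.

Section GroupRing.
Variables (R : comNzRingType) (G : groupType).
Implicit Types (x y z : {malg R[G]}) (g h : G).

HB.instance Definition _ := GRing.Lmodule.on (group_ring R G).

Definition gr_one : {malg R[G]} := << 1 *g 1%g >>.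

Definition gr_mul x y : {malg R[G]} :=
  \sum_(g <- msupp x) \sum_(h <- msupp y) << x@_g * y@_h *g (g * h)%g >>.

Lemma gr_mulEw (d1 d2 : {fset G}) x y :
  (msupp x `<=` d1)%fset -> (msupp y `<=` d2)%fset ->
  gr_mul x y = \sum_(g <- d1) \sum_(h <- d2) << x@_g * y@_h *g (g * h)%g >>.
Proof.
move=> le1 le2; rewrite /gr_mul (big_fset_incl _ le1) /=.
  apply/eq_bigr=> g _; apply/big_fset_incl => // h _ /mcoeff_outdom ->.
  by rewrite mulr0 monalgU0.
move=> g _ /mcoeff_outdom xg.
by rewrite big1 => // h _; rewrite xg mul0r monalgU0.
Qed.

Lemma gr_mulUU (r s : R) g h :
  gr_mul << r *g g >> << s *g h >> = << r * s *g (g * h)%g >>.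
Proof. by rewrite (gr_mulEw msuppU_le msuppU_le) !big_seq_fset1 !mcoeffUU. Qed.

Lemma gr_mulDl : left_distributive gr_mul +%R.
Proof.
move=> x y z.
rewrite [in RHS](gr_mulEw (fsubsetUl _ (msupp y)) (fsubset_refl _)).
rewrite [in RHS](gr_mulEw (fsubsetUr (msupp x) _) (fsubset_refl _)).
rewrite (gr_mulEw (msuppD_le _ _) (fsubset_refl _)) -big_split /=.
apply/eq_bigr=> g _; rewrite -big_split /=; apply/eq_bigr=> h _.
by rewrite mcoeffD mulrDl monalgUD.
Qed.

Lemma gr_mulDr : right_distributive gr_mul +%R.
Proof.
move=> z x y.
rewrite [in RHS](gr_mulEw (fsubset_refl _) (fsubsetUl _ (msupp y))).
rewrite [in RHS](gr_mulEw (fsubset_refl _) (fsubsetUr (msupp x) _)).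
rewrite (gr_mulEw (fsubset_refl _) (msuppD_le _ _)) -big_split /=.
apply/eq_bigr=> g _; rewrite -big_split /=; apply/eq_bigr=> h _.
by rewrite mcoeffD mulrDr monalgUD.
Qed.

Lemma gr_mul0l : left_zero 0 gr_mul.
Proof. by move=> x; rewrite /gr_mul msupp0 big_seq_fset0. Qed.

Lemma gr_mul0r : right_zero 0 gr_mul.
Proof. by move=> x; rewrite /gr_mul big1 // => g _; rewrite msupp0 big_seq_fset0. Qed.

Lemma gr_mul_suml (I : Type) (r : seq I) (F : I -> {malg R[G]}) y :
  gr_mul (\sum_(i <- r) F i) y = \sum_(i <- r) gr_mul (F i) y.
Proof.
exact: (big_morph (gr_mul^~ y) (fun _ _ => gr_mulDl _ _ _) (gr_mul0l _)).
Qed.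

Lemma gr_mul_sumr (I : Type) (r : seq I) (F : I -> {malg R[G]}) x :
  gr_mul x (\sum_(i <- r) F i) = \sum_(i <- r) gr_mul x (F i).
Proof.
exact: (big_morph (gr_mul x) (fun _ _ => gr_mulDr _ _ _) (gr_mul0r _)).
Qed.

Lemma gr_mul1l : left_id gr_one gr_mul.
Proof.
move=> x; rewrite [in LHS](monalgE x) gr_mul_sumr [RHS]monalgE.
by apply/eq_bigr=> g _; rewrite gr_mulUU mul1r mul1g.
Qed.

Lemma gr_mul1r : right_id gr_one gr_mul.
Proof.
move=> x; rewrite [in LHS](monalgE x) gr_mul_suml [RHS]monalgE.
by apply/eq_bigr=> g _; rewrite gr_mulUU mulr1 mulg1.
Qed.

Lemma gr_mulA : associative gr_mul.
Proof.
move=> x y z; rewrite (monalgE x) !gr_mul_suml; apply/eq_bigr=> g _.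
rewrite (monalgE y) gr_mul_sumr !gr_mul_suml gr_mul_sumr.
apply/eq_bigr=> h _.
rewrite (monalgE z) !gr_mul_sumr; apply/eq_bigr=> k _.
by rewrite !gr_mulUU mulrA mulgA.
Qed.

Lemma gr_one_neq0 : gr_one != 0.
Proof. by rewrite monalgU_eq0 oner_eq0. Qed.

HB.instance Definition _ := GRing.Zmodule_isNzRing.Build (group_ring R G)
  gr_mulA gr_mul1l gr_mul1r gr_mulDl gr_mulDr gr_one_neq0.

End GroupRing.

Definition is_orientation (G : groupType) (sigma : G -> int) : Prop :=
  (forall g, sigma g = 1 \/ sigma g = -1) /\
  (forall g h, sigma (g * h)%g = sigma g * sigma h).

Definition oker (G : groupType) (sigma : G -> int) : set G :=
  [set g | sigma g = 1].

Definition oinvol (R : comNzRingType) (G : groupType) (sigma : G -> int)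
    (x : group_ring R G) : group_ring R G :=
  \sum_(g <- msupp x) << x@_g * (sigma g)%:~R *g g^-1%g >>.

Definition antisym (R : comNzRingType) (G : groupType) (sigma : G -> int) :
    set (group_ring R G) :=
  [set x | oinvol sigma x = - x].

(* [[pchar R]] only records prime characteristics.                            *)
Definition has_char (R : comNzRingType) (n : nat) : Prop :=
  forall m : nat, (m%:R = 0 :> R) <-> (n %| m)%N.

Definition torsion2 (R : comNzRingType) : set R := [set r | r *+ 2 = 0].
Arguments torsion2 R : clear implicits.

(* Arbitrary, possibly infinite, groups and their subgroups.                  *)

Section Groups.
Local Open Scope group_scope.
Variable G : groupType.
Implicit Types (A B E : set G) (s : seq G).

Definition subgroup A : Prop :=
  [/\ A 1, forall x y, A x -> A y -> A (x * y) & forall x, A x -> A x^-1].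

Definition gen s : set G := smallest subgroup [set` s].

Definition comm_set A : Prop := forall x y, A x -> A y -> x * y = y * x.

Definition elem_abelian2 E : Prop :=
  [/\ subgroup E, comm_set E & forall x, E x -> x ^+ 2 = 1].

Definition hamiltonian2 A : Prop :=
  [/\ subgroup A, ~ comm_set A,
      forall x, A x -> exists k : nat, x ^+ (2 ^ k)%N = 1
    & forall B, subgroup B -> B `<=` A ->
        forall x y, A x -> B y -> B (y ^ x)].

(* As in [gproduct], the product is empty unless it is direct, so that        *)
(* [dprod A B = C] says that C is the internal direct product of A and B.     *)
Definition dprod A B : set G :=
  [set z | [/\ subgroup A, subgroup B, forall x y, A x -> B y -> x * y = y * x,
               A `&` B = [set 1] & exists x y, [/\ A x, B y & z = x * y]]].

End Groups.

(* The presentation syntax is that of [presentation], whose semantics is      *)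
(* restricted to finite groups; here it is interpreted in any group.          *)

Import Presentation.

Fixpoint term_eval (G : groupType) (e : seq G) (t : term) : G :=
  match t with
  | Cst i => nth 1%g e i
  | Idx => 1%g
  | Inv t1 => (term_eval e t1)^-1%g
  | Exp t1 n => (term_eval e t1 ^+ n)%g
  | Mul t1 t2 => (term_eval e t1 * term_eval e t2)%g
  | Conj t1 t2 => (term_eval e t1 ^ term_eval e t2)%g
  | Comm t1 t2 => [~ term_eval e t1, term_eval e t2]%g
  end.

Fixpoint formula_holds (G : groupType) (e : seq G) (f : formula) : Prop :=
  match f with
  | Eq2 s t => term_eval e s = term_eval e t
  | And f1 f2 => formula_holds e f1 /\ formula_holds e f2
  end.

Fixpoint relations_from (G : groupType) (e : seq G) (n : nat) (p : type) :
    Prop :=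
  match p with
  | Formula f => formula_holds e f /\ size e = n
  | Generator q => relations_from e n.+1 (q (Cst n))
  end.

Definition relations (G : groupType) (e : seq G) (p : term -> type) : Prop :=
  relations_from e 1 (p (Cst 0)).

(* Universal property of <x_1, ..., x_n | relations>: the relations hold for  *)
(* e in G, and any e' satisfying them in any group H is the image of e under  *)
(* a homomorphism from <e> to H (only the values of f on <e> are relevant).   *)
Definition presents (G : groupType) (e : seq G) (p : term -> type) : Prop :=
  relations e p /\
  forall (H : groupType) (e' : seq H), relations e' p ->
    exists f : G -> H,
      (forall x y, gen e x -> gen e y -> f (x * y)%g = (f x * f y)%g) /\
      map f e = e'.

Notation "e \presents 'Grp' ( x : p )" := (presents e (fun x => Cast p))
  (at level 70, x ident, p custom group_presentation at level 200,
   format "e  \presents  'Grp'  ( x  :  p )") : group_scope.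

(* Main.v *)
Require Import Defs.
From HB Require Import structures.
From mathcomp Require Import all_boot all_algebra.
From mathcomp Require Import presentation.
From mathcomp Require Import finmap monalg.
From mathcomp Require Import boolp classical_sets.
From mathcomp Require Import ring.
From mathcomp Require fingroup cyclic extremal.

Set Implicit Arguments.
Unset Strict Implicit.
Unset Printing Implicit Defensive.

Import GRing.Theory.

Local Open Scope classical_set_scope.
Local Open Scope group_scope.

(** The antisymmetric elements are spanned by the [r g - r sigma(g) g^-1], the [r g]
    for the involutions [g] outside the kernel [N] of [sigma], and those for the
    involutions [g] in [N] when [2 r = 0]. Comparing coefficients in the products of
    two of these turns commutativity into conditions on pairs of elements of [G],
    gathered in [skew_commute]: each pair commutes, or one of its elements inverts
    the other, or some equality between squares holds. The ring only enters through
    two facts, written [t] and [c] below: [2 r = 0] for some [r <> 0], and [4 = 0].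
    Since [2 <> 0], the latter means characteristic 4, and it implies the former
    with [r = 2]. This is the content of [antisym_commuteE] and, for the converse,
    of [antisym_commute], where torsion is asked to make the involutions of [N]
    central.

    What remains is to find the groups satisfying these conditions
    ([classification]). If [N] has exponent 2 there is nothing more to say. If some
    involution lies outside [N], either it does not commute with [N], which is then
    generalized dihedral ([outer_involution]), or it lets the conditions on mixed
    pairs descend to [N], and all noncommuting pairs generate quaternion groups of
    order 8 ([central_outer_involution]). Without involutions outside [N], the
    elements of [N] satisfy [n^4 = 1] and have central squares. An [x] outside [N]
    with [x^4 <> 1] generates with an element of [N] a group of order 16, quaternion
    ([deep_quaternion]) or semidihedral ([deep_semidihedral]). Otherwise [G] has
    exponent 4 and central squares, so that squaring is a quadratic map with values
    in an elementary abelian 2-group and with the commutator as its polar form. Each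
    condition on pairs becomes a disjunction of linear equations and inequations
    between values of this map. That some configuration of two or three elements
    exists, and that any further element of [N] is a product of elements of the
    configuration and of a central involution, follow by a finite search over such
    equations; the search is a refutation procedure on linear forms over the field
    with two elements, executed by conversion and proved sound in [entailsP].

    In each of these cases [G = K Omega], where [K] is generated by the configuration
    and [Omega] consists of the central involutions of [N]. Zorn's lemma provides
    a complement [E] of [K] in [K Omega] ([complement]), whence [G = K x E], and [N]
    splits accordingly. To see that [K] has the expected presentation, its elements
    are put in normal form and multiplied through a finite table; the table being
    valid for any group satisfying the relations, the graph of the map between the
    generators is the graph of a homomorphism ([presents_graph], [model_split]).

    For the converse, the conditions on pairs of [K x E] only depend on the
    components in [K] and are checked on the same tables ([model_skew]). When the
    ring has torsion, the involutions of [N] have to be central, and this requires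
    some power of a generator of [K] to be nontrivial: the universal property
    reduces this to an explicit quotient, found in the generalized quaternion group
    of order 16. Finally, any two noncommuting elements of a Hamiltonian 2-group
    generate a quaternion group of order 8 ([hamiltonian_Q8pair]), by Dedekind's
    argument on pairs of minimal order. *)

(** * Antisymmetric elements and commutation of pairs of group elements *)

Definition inverts (G : groupType) (y x : G) := x * y = y * x^-1.

(** What commutativity of the antisymmetric elements says about pairs of
    elements of [G]: [t] stands for [2r = 0 for some r <> 0], [c] for [4 = 0]
    in the ring, and [N] is the kernel of the orientation. *)
Record skew_commute (t c : Prop) (G : groupType) (N : pred G) : Prop := {
  sc_out : forall x y, ~~ N x -> ~~ N y ->
    [\/ commute x y, inverts y x, inverts x y
      | (x * y) ^+ 2 = 1 /\ (x * y^-1) ^+ 2 = 1];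
  sc_mix : forall x n, ~~ N x -> N n ->
    [\/ commute x n, inverts n x, x ^+ 2 = n ^+ 2 /\ x ^+ 4 = 1
      | n ^+ 2 = 1];
  sc_in : forall g h, N g -> N h -> g ^+ 2 <> 1 -> h ^+ 2 <> 1 ->
    [\/ commute g h, (g * h) ^+ 2 = 1 /\ (g * h^-1) ^+ 2 = 1
      | [/\ c, inverts h g, g ^+ 2 = h ^+ 2 & g ^+ 4 = 1]];
  sc_tor : t -> forall g h, N g -> g ^+ 2 = 1 ->
    [\/ commute g h, inverts g h | N h /\ h ^+ 2 = 1] }.

Lemma sqg1 (G : groupType) (g : G) : (g ^+ 2 = 1) <-> (g^-1 = g).
Proof.
rewrite expg2; split=> [/mulg1_eq //|e].
by rewrite -{1}e mulVg.
Qed.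

(** A predicate compatible with products in this way is the kernel of a
    homomorphism to the group of order 2. *)
Section Kernel.
Variables (G : groupType) (N : pred G).
Hypothesis NM : forall g h, N (g * h) = (N g == N h).

Lemma kernel1 : N 1. Proof. by rewrite -[1]mulg1 NM eqxx. Qed.

Lemma kernelV g : N g^-1 = N g.
Proof. by have := NM g g^-1; rewrite mulgV kernel1 => /esym/eqP->. Qed.

Lemma kernel_sq g : N (g ^+ 2). Proof. by rewrite expg2 NM eqxx. Qed.

Lemma kernel_subgroup : subgroup [set g | N g].
Proof.
by split=> [|g h /= Ng Nh|g] /=; rewrite ?kernel1 ?kernelV // NM Ng Nh.
Qed.

End Kernel.

Section PairIdentities.
Variables (G : groupType) (g h : G).

Lemma commute_quad : commute g h ->
  [/\ g * h = h * g, g * h^-1 = h^-1 * g, g^-1 * h = h * g^-1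
    & g^-1 * h^-1 = h^-1 * g^-1].
Proof.
move=> gh; split; first exact: gh.
- exact/commuteV.
- exact/commute_sym/commuteV/commute_sym.
- exact/commuteV/commute_sym/commuteV/commute_sym.
Qed.

Lemma inverts_quad : inverts h g ->
  [/\ g * h = h * g^-1, g * h^-1 = h^-1 * g^-1, g^-1 * h = h * g
    & g^-1 * h^-1 = h^-1 * g].
Proof.
rewrite /inverts => gh.
have gh' : g^-1 * h = h * g by apply: (mulgI g); rewrite mulVKg mulgA gh mulgVK.
split=> //; apply: (mulgI h); apply: (mulIg h).
  by rewrite mulVKg mulgA mulgVK gh'.
by rewrite mulVKg mulgA mulgVK gh.
Qed.

Lemma sq_mul_eq : (g * h) ^+ 2 = 1 ->
  g * h = h^-1 * g^-1 /\ g^-1 * h^-1 = h * g.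
Proof.
move=> /sqg1; rewrite invgM => e; split=> //.
by apply: (mulIg h); rewrite mulgVK -mulgA -e mulVKg.
Qed.

Lemma invertsP : inverts g h <-> g * h = h^-1 * g.
Proof.
rewrite /inverts; split=> e.
  by apply: (mulgI h); rewrite mulVKg mulgA e mulgVK.
by apply: (mulgI h^-1); rewrite mulKg mulgA -e mulgK.
Qed.

Lemma eq_mulgV k : h ^+ 2 <> 1 -> (k * h^-1 == k * h) = false.
Proof. by move=> h2; apply/eqP => /mulgI /sqg1. Qed.

Lemma eq_mulVg k : g ^+ 2 <> 1 -> (g^-1 * k == g * k) = false.
Proof. by move=> g2; apply/eqP => /mulIg /sqg1. Qed.

Lemma eq_conjV : g * h <> h * g -> (h^-1 * g == g * h^-1) = false.
Proof.
move=> gh; apply/eqP => e; apply: gh; apply: (mulgI h^-1); apply: (mulIg h^-1).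
by rewrite mulKg -e !mulgA mulgK.
Qed.

Lemma sq_mulP : g * h = h^-1 * g^-1 -> (g * h) ^+ 2 = 1.
Proof. by move=> e; apply/sqg1; rewrite invgM -e. Qed.

End PairIdentities.

Section GroupRing.
Variables (R : comNzRingType) (G : groupType) (sigma : G -> int).
Hypotheses (oS : is_orientation sigma) (two_neq0 : (2%:R != 0 :> R)%R).
Local Open Scope ring_scope.
Local Notation sg g := ((sigma g)%:~R : R).
Local Notation N := (fun g => sigma g == 1).
Local Notation U r g := (<< r *g g >> : group_ring R G).

Lemma sigmaM g h : sigma (g * h)%g = sigma g * sigma h. Proof. by case: oS. Qed.

Lemma sigma_sq g : sigma g * sigma g = 1.
Proof. by case: oS => /(_ g)[] -> _. Qed.

Lemma sigmaV g : sigma g^-1%g = sigma g.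
Proof.
have s1 : sigma 1%g = 1 by rewrite -(sigma_sq 1%g) -sigmaM mulg1.
by rewrite -[LHS]mul1r -(sigma_sq g) -mulrA -sigmaM mulgV s1 mulr1.
Qed.

Lemma sg_out g : ~~ N g -> sg g = -1.
Proof. by case: oS => /(_ g)[] ->. Qed.

Lemma sg_in g : N g -> sg g = 1.
Proof. by move/eqP->. Qed.

Lemma sg_sq g : sg g * sg g = 1.
Proof. by rewrite -intrM sigma_sq. Qed.

Lemma oinvolE (x : group_ring R G) g :
  (oinvol sigma x)@_g = x@_(g^-1%g) * sg g.
Proof.
rewrite /oinvol raddf_sum /=.
under eq_bigr => h _ do rewrite mcoeffU.
case: (msuppP x g^-1%g) => [gx|gx].
  rewrite (bigD1_seq g^-1%g) ?fset_uniq //= invgK eqxx sigmaV mulr1n big1 ?addr0 //.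
  by move=> h /negPf hg; rewrite eqg_invLR hg.
rewrite mul0r big_seq big1 // => h hx.
case: eqP => // hg; case/negP: gx; by rewrite -hg invgK.
Qed.

Lemma antisymP (x : group_ring R G) :
  antisym sigma x <-> forall g, x@_(g^-1%g) * sg g = - x@_g.
Proof.
rewrite /antisym /=; split=> [e g|e]; first by rewrite -oinvolE e mcoeffN.
by apply/malgP => g; rewrite oinvolE e mcoeffN.
Qed.

Definition skew (r : R) (g : G) : group_ring R G :=
  << r *g g >> - << r * sg g *g g^-1%g >>.

Lemma skew_antisym r g : antisym sigma (skew r g).
Proof.
apply/antisymP => h; rewrite /skew !mcoeffB !mcoeffU opprB.
rewrite mulrBl eqg_inv -eqg_invLR; congr (_ - _).
  by case: (g^-1%g =P h) => [<-|_]; rewrite ?mul0r // sigmaV.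
by case: (g =P h) => [<-|_]; rewrite ?mul0r // mulr1n -mulrA sg_sq mulr1.
Qed.

Lemma involution_antisym r g : (g ^+ 2 = 1)%g -> (N g -> r *+ 2 = 0) ->
  antisym sigma (U r g).
Proof.
move=> /sqg1 gV Nr; apply/antisymP => h; rewrite !mcoeffU.
have -> : (g == h^-1)%g = (g == h) by rewrite -eqg_invLR gV.
case: (g =P h) => [<-|_]; last by rewrite mul0r oppr0.
case: (boolP (N g)) => [Ng|gN]; last by rewrite sg_out // mulrN1.
by rewrite sg_in // mulr1 mulr1n; apply/eqP; rewrite -addr_eq0 -mulr2n Nr.
Qed.

(** With [r] the coefficient of [g] in an antisymmetric element, subtracting
    [skew r g], or [r g] when [g] is an involution, clears [g] and [g^-1] from
    the support: these elements span the antisymmetric ones. *)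
Lemma antisym_ind (P : group_ring R G -> Prop) :
  P 0 -> (forall x y, P x -> P y -> P (x + y)) ->
  (forall r g, (g ^+ 2 <> 1)%g -> P (skew r g)) ->
  (forall r g, (g ^+ 2 = 1)%g -> (N g -> r *+ 2 = 0) -> P (U r g)) ->
  forall x, antisym sigma x -> P x.
Proof.
move=> P0 PD Ps Pi x; have [n] := ubnP #|` msupp x|.
elim: n x => // n IHn x; rewrite ltnS => xn.
case: (fset_0Vmem (msupp x)) => [x0 _|[g gx] /antisymP ax].
  suff -> : x = 0 by [].
  by apply/malgP => g; rewrite mcoeff_outdom ?x0 ?inE // mcoeff0.
suff [u [Pu au usub ug]] : exists u : group_ring R G, [/\ P u, antisym sigma u,
    (msupp u `<=` msupp x)%fset & u@_g = x@_g].
  rewrite -(subrK u x); apply: PD => //; apply: IHn; last first.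
    apply/antisymP => h; rewrite !mcoeffB mulrBl ax.
    by move/antisymP: au => ->; rewrite opprB opprK addrC.
  apply: leq_trans xn; apply: fproper_ltn_card; rewrite fproperE.
  apply/andP; split.
    by apply/(fsubset_trans (msuppB_le _ _)); rewrite fsubUset fsubset_refl.
  by apply/fsubsetPn; exists g => //; rewrite -mcoeff_eq0 mcoeffB ug subrr.
case: (eqVneq (g ^+ 2)%g 1%g) => [g2|/eqP g2].
  have gV : g^-1%g = g by apply/sqg1.
  exists (U x@_g g); rewrite mcoeffUU; split => //.
  - apply: Pi => // Ng; rewrite mulr2n -[X in X + _]mulr1 -(sg_in Ng) -{1}gV ax.
    exact: addNr.
  - apply: involution_antisym => // Ng.
    rewrite mulr2n -[X in X + _]mulr1 -(sg_in Ng) -{1}gV ax; exact: addNr.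
  - by apply: (fsubset_trans msuppU_le); rewrite fsub1set.
have gV : (g^-1 != g)%g by apply/eqP => /sqg1.
exists (skew x@_g g); split; [exact: Ps | exact: skew_antisym | | ].
  apply: (fsubset_trans (msuppB_le _ _)); rewrite fsubUset.
  rewrite !(fsubset_trans msuppU_le) // fsub1set // -mcoeff_neq0.
  have := ax g^-1%g; rewrite invgK sigmaV => e.
  by rewrite -oppr_eq0 -e; apply: contraTneq gx => /(congr1 ( *%R^~ (sg g)));
     rewrite mul0r -mulrA sg_sq mulr1 -mcoeff_eq0 => /eqP.
by rewrite /skew mcoeffB mcoeffUU mcoeffU (negPf gV) subr0.
Qed.

Local Notation ch w k := ((k == w)%:R : R).

Lemma mcoeffUE (r : R) (g w : G) : (U r g)@_w = r * ch w g.
Proof. by rewrite mcoeffU mulr_natr. Qed.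

Lemma mcoeffUU2 (r s : R) (g h w : G) :
  (U r g * U s h)@_w = r * s * ch w (g * h)%g.
Proof. by rewrite -mcoeffUE; congr (_@_w); exact: gr_mulUU. Qed.

Local Notation coef g h w := (ch w (g * h)%g - sg h * ch w (g * h^-1)%g
  - sg g * ch w (g^-1 * h)%g + sg g * sg h * ch w (g^-1 * h^-1)%g).

Lemma mcoeff_skewM r s g h w : (skew r g * skew s h)@_w = r * s * coef g h w.
Proof. rewrite /skew mulrBl !mulrBr !mcoeffB !mcoeffUU2; ring. Qed.

Lemma mcoeff_Uskew r s g h w : (U r g * skew s h)@_w =
  r * s * (ch w (g * h)%g - sg h * ch w (g * h^-1)%g).
Proof. rewrite /skew !mulrBr !mcoeffB !mcoeffUU2; ring. Qed.

Lemma mcoeff_skewU r s g h w : (skew s h * U r g)@_w =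
  r * s * (ch w (h * g)%g - sg h * ch w (h^-1 * g)%g).
Proof. rewrite /skew !mulrBl !mcoeffB !mcoeffUU2; ring. Qed.

(** The eight terms of the commutator cancel two by two in each of the cases,
    except for a quaternion pair in [N], where four times a difference remains. *)
Lemma skew_skew_commute (c : Prop) r s g h :
  skew_commute False c N -> (c -> 4%:R = 0 :> R) ->
  (g ^+ 2 <> 1)%g -> (h ^+ 2 <> 1)%g ->
  skew r g * skew s h = skew s h * skew r g.
Proof.
move=> C c4 g2 h2.
suff e w : coef g h w = coef h g w.
  by apply/malgP => w; rewrite !mcoeff_skewM e (mulrC s).
have com : commute g h -> coef g h w = coef h g w.
  by case/commute_quad=> -> -> -> ->; ring.
have invh : sg g = -1 -> inverts h g -> coef g h w = coef h g w.
  by move=> ->; case/inverts_quad=> -> -> -> ->; ring.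
have invg : sg h = -1 -> inverts g h -> coef g h w = coef h g w.
  by move=> ->; case/inverts_quad=> -> -> -> ->; ring.
have sqs : sg g = sg h -> ((g * h) ^+ 2 = 1 /\ (g * h^-1) ^+ 2 = 1)%g ->
    coef g h w = coef h g w.
  move=> -> [/sq_mul_eq[-> ->] /sq_mul_eq[]]; rewrite invgK => -> ->.
  by rewrite sg_sq; ring.
have sqV (k l : G) : (k ^+ 2 = l ^+ 2 -> k^-1 * l = k * l^-1)%g.
  by move=> e; apply: (mulgI k); rewrite mulVKg mulgA -expg2 e expg2 mulgK.
have sqVV (k l : G) : (k ^+ 2 = l ^+ 2 -> k ^+ 4 = 1 -> k^-1 * l^-1 = k * l)%g.
  move=> e e4; apply: (mulgI k); apply: (mulIg l).
  rewrite mulVKg mulVg !mulgA -expg2 -mulgA -[(l * l)%g]expg2 -e -expgnDr.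
  by rewrite e4.
case: (boolP (N g)) => Ng; case: (boolP (N h)) => Nh.
- case: (sc_in C Ng Nh g2 h2) => [/com//|/sqs|[/c4 e4 hg e2 gg]].
    by apply; rewrite !sg_in.
  have h4 : (h ^+ 4 = 1)%g by rewrite (expgnA _ 2 2) -e2 -expgnA.
  have [q1 q2 q3 q4] := inverts_quad hg.
  rewrite -q1 -q2 -q3 -q4 (sqV g h) // (sqVV g h) // !sg_in // !mul1r.
  apply/eqP; rewrite -subr_eq0; apply/eqP.
  transitivity (4%:R * (ch w (g * h)%g - ch w (g * h^-1)%g)); first by ring.
  by rewrite e4 mul0r.
- have s1 := sg_out Nh.
  case: (sc_mix C Nh Ng) => [/commute_sym/com//|/(invg s1)//|[e2 e4]|//].
  have g4 : (g ^+ 4 = 1)%g by rewrite (expgnA _ 2 2) -e2 -expgnA.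
  rewrite (sqV g h) // (sqVV g h) // (sqV h g) // (sqVV h g) //.
  by rewrite (sg_in Ng) s1; ring.
- have s1 := sg_out Ng.
  case: (sc_mix C Ng Nh) => [/com//|/(invh s1)//|[e2 e4]|//].
  have h4 : (h ^+ 4 = 1)%g by rewrite (expgnA _ 2 2) -e2 -expgnA.
  rewrite (sqV g h) // (sqVV g h) // (sqV h g) // (sqVV h g) //.
  by rewrite (sg_in Nh) s1; ring.
- have [s1 s2] := (sg_out Ng, sg_out Nh).
  case: (sc_out C Ng Nh) => [/com//|/(invh s1)//|/(invg s2)//|/sqs].
  by apply; rewrite s1 s2.
Qed.

Lemma U_skew_commute (c : Prop) r s g h :
  skew_commute False c N -> ~~ N g -> (g ^+ 2 = 1)%g -> (h ^+ 2 <> 1)%g ->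
  U r g * skew s h = skew s h * U r g.
Proof.
move=> C Ng g2 h2; have gV := (sqg1 g).1 g2.
suff e w : ch w (g * h)%g - sg h * ch w (g * h^-1)%g
   = ch w (h * g)%g - sg h * ch w (h^-1 * g)%g.
  by apply/malgP => w; rewrite mcoeff_Uskew mcoeff_skewU e.
have com : commute g h -> ch w (g * h)%g - sg h * ch w (g * h^-1)%g
   = ch w (h * g)%g - sg h * ch w (h^-1 * g)%g.
  by case/commute_quad=> -> -> _ _.
have comV : inverts h g -> commute g h by rewrite /inverts gV.
case: (boolP (N h)) => Nh.
  case: (sc_mix C Ng Nh) => [/com//|/comV/com//|[]|//].
  by rewrite g2 => /esym.
have inv : inverts g h -> ch w (g * h)%g - sg h * ch w (g * h^-1)%g
   = ch w (h * g)%g - sg h * ch w (h^-1 * g)%g.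
  by case/inverts_quad=> -> _ _; rewrite gV => <-; rewrite (sg_out Nh); ring.
case: (sc_out C Ng Nh) => [/com//|/comV/com//|/inv//|[/sq_mul_eq[_]]].
by rewrite gV => e _; apply: inv; rewrite /inverts e.
Qed.

(** Torsion of [R] makes [r g] antisymmetric for each involution [g] of [N] and
    each [r] with [2 r = 0], and such elements must commute with the others. *)
Lemma antisym_commute (c : Prop) :
  skew_commute False c N -> (c -> 4%:R = 0 :> R) ->
  ((exists2 r : R, r != 0 & r *+ 2 = 0) ->
     forall g h, N g -> (g ^+ 2 = 1)%g -> commute g h) ->
  forall x y : group_ring R G,
    antisym sigma x -> antisym sigma y -> x * y = y * x.
Proof.
move=> C c4 tor x y ax ay.
have UU r s g h : commute g h -> U r g * U s h = U s h * U r g.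
  move=> gh; apply/malgP => w; rewrite !mcoeffUU2 gh; ring.
have Uin r g z : N g -> (g ^+ 2 = 1)%g -> (N g -> r *+ 2 = 0) ->
    U r g * z = z * U r g.
  move=> Ng g2 /(_ Ng) r2; have [->|r0] := eqVneq r 0.
    by rewrite monalgU0 mul0r mulr0.
  have cg : forall h, commute g h.
    by move=> h; apply: tor => //; exists r.
  rewrite (monalgE z) mulr_sumr mulr_suml; apply: eq_bigr => h _.
  exact: UU.
move: x ax y ay; apply: antisym_ind => //.
- by move=> y _; rewrite mul0r mulr0.
- by move=> x x' IH IH' y ay; rewrite mulrDl mulrDr IH // IH'.
- move=> r g g2; apply: antisym_ind => //.
  + by rewrite mul0r mulr0.
  + by move=> y y' IH IH'; rewrite mulrDr [RHS]mulrDl IH IH'.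
  + by move=> s h h2; apply: skew_skew_commute C c4 g2 h2.
  + move=> s h h2 Ns; case: (boolP (N h)) => Nh; first by rewrite -Uin.
    by apply/esym; apply: U_skew_commute C Nh h2 g2.
- move=> r g g2 Nr; case: (boolP (N g)) => Ng; first by move=> y _; apply: Uin.
  apply: antisym_ind => //.
  + by rewrite mul0r mulr0.
  + by move=> y y' IH IH'; rewrite mulrDr [RHS]mulrDl IH IH'.
  + by move=> s h h2; apply: U_skew_commute C Ng g2 h2.
  + move=> s h h2 Ns; case: (boolP (N h)) => Nh; first by rewrite -Uin.
    apply: UU; have gV := (sqg1 g).1 g2; have hV := (sqg1 h).1 h2.
    case: (sc_out C Ng Nh) => [//|e|e|[/sq_mul_eq[e _] _]]; move: e;
      rewrite /inverts ?gV ?hV => e; [exact: e | exact: esym e | exact: e].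
Qed.

Section Converse.
Hypothesis comm : forall x y : group_ring R G,
  antisym sigma x -> antisym sigma y -> x * y = y * x.

Lemma skew_coef g h w : coef g h w = coef h g w.
Proof.
have := comm (skew_antisym 1 g) (skew_antisym 1 h).
by move/(congr1 (mcoeff w)); rewrite !mcoeff_skewM !mul1r.
Qed.

Lemma involution_coef r g h w : (g ^+ 2 = 1)%g -> (N g -> r *+ 2 = 0) ->
  r * (ch w (g * h)%g - sg h * ch w (g * h^-1)%g) =
  r * (ch w (h * g)%g - sg h * ch w (h^-1 * g)%g).
Proof.
move=> g2 Nr; have := comm (involution_antisym g2 Nr) (skew_antisym 1 h).
by move/(congr1 (mcoeff w)); rewrite mcoeff_Uskew mcoeff_skewU mulr1.
Qed.

Let simpR := (@mulr0 R, @mul0r R, @mulr1 R, @mul1r R, @mulrN R, @mulNr R,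
  @opprK R, @subr0 R, @addr0 R, @add0r R, @sub0r R, @oppr0 R).

Lemma nat1B (b : bool) : (1 + b%:R != 0 :> R).
Proof. by case: b; rewrite ?addr0 ?oner_eq0. Qed.

Lemma out_inv g h : ~~ N g -> (g ^+ 2 = 1)%g -> ~~ N h ->
  commute g h \/ inverts g h.
Proof.
move=> Ng g2 Nh.
have [h2|/eqP h2] := eqVneq (h ^+ 2)%g 1%g.
  have gA : antisym sigma (U 1 g) by apply: involution_antisym => //; rewrite (negPf Ng).
  have hA : antisym sigma (U 1 h) by apply: involution_antisym => //; rewrite (negPf Nh).
  have := comm gA hA; move/(congr1 (mcoeff (g * h)%g)).
  rewrite !mcoeffUU2 !mul1r eqxx; case: eqP => [e _|_ /eqP]; first by left; exact/esym.
  by rewrite oner_eq0.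
have NF : N g -> (1 : R) *+ 2 = 0 by rewrite (negPf Ng).
have := @involution_coef 1 g h (g * h)%g g2 NF; rewrite !mul1r sg_out // !mulN1r !opprK.
rewrite eqxx eq_mulgV // addr0.
case: eqP => [e _|_]; first by left; exact/esym.
case: eqP => [e _|_]; first by right; apply/invertsP.
by rewrite addr0 => /eqP; rewrite oner_eq0.
Qed.

(** The element [g * h] is one of the eight terms of the commutator of [skew 1 g]
    and [skew 1 h], and so is [g * h^-1]: each must coincide with another one,
    and few coincidences let the coefficients add up to 0 as [2 <> 0]. *)
Lemma comm_out g h : ~~ N g -> ~~ N h ->
    [\/ commute g h, inverts h g, inverts g h
      | (g * h) ^+ 2 = 1 /\ (g * h^-1) ^+ 2 = 1]%g.
Proof.
move=> Ng Nh.
have [g2|/eqP g2] := eqVneq (g ^+ 2)%g 1%g.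
  by case: (out_inv Ng g2 Nh) => ?; [constructor 1|constructor 3].
have [h2|/eqP h2] := eqVneq (h ^+ 2)%g 1%g.
  by case: (out_inv Nh h2 Ng) => e; [constructor 1; exact: esym | constructor 2].
have E w := skew_coef g h w; rewrite !sg_out // in E.
case: (g * h =P h * g)%g => [?|n1]; first by constructor 1.
case: (g * h =P h * g^-1)%g => [?|n2]; first by constructor 2.
case: (g * h =P h^-1 * g)%g => [?|n3]; first by constructor 3; apply/invertsP.
case: (g * h =P h^-1 * g^-1)%g => [e4|n4]; last first.
  have := E (g * h)%g; rewrite eqxx eq_mulgV // eq_mulVg //.
  move: n1 n2 n3 n4; do 4![move/eqP; rewrite eq_sym => /negPf ->].
  rewrite !mulr0 !mulN1r !opprK mul1r !subr0 => /eqP; rewrite addr0.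
  by rewrite (negPf (nat1B _)).
constructor 4; split; first exact: sq_mulP.
apply: sq_mulP; rewrite invgK; apply: contrapT => n5.
have := E (g * h^-1)%g.
have -> : (g * h == g * h^-1)%g = false by rewrite eq_sym eq_mulgV.
have -> : (g^-1 * h^-1 == g * h^-1)%g = false by rewrite eq_mulVg.
have -> : (h * g^-1 == g * h^-1)%g = false by apply/eqP => /esym.
rewrite (eq_conjV n1).
have -> : (h^-1 * g^-1 == g * h^-1)%g = false by rewrite -e4 eq_sym eq_mulgV.
have -> : (h * g == g * h^-1)%g = false.
  by apply/eqP => e; apply: n3; apply/invertsP.
rewrite eqxx !mulr0 !mulN1r !opprK !subr0 !addr0 add0r => /eqP.
by rewrite (negPf (nat1B _)).
Qed.

Lemma comm_mix g h : ~~ N g -> N h ->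
    [\/ commute g h, inverts h g, g ^+ 2 = h ^+ 2 /\ g ^+ 4 = 1
      | h ^+ 2 = 1]%g.
Proof.
move=> Ng Nh; have [h2|/eqP h2] := eqVneq (h ^+ 2)%g 1%g; first by constructor 4.
have [g2|/eqP g2] := eqVneq (g ^+ 2)%g 1%g.
  have NF : N g -> (1 : R) *+ 2 = 0 by rewrite (negPf Ng).
  have := @involution_coef 1 g h (g * h)%g g2 NF; rewrite !mul1r sg_in //.
  rewrite eqxx eq_mulgV // mulr0 subr0 mul1r.
  case: eqP => [e _|_ /eqP]; first by constructor 1; exact/esym.
  by rewrite add0r -addr_eq0 (negPf (nat1B _)).
have E w := skew_coef g h w; rewrite (sg_in Nh) sg_out // in E.
case: (g * h =P h * g)%g => [?|n1]; first by constructor 1.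
case: (g * h =P h * g^-1)%g => [?|n2]; first by constructor 2.
have gVF k : (k * g^-1 == k * g)%g = false by apply: eq_mulgV.
case: (g * h =P g^-1 * h^-1)%g => [e|n3]; last first.
  have := E (g * h)%g; rewrite eqxx eq_mulgV // eq_mulVg //.
  move: n1 n2 n3; do 3![move/eqP; rewrite eq_sym => /negPf ->].
  rewrite !simpR.
  case: (h^-1 * g =P g * h)%g => [<-|_].
    by rewrite gVF !simpR => /eqP; rewrite -addr_eq0 (negPf (nat1B true)).
  by rewrite !simpR => /eqP; rewrite -addr_eq0 (negPf (nat1B _)).
have := E (g * h^-1)%g.
have -> : (g * h == g * h^-1)%g = false by rewrite eq_sym eq_mulgV.
have -> : (g^-1 * h^-1 == g * h^-1)%g = false by rewrite eq_mulVg.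
rewrite (eq_conjV n1).
have -> : (h^-1 * g^-1 == g * h^-1)%g = false.
  apply/eqP => e'; apply: n2; apply: (mulIg h^-1%g); rewrite mulgK.
  have e2 : (g^-1 = h * (g * h^-1))%g by rewrite -e' mulVKg.
  by rewrite -[LHS]invgK [in LHS]e2 !invgM invgK.
rewrite eqxx; case: (g^-1 * h =P g * h^-1)%g => [e2 _|_].
  have gh : (g ^+ 2 = h ^+ 2)%g.
    by rewrite !expg2; apply: (mulgI g^-1%g); rewrite mulKg mulgA e2 mulgVK.
  constructor 3; split=> //; rewrite (expgnA _ 2 2) expg2 {2}gh !expg2.
  by rewrite -!mulgA (mulgA g h) e !mulgA mulgV mul1g mulVg.
case: (h * g =P g * h^-1)%g => [<-|_].
  rewrite gVF !simpR => /eqP.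
  by rewrite eq_sym -addr_eq0 (negPf (nat1B true)).
rewrite !simpR => /eqP.
by rewrite eq_sym -addr_eq0 addrC (negPf (nat1B _)).
Qed.

(** At [g * h] the coefficients give [1 + d = - (b + b')], each of [d], [b] and
    [b'] being 0 or 1 according to a coincidence between terms. All three are 1
    for a quaternion pair, whence [4 = 0]. *)
Lemma comm_in g h : N g -> N h -> (g ^+ 2 <> 1 -> h ^+ 2 <> 1 ->
    [\/ commute g h, (g * h) ^+ 2 = 1 /\ (g * h^-1) ^+ 2 = 1
      | [/\ 4%:R = 0 :> R, inverts h g, g ^+ 2 = h ^+ 2 & g ^+ 4 = 1]])%g.
Proof.
move=> Ng Nh g2 h2.
have E w := skew_coef g h w; rewrite !sg_in // in E.
case: (g * h =P h * g)%g => [?|n1]; first by constructor 1.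
have E1 := E (g * h)%g; have E2 := E (g * h^-1)%g.
case: (g * h =P h^-1 * g^-1)%g => [e4|n4].
  constructor 2; split; first exact: sq_mulP.
  apply: sq_mulP; rewrite invgK; apply: contrapT => n5; move: E2.
  have -> : (g * h == g * h^-1)%g = false by rewrite eq_sym eq_mulgV.
  have -> : (g^-1 * h^-1 == g * h^-1)%g = false by rewrite eq_mulVg.
  have -> : (h * g^-1 == g * h^-1)%g = false by apply/eqP => /esym.
  rewrite (eq_conjV n1).
  have -> : (h^-1 * g^-1 == g * h^-1)%g = false by rewrite -e4 eq_sym eq_mulgV.
  have -> : (h * g == g * h^-1)%g = false.
    apply/eqP => e; apply: g2; have [_] := sq_mul_eq (sq_mulP e4).
    by rewrite e => /mulIg /sqg1.
  rewrite eqxx !simpR -opprD => /eqP.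
  by rewrite oppr_eq0 (negPf (nat1B _)).
have inv : (g * h = h * g^-1)%g \/ (g * h = h^-1 * g)%g.
  case: (g * h =P h * g^-1)%g => [?|n2]; first by left.
  case: (g * h =P h^-1 * g)%g => [?|n3]; first by right.
  move: E1; rewrite eqxx eq_mulgV // eq_mulVg //.
  move: n1 n2 n3 n4; do 4![move/eqP; rewrite eq_sym => /negPf ->].
  rewrite !simpR => /eqP.
  by rewrite (negPf (nat1B _)).
have sqV (k l : G) : (k ^+ 2 = l ^+ 2 -> k ^+ 4 = 1 ->
    [/\ k^-1 * l^-1 = k * l & k * l^-1 = k^-1 * l] :> Prop)%g.
  move=> e e4; have kl : (k * k * (l * l) = 1)%g.
    by rewrite -[(k * k)%g]expg2 -[(l * l)%g]expg2 -e -expgnDr.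
  split; apply: (mulgI k); apply: (mulIg l).
    by rewrite mulVKg mulVg -kl !mulgA.
  by rewrite mulVKg !mulgA mulgVK -!expg2 e.
have quat (k l : G) : (inverts l k -> commute (k ^+ 2) l -> k ^+ 4 = 1)%g.
  move=> kl c2; have : (k ^+ 2 * l = l * (k^-1) ^+ 2)%g.
    by rewrite !expg2 -mulgA kl mulgA kl -mulgA.
  by rewrite c2 => /mulgI e2; rewrite (expgnA _ 2 2) expg2 {2}e2 expVgn mulgV.
pose d := (g^-1 * h^-1 == g * h)%g.
pose b := (h * g^-1 == g * h)%g; pose b' := (h^-1 * g == g * h)%g.
have {}E1 : 1 + d%:R = - (b%:R + b'%:R) :> R.
  move: E1; rewrite eqxx eq_mulgV // eq_mulVg // -/d -/b -/b'.
  by move: n1 n4; do 2![move/eqP; rewrite eq_sym => /negPf ->];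
     rewrite !simpR opprD addrC.
have fin : inverts h g -> (g ^+ 2 = h ^+ 2)%g ->
    [/\ 4%:R = 0 :> R, inverts h g, g ^+ 2 = h ^+ 2 & g ^+ 4 = 1]%g.
  move=> hg e; have g4 : (g ^+ 4 = 1)%g.
    by apply: quat hg _; rewrite e; apply/commute_sym/commuteX.
  split=> //.
  have h4 : (h ^+ 4 = 1)%g by rewrite (expgnA _ 2 2) -e -expgnA.
  have [e1 e2] := sqV _ _ e g4; have [e3 e4] := sqV _ _ (esym e) h4.
  move: E1; rewrite /d /b /b' e1 -e4 -hg eqxx => /eqP.
  by rewrite -subr_eq0 opprK => /eqP <-; rewrite -!natrD.
constructor 3; case: (boolP d) => [/eqP/esym ed|nd].
  have gh2 : (g ^+ 2 = h ^- 2)%g.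
    rewrite !expg2 invgM; apply: (mulgI g^-1%g); apply: (mulIg h).
    by rewrite mulKg ed !mulgA mulgVK.
  case: inv => [hg|/invertsP gh].
    apply: fin => //; apply/esym; have : (g ^+ 4 = 1)%g.
      apply: quat hg _; rewrite gh2; exact/commute_sym/commuteV/commuteX.
    by rewrite (expgnA _ 2 2) => /sqg1 <-; rewrite gh2 invgK.
  have h4 : (h ^+ 4 = 1)%g.
    apply: quat gh _; rewrite -[(h ^+ 2)%g]invgK -gh2.
    exact/commute_sym/commuteV/commuteX.
  have gh2' : (g ^+ 2 = h ^+ 2)%g.
    by rewrite gh2; apply/sqg1; rewrite -expgnA.
  apply: fin => //; rewrite /inverts (invertsP g h).1 //.
  apply: (mulgI h); apply: (mulIg g); rewrite mulVKg -expg2 gh2'.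
  by rewrite !mulgA mulgVK -expg2.
have [eb|nb] := boolP b; have [eb'|nb'] := boolP b'; last first.
- by case: inv nb nb' => e; rewrite /b /b' -e eqxx.
- by move: E1; rewrite (negPf nd) (negPf nb) eb' !simpR => /eqP;
     rewrite -addr_eq0 (negPf (nat1B true)).
- by move: E1; rewrite (negPf nd) (negPf nb') eb !simpR => /eqP;
     rewrite -addr_eq0 (negPf (nat1B true)).
apply: fin; first exact/esym/eqP.
move/eqP: eb' => e; move/eqP: eb; rewrite -e => e2.
rewrite !expg2; apply: (mulgI h^-1%g); apply: (mulIg g^-1%g).
by rewrite !mulgA mulgK -e2 mulVg mul1g.
Qed.

Lemma comm_tor g h : (exists2 r : R, r != 0 & r *+ 2 = 0) ->
  N g -> (g ^+ 2 = 1)%g ->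
  [\/ commute g h, inverts g h | N h /\ h ^+ 2 = 1]%g.
Proof.
move=> [r r0 r2] Ng g2.
have [h2|/eqP h2] := eqVneq (h ^+ 2)%g 1%g.
  have [Nh|Nh] := boolP (N h); first by constructor 3.
  have gA : antisym sigma (U r g) by apply: involution_antisym.
  have hA : antisym sigma (U 1 h).
    by apply: involution_antisym => //; rewrite (negPf Nh).
  have := comm gA hA; move/(congr1 (mcoeff (g * h)%g)).
  rewrite !mcoeffUU2 eqxx !simpR; case: eqP => [e _|_ /eqP].
    by constructor 1; exact/esym.
  by rewrite !simpR (negPf r0).
have := @involution_coef r g h (g * h)%g g2 (fun=> r2).
rewrite eqxx eq_mulgV // !simpR.
case: eqP => [e _|_]; first by constructor 1; exact/esym.
case: eqP => [e _|_]; first by constructor 2; apply/invertsP.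
by rewrite !simpR => /eqP; rewrite (negPf r0).
Qed.

End Converse.

Lemma antisym_commuteE (t := exists2 r : R, r != 0 & r *+ 2 = 0)
    (c := 4%:R = 0 :> R) :
  (forall x y : group_ring R G,
    antisym sigma x -> antisym sigma y -> x * y = y * x) ->
  skew_commute t c N.
Proof.
move=> comm; split=> *.
- exact: comm_out.
- exact: comm_mix.
- exact: comm_in.
- exact: comm_tor.
Qed.

End GroupRing.

(** * Generated subgroups, direct products and presentations *)

Section Subgroups.
Variable G : groupType.
Implicit Types (A B K L E Om W : set G) (s : seq G) (x y z g : G).

Lemma subgroup_gen s : subgroup (gen s).
Proof.
split=> [M [[]]|x y xs ys M sM|x xs M sM] //.
  by case: (sM) => -[_ mulM _] _; apply: mulM; [exact: xs | exact: ys].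
by case: (sM) => -[_ _ invM] _; apply: invM; exact: xs.
Qed.

Lemma mem_gen s x : x \in s -> gen s x.
Proof. by move=> xs; apply: sub_gen_smallest. Qed.

Lemma gen_min s A : subgroup A -> (forall x, x \in s -> A x) -> gen s `<=` A.
Proof. by move=> sA sub; apply: smallest_sub. Qed.

Lemma subgroupX A x n : subgroup A -> A x -> A (x ^+ n).
Proof. by case=> A1 AM _ Ax; elim: n => // n IHn; rewrite expgS; apply: AM. Qed.

(** Finite order lets one forget about inverses. *)
Lemma gen_words s W : W 1 ->
  (forall x w, x \in s -> W w -> W (w * x)) ->
  (forall x, x \in s -> exists n, x ^+ n.+1 = 1) -> gen s `<=` W.
Proof.
move=> W1 WM fin.
pose S := [set y | forall w, W w -> W (w * y) /\ W (w * y^-1)].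
suff gS : gen s `<=` S by move=> y /gS /(_ 1 W1) []; rewrite mul1g.
apply: gen_min => [|x xs w Ww].
  split=> [w|x y Sx Sy w Ww|x Sx w /Sx[]].
  - by rewrite invg1 mulg1.
  - rewrite invgM !mulgA; split.
      by have [/Sy[]] := Sx w Ww.
    by have [_ /Sx[]] := Sy w Ww.
  - by rewrite invgK.
split; first exact: WM.
have WX n : W (w * x ^+ n).
  by elim: n => [|n IHn]; rewrite ?mulg1 // expgSr mulgA; apply: WM.
have [n xn] := fin x xs; suff -> : x^-1 = x ^+ n by [].
by apply: mulg1_eq; rewrite -expgS.
Qed.

Lemma dprodE A B z : subgroup A -> subgroup B ->
  (forall x y, A x -> B y -> commute x y) -> (forall x, A x -> B x -> x = 1) ->
  dprod A B z <-> exists x y, [/\ A x, B y & z = x * y].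
Proof.
move=> sA sB AB tiAB; split=> [[]//|zAB]; split=> //.
apply/seteqP; split=> x /=; first by case=> /tiAB.
by move=> ->; case: sA sB => ? _ _ [].
Qed.

(** In an elementary abelian [Om] a subgroup maximal among those meeting [K]
    trivially is a complement of [K] in [K Om]. *)
Lemma complement K Om : subgroup K -> Om 1 ->
  (forall x y, Om x -> Om y -> Om (x * y)) ->
  (forall x, Om x -> x ^+ 2 = 1 /\ forall g, commute x g) ->
  exists E, [/\ elem_abelian2 E, E `<=` Om, forall x, K x -> E x -> x = 1
    & forall w, Om w -> exists k e, [/\ K k, E e & w = k * e]].
Proof.
move=> sK Om1 OmM Om2; have [K1 KM KV] := sK.
pose P A := [/\ forall x y, A x -> A y -> A (x * y), A `<=` Om
  & forall x, K x -> A x -> x = 1].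
have /Zorn_bigcup[E [PE maxE]] F : F `<=` P -> total_on F subset ->
    P (\bigcup_(X in F) X).
  move=> FP totF; split.
  - move=> x y [X FX Xx] [Y FY Yy].
    have [XY|YX] := totF X Y FX FY.
      by exists Y => //; case: (FP Y FY) => YM _ _; apply: YM => //; apply: XY.
    by exists X => //; case: (FP X FX) => XM _ _; apply: XM => //; apply: YX.
  - by move=> x [X FX Xx]; case: (FP X FX) => _ XO _; apply: XO.
  - by move=> x Kx [X FX Xx]; case: (FP X FX) => _ _; apply.
have max B : P B -> E `<=` B -> B `<=` E.
  by move=> PB EB; apply: contrapT => nBE; apply: (maxE B).
have [EM EOm EK] := PE.
have E1 : E 1.
  apply: (max (E `|` [set 1])); [|by move=> x Ex; left|by right].
  split.
  - move=> x y [Ex|->] [Ey|->]; [left|left|left|right]; rewrite ?mulg1 ?mul1g //.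
    exact: EM.
  - by move=> x [Ex|->]; [apply: EOm|].
  - by move=> x Kx [Ex|//]; apply: EK.
have EV x : E x -> x^-1 = x by move=> /EOm/Om2[/sqg1].
exists E; split=> //.
  split=> [|x y Ex _|x /EOm/Om2[]//].
    by split=> // z Ez; rewrite EV.
  by case: (Om2 x (EOm _ Ex)) => _ /(_ y).
move=> w Ow; apply: contrapT => nw.
have w2 := (Om2 w Ow).1; have wC := (Om2 w Ow).2.
pose B := [set x | E x \/ E (x * w)].
have PB : P B.
  split.
  - move=> x y [Ex|Exw] [Ey|Eyw].
    + by left; apply: EM.
    + by right; rewrite -mulgA; apply: EM.
    + by right; rewrite -mulgA -(wC y) mulgA; apply: EM.
    + left; suff -> : x * y = (x * w) * (y * w) by apply: EM.
      by rewrite -mulgA (wC (y * w)) -!mulgA -expg2 w2 mulg1.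
  - move=> x [/EOm//|/EOm Oxw].
    by rewrite -[x]mulg1 -w2 expg2 mulgA; apply: OmM.
  - move=> x Kx [/EK->//|Exw]; case: nw; exists x^-1, (x * w).
    by rewrite mulKg; split=> //; apply: KV.
apply: nw; exists 1, w; split; rewrite ?mul1g //.
apply: (max B PB); first by left.
by right; rewrite -expg2 w2.
Qed.

(** The complement [E] of [K] given by the previous lemma lies in [N], so that it
    also splits the intersection [L] of [K] and [N] off [N]. *)
Lemma direct_split (N : pred G) K L Om : subgroup K -> subgroup L ->
  (forall x, L x <-> K x /\ N x) ->
  (forall x y, N x -> N y -> N (x * y)) -> (forall x, N x -> N x^-1) ->
  Om 1 -> (forall x y, Om x -> Om y -> Om (x * y)) ->
  (forall x, Om x -> [/\ N x, x ^+ 2 = 1 & forall g, commute x g]) ->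
  (forall g, exists k w, [/\ K k, Om w & g = k * w]) ->
  exists E, [/\ elem_abelian2 E, [set: G] = dprod K E
              & [set x | N x] = dprod L E].
Proof.
move=> sK sL LKN NM NV O1 OM O2 KOm.
have [|E [aE EO KE OKE]] := complement sK O1 OM.
  by move=> x /O2[].
have [sE _ _] := aE; have EC x g : E x -> commute g x.
  by move=> /EO/O2[_ _ /(_ g)/commute_sym].
have GE g : exists k e, [/\ K k, E e & g = k * e].
  have [k [w [Kk /OKE[k' [e [Kk' Ee ->]]] ->]]] := KOm g.
  by exists (k * k'), e; rewrite mulgA; split=> //; case: sK => _ KM _; apply: KM.
exists E; split=> //; apply/seteqP; split=> // g /=.
- move=> _; apply/dprodE => // x y _; exact: EC.
- move=> Ng; apply/dprodE => //.
  + by move=> x y _; apply: EC.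
  + by move=> x /LKN[Kx _]; apply: KE.
  have [k [e [Kk Ee ge]]] := GE g; exists k, e; split=> //.
  apply/LKN; split=> //; rewrite -(mulgK e k) -ge; apply: NM => //.
  by apply: NV; case: (O2 _ (EO _ Ee)).
- move/dprodE => [] //.
  + by move=> x y _; apply: EC.
  + by move=> x /LKN[Kx _]; apply: KE.
  move=> x [y [/LKN[_ Nx] Ey ->]]; apply: NM => //.
  by case: (O2 _ (EO _ Ey)).
Qed.

End Subgroups.

Section Presents.
Variable G : groupType.

(** The subgroup of [G * H] generated by matching pairs of generators is the
    graph of the homomorphism wanted by the universal property as soon as it
    meets [1 * H] trivially. *)
Lemma presents_graph (e : seq G) p : relations e p ->
  (forall (H : groupType) (e' : seq H), relations e' p ->
     size e' = size e /\ forall h, gen (zip e e') (1, h) -> h = 1) ->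
  presents e p.
Proof.
move=> ep graph; split=> // H e' e'p.
have [sz inj] := graph H e' e'p; pose D := gen (zip e e').
have [D1 DM DV] := subgroup_gen (zip e e').
have uniq x h h' : D (x, h) -> D (x, h') -> h = h'.
  move=> xh xh'; apply: divg1_eq; apply: inj.
  by rewrite -(mulgV x); exact: DM xh (DV _ xh').
have dom x : gen e x -> exists h, D (x, h).
  pose X := [set x | exists h, D (x, h)].
  suff eX : gen e `<=` X by move=> /eX.
  apply: gen_min => [|{}x xe].
    split=> [|y z [h yh] [h' zh']|y [h yh]].
    - by exists 1.
    - by exists (h * h'); apply: DM yh zh'.
    - by exists h^-1; apply: DV yh.
  exists (nth 1 e' (index x e)); apply: mem_gen.
  rewrite -{1}(nth_index 1 xe) -nth_zip ?sz //; apply: mem_nth.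
  by rewrite size_zip sz minnn index_mem.
pose f x := xget 1 [set h | D (x, h)].
have fP x h : D (x, h) -> f x = h.
  by move=> xh; apply: (uniq x) => //; rewrite /f; case: xgetP => // /(_ h).
exists f; split.
  move=> x y /dom[h xh] /dom[h' yh']; rewrite (fP _ _ xh) (fP _ _ yh').
  exact: fP (DM _ _ xh yh').
apply: (@eq_from_nth _ 1); rewrite size_map ?sz // => i ie.
rewrite (nth_map 1) //; apply: fP; apply: mem_gen; rewrite -nth_zip ?sz //.
by apply: mem_nth; rewrite size_zip sz minnn.
Qed.

End Presents.

(** * Computing in a subgroup through a finite multiplication table *)

Section Model.
Variables (M : eqType) (mul : M -> M -> M) (one : M) (els : seq M).
Implicit Types (m : M) (gs ls S : seq M).

Definition pw m n := iter n (mul m) one.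

(** All the groups concerned have exponent dividing 8. *)
Definition inv m := pw m 7.

Definition table_ok := [&& one \in els, mul one one == one,
  all (fun x => all (fun y => mul x y \in els) els) els,
  all (fun x => pw x 8 == one) els
  & all (fun x => all (fun y => (mul x (inv y) == one) ==> (x == y)) els) els].

(** Eight rounds exhaust the subgroups of all the tables considered, which
    [closure_ok] verifies. *)
Definition generated gs :=
  iter 8 (fun l => undup (l ++ [seq mul x g | x <- l, g <- gs])) [:: one].

Definition closure_ok gs := let l := generated gs in
  [&& all (mem els) gs, one \in l, all (mem els) l
    & all (fun x => all (fun g => mul x g \in l) gs) l].

(** An element other than [one] is nontrivial in the group when it, its square,
    its fourth power or one of its commutators lies in a list [S] of elements
    which are nontrivial there. *)
Definition nondeg S := all (fun m => (m == one) || has (fun s => [|| m == s,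
  mul m m == s, pw m 4 == s | has (fun y => mul m y == mul (mul y m) s) els]) S) els.

Definition skew_ok (NM : pred M) (cf : bool) :=
  let com x y := mul x y == mul y x in
  let inverts y x := mul x y == mul y (inv x) in
  let sq1 x := mul x x == one in
  all (fun x => all (fun y =>
    let weak := [|| com x y, inverts y x | inverts x y] in
    match NM x, NM y with
    | false, false => weak || sq1 (mul x y) && sq1 (mul x (inv y))
    | false, true => [|| com x y, inverts y x,
        (mul x x == mul y y) && (pw x 4 == one) | sq1 y]
    | true, false => true
    | true, true => [|| com x y, sq1 x, sq1 y,
         sq1 (mul x y) && sq1 (mul x (inv y))
        | [&& cf, inverts y x, mul x x == mul y y & pw x 4 == one]]
    end) els) els.

Definition dprod_ok S l1 l2 :=
  let g1 := generated l1 in let g2 := generated l2 in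
  [&& nondeg S, closure_ok l1, closure_ok l2, closure_ok (l1 ++ l2),
    all (fun x => all (fun y => (mul x y == mul y x) &&
      ((x == y) ==> (x == one))) g2) g1
    & all (fun x => has (fun y => has (fun z => x == mul y z) g2) g1)
        (generated (l1 ++ l2))].

(** An element of square [s] is not an involution once [s] is nontrivial. *)
Definition torsion_ok (NM : pred M) s := all (fun x => NM x ==>
  (mul x x == s) || all (fun y => mul x y == mul y x) els) els.

Section Eval.
Variables (G : groupType) (ev : M -> G).
Hypotheses (evM : forall x y, ev (mul x y) = ev x * ev y) (ok : table_ok).

Lemma ev1 : ev one = 1.
Proof.
have /and5P[_ /eqP e _ _ _] := ok.
by apply: (mulgI (ev one)); rewrite -evM e mulg1.
Qed.

Lemma ev_pw x n : ev (pw x n) = ev x ^+ n.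
Proof. by elim: n => [|n IHn]; rewrite ?ev1 //= evM IHn expgS. Qed.

Lemma els_one : one \in els. Proof. by case/and5P: ok. Qed.

Lemma els_mul x y : x \in els -> y \in els -> mul x y \in els.
Proof. by case/and5P: ok => _ _ /allP h _ _ /h/allP; apply. Qed.

Lemma ev_exp8 x : x \in els -> ev x ^+ 8 = 1.
Proof.
case/and5P: ok => _ _ _ /allP h _ /h/eqP e; by rewrite -ev_pw e ev1.
Qed.

Lemma ev_inv x : x \in els -> ev (inv x) = (ev x)^-1.
Proof. by move=> /ev_exp8 x8; rewrite ev_pw; apply/esym/mulg1_eq; rewrite -expgS. Qed.

Lemma gen_closureP gs z : closure_ok gs ->
  gen (map ev gs) z <-> exists2 m, m \in generated gs & z = ev m.
Proof.
move=> /and4P[/allP gsE one_cl /allP clE /allP cl]; split.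
  apply: (@gen_words _ (map ev gs) (fun z => exists2 m, m \in generated gs & z = ev m)).
  - by exists one; rewrite ?ev1.
  - move=> _ _ /mapP[g gg ->] [x xc ->]; exists (mul x g); rewrite ?evM //.
    by have /allP := cl x xc; apply.
  - by move=> _ /mapP[g gg ->]; exists 7%N; apply: ev_exp8; apply: gsE.
case=> m mc ->{z}; have [_ genM _] := subgroup_gen (map ev gs).
move: m mc; rewrite /generated; elim: 8 => [|n IHn] m.
  by rewrite inE => /eqP->; rewrite ev1; case: (subgroup_gen (map ev gs)).
rewrite mem_undup mem_cat => /orP[/IHn//|/allpairsP[[x g] /= [/IHn xl gg ->]]].
by rewrite evM; apply: genM => //; apply: mem_gen; apply: map_f.
Qed.

Lemma ev_eq1 S m : nondeg S -> (forall s, s \in S -> ev s <> 1) ->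
  m \in els -> ev m = 1 -> m = one.
Proof.
move=> /allP nd nS /nd/orP[/eqP//|/hasP[s sS /or4P[/eqP->|/eqP e|/eqP e|/hasP[y _ /eqP e]]]].
- by move/(nS s sS).
- by move=> m1; case: (nS s sS); rewrite -e evM m1 mulg1.
- by move=> m1; case: (nS s sS); rewrite -e ev_pw m1 expg1n.
- move=> m1; case: (nS s sS); move/(congr1 ev): e; rewrite !evM m1 mul1g mulg1.
  by rewrite -{1}[ev y]mulg1 => /mulgI.
Qed.

Lemma ev_inj S x y : nondeg S -> (forall s, s \in S -> ev s <> 1) ->
  x \in els -> y \in els -> ev x = ev y -> x = y.
Proof.
move=> nd nS xE yE xy; have /and5P[_ _ _ _ /allP h] := ok.
have /allP/(_ y yE)/implyP := h x xE => h'; apply/eqP/h'/eqP.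
apply: (ev_eq1 nd nS); last by rewrite evM ev_inv // xy mulgV.
by apply: els_mul => //; rewrite /inv; elim: 7 => [|n IHn] /=;
  rewrite ?els_one ?els_mul.
Qed.

Lemma dprod_closure S l1 l2 : dprod_ok S l1 l2 ->
  (forall s, s \in S -> ev s <> 1) ->
  dprod (gen (map ev l1)) (gen (map ev l2)) = gen (map ev (l1 ++ l2)).
Proof.
case/and5P=> nd ok1 ok2 ok12 /andP[/allP sep /allP dec] nS.
have [s1 s2] := (subgroup_gen (map ev l1), subgroup_gen (map ev l2)).
have g1 z := gen_closureP z ok1; have g2 z := gen_closureP z ok2.
have com x y : gen (map ev l1) x -> gen (map ev l2) y -> commute x y.
  move=> /g1[m mc ->] /g2[m' mc' ->].
  have /allP/(_ m' mc')/andP[/eqP e _] := sep m mc.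
  by rewrite /commute -!evM e.
have ti x : gen (map ev l1) x -> gen (map ev l2) x -> x = 1.
  move=> /g1[m mc ->] /g2[m' mc' e].
  have /allP/(_ m' mc')/andP[_ /implyP h] := sep m mc.
  rewrite (eqP (h _)) ?ev1 //; apply/eqP; apply: (ev_inj nd nS) => //.
    by have /and4P[_ _ /allP/(_ m mc)] := ok1.
  by have /and4P[_ _ /allP/(_ m' mc')] := ok2.
apply/seteqP; split=> z.
  move/(dprodE _ s1 s2 com ti) => [x [y [x1 y2 ->]]].
  have [_ genM _] := subgroup_gen (map ev (l1 ++ l2)).
  have sub l : {subset l <= l1 ++ l2} -> gen (map ev l) `<=` gen (map ev (l1 ++ l2)).
    move=> ll; apply: gen_min (subgroup_gen _) _ => _ /mapP[m ml ->].
    by apply: mem_gen; apply: map_f; apply: ll.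
  apply: genM; [apply: sub x1|apply: sub y2] => m; rewrite mem_cat => ->//.
  by rewrite orbT.
move/(gen_closureP _ ok12) => [m mc ->].
apply: (proj2 (dprodE _ s1 s2 com ti)).
have /hasP[x xc /hasP[y yc /eqP ->]] := dec m mc.
exists (ev x), (ev y); split; rewrite ?evM //.
  by apply/g1; exists x.
by apply/g2; exists y.
Qed.

(** Checking the pairs of table elements suffices when [G] is the product of the
    image of the table and of central elements of exponent 2. *)
Lemma model_skew (N NM : pred _) (cf : bool) (c : Prop) : (cf -> c) ->
  (forall g : G, exists m e, [/\ m \in els, g = ev m * e, e ^+ 2 = 1,
     forall h, commute e h & N g = NM m]) ->
  skew_ok NM cf -> skew_commute False c N.
Proof.
move=> cfc dec /allP chk.
pose Z := [set e : G | e ^+ 2 = 1 /\ forall h, commute e h].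
have ZM e f : Z e -> Z f -> Z (e * f).
  move=> [e2 eC] [f2 fC]; split; first by rewrite expgMn // e2 f2 mulg1.
  by move=> h; apply/commute_sym/commuteM; apply/commute_sym.
have mulE x y e f : Z e -> ev x * e * (ev y * f) = ev (mul x y) * (e * f).
  by move=> [_ eC]; rewrite evM -!mulgA; congr (_ * _); rewrite !mulgA eC.
have invE x e : x \in els -> Z e -> (ev x * e)^-1 = ev (inv x) * e.
  by move=> xE [/sqg1 e2 eC]; rewrite invgM ev_inv // e2 eC.
have sqE x e : Z e -> (ev x * e) ^+ 2 = ev (mul x x).
  by move=> eZ; rewrite expg2 mulE // -expg2 (proj1 eZ) mulg1.
have comE x y e f : Z e -> Z f -> mul x y == mul y x ->
    commute (ev x * e) (ev y * f).
  by move=> eZ fZ /eqP xy; rewrite /commute !mulE // xy (proj2 eZ f).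
have invsE x y e f : x \in els -> Z e -> Z f -> mul x y == mul y (inv x) ->
    inverts (ev y * f) (ev x * e).
  by move=> xE eZ fZ /eqP xy; rewrite /inverts invE // !mulE // xy (proj2 eZ f).
have sq1E x e : Z e -> mul x x == one -> (ev x * e) ^+ 2 = 1.
  by move=> eZ /eqP xx; rewrite sqE // xx ev1.
have sq2E x y e f : y \in els -> Z e -> Z f -> mul (mul x y) (mul x y) == one ->
    mul (mul x (inv y)) (mul x (inv y)) == one ->
    (ev x * e * (ev y * f)) ^+ 2 = 1 /\ (ev x * e * (ev y * f)^-1) ^+ 2 = 1.
  by move=> yE eZ fZ h1 h2; rewrite invE // !mulE // !sq1E //; apply: ZM.
have sqeqE x y e f : Z e -> Z f -> mul x x == mul y y ->
    (ev x * e) ^+ 2 = (ev y * f) ^+ 2.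
  by move=> eZ fZ /eqP xy; rewrite !sqE // xy.
have p4E x e : Z e -> pw x 4 == one -> (ev x * e) ^+ 4 = 1.
  move=> eZ /eqP x4; rewrite expgMn; last exact/commute_sym/(proj2 eZ).
  by rewrite -ev_pw x4 ev1 mul1g (expgnA _ 2 2) (proj1 eZ) expg1n.
have get g : exists m e, [/\ m \in els, g = ev m * e, Z e & N g = NM m].
  by have [m [e [mE ge e2 eC Ng]]] := dec g; exists m, e.
split=> // g h; have [x [e [xE -> eZ ->]]] := get g;
  have [y [f [yE -> fZ ->]]] := get h; have /allP/(_ y yE) := chk x xE.
- case: (NM x) => //; case: (NM y) => // => /orP[/or3P[xy|xy|xy]|/andP[h1 h2]] _ _.
  + by constructor 1; apply: comE.
  + by constructor 2; apply: invsE.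
  + by constructor 3; apply: invsE.
  + by constructor 4; apply: sq2E.
- case: (NM x) => //; case: (NM y) => // => /or4P[xy|xy|/andP[h1 h2]|xy] _ _.
  + by constructor 1; apply: comE.
  + by constructor 2; apply: invsE.
  + by constructor 3; split; [apply: sqeqE | apply: p4E].
  + by constructor 4; apply: sq1E.
- case: (NM x) => //; case: (NM y) => // => /or4P[xy|xy|xy|/orP[/andP[h1 h2]|/and4P[h1 h2 h3 h4]]] _ _ n1 n2.
  + by constructor 1; apply: comE.
  + by case: n1; apply: sq1E.
  + by case: n2; apply: sq1E.
  + by constructor 2; apply: sq2E.
  + by constructor 3; split; [exact: cfc | apply: invsE | apply: sqeqE | apply: p4E].
Qed.

Lemma model_torsion (N NM : pred _) s :
  (forall g : G, exists m e, [/\ m \in els, g = ev m * e, e ^+ 2 = 1,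
     forall h, commute e h & N g = NM m]) ->
  torsion_ok NM s -> ev s <> 1 ->
  forall g h, N g -> g ^+ 2 = 1 -> commute g h.
Proof.
move=> dec /allP tor ns g h; have [x [e [xE -> e2 eC ->]]] := dec g.
have [y [f [yE -> f2 fC _]]] := dec h => Nx.
have := tor x xE; rewrite Nx /= => /orP[/eqP xx|/allP/(_ y yE)/eqP xy].
  rewrite expgMn; last exact/commute_sym/eC.
  by rewrite e2 mulg1 expg2 -evM xx.
move=> _; apply: commuteM; last exact/commute_sym/fC.
apply/commute_sym/commuteM; last exact/commute_sym/eC.
by rewrite /commute -!evM xy.
Qed.

(** The table evaluates injectively in [G] once the elements of [S] are
    nontrivial, and it also evaluates in each group satisfying the relations: the
    correspondence between both values is the homomorphism that a presentation
    asks for. *)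
Lemma model_split (N NM : pred _) (Om : set G) S gs ls p :
  (forall x y, N x -> N y -> N (x * y)) -> (forall x, N x -> N x^-1) ->
  Om 1 -> (forall x y, Om x -> Om y -> Om (x * y)) ->
  (forall x, Om x -> [/\ N x, x ^+ 2 = 1 & forall g, commute x g]) ->
  (forall g, exists m w, [/\ m \in els, Om w & g = ev m * w]) ->
  (forall m, m \in els -> N (ev m) = NM m) ->
  nondeg S -> (forall s, s \in S -> ev s <> 1) ->
  closure_ok gs -> all (mem (generated gs)) els ->
  closure_ok ls -> all (fun m => NM m == (m \in generated ls)) els ->
  relations (map ev gs) p ->
  (forall (H : groupType) (e' : seq H), relations e' p ->
     exists2 evH : M -> H, forall x y, evH (mul x y) = evH x * evH y
     & map evH gs = e') ->
  exists E, [/\ elem_abelian2 E, presents (map ev gs) p,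
     [set: G] = dprod (gen (map ev gs)) E & [set x | N x] = dprod (gen (map ev ls)) E].
Proof.
move=> NM_ NV O1 OM O2 GO evN nd nS gok gall lok /allP lNM rel univ.
have [sK sL] := (subgroup_gen (map ev gs), subgroup_gen (map ev ls)).
have gK z := gen_closureP z gok; have gL z := gen_closureP z lok.
have clE l m : closure_ok l -> m \in generated l -> m \in els.
  by move=> /and4P[_ _ /allP h _] /h.
have [x|g|E [aE GE NE]] := direct_split sK sL _ NM_ NV O1 OM O2 _.
- split=> [/gL[m mc ->]|[/gK[m mc ->] Nx]]; last first.
    apply/gL; exists m => //; have mE := clE _ _ gok mc.
    by rewrite -(eqP (lNM m mE)) -evN.
  have mE := clE _ _ lok mc.
  rewrite evN // (eqP (lNM m mE)); split=> //.
  by apply/gK; exists m => //; apply: (allP gall).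
- have [m [w [mE Ow ->]]] := GO g; exists (ev m), w; split=> //.
  by apply/gK; exists m => //; apply: (allP gall).
exists E; split=> //; apply: presents_graph rel _ => H e' /univ[evH evHM <-].
rewrite !size_map; split=> // h.
have /and4P[/allP gsE one_cl _ /allP cl] := gok.
have evH1 : evH one = 1.
  have /and5P[_ /eqP e _ _ _] := ok.
  by apply: (mulgI (evH one)); rewrite -evHM e mulg1.
pose W := [set z : G * H | exists2 m, m \in generated gs & z = (ev m, evH m)].
have gW : gen (zip (map ev gs) (map evH gs)) `<=` W.
  have zE : zip (map ev gs) (map evH gs) = [seq (ev m, evH m) | m <- gs].
    by elim: (gs) => //= m l ->.
  rewrite zE; apply: gen_words.
  - by exists one; rewrite ?ev1 ?evH1.
  - move=> _ _ /mapP[g gg ->] [m mc ->]; exists (mul m g).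
      by have /allP := cl m mc; apply.
    by rewrite evM evHM.
  - move=> _ /mapP[g /gsE gE ->]; exists 7%N.
    have /and5P[_ _ _ /allP/(_ g gE)/eqP g8 _] := ok.
    have pE n : (ev g, evH g) ^+ n = (ev (pw g n), evH (pw g n)).
      by elim: n => [|n IHn]; rewrite ?ev1 ?evH1 // expgS IHn /= evM evHM.
    by rewrite pE g8 ev1 evH1.
move=> /gW[m mc [m1 ->]]; rewrite (ev_eq1 nd nS _ (esym m1)) ?evH1 //.
exact: clE gok mc.
Qed.

End Eval.
End Model.

(** * Multiplication tables of the groups of the classification *)

Import Presentation.

Notation "'Grel' ( x : p )" := (fun x => Cast p)
  (at level 0, x ident, p custom group_presentation at level 200, only parsing).

(** Commutation relations of elements [a], [b], [c] whose squares and commutators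
    lie in the central elementary abelian group spanned by [u] and [v]; a pair
    of booleans holds the exponents of [u] and [v]. The flags [has_c] and [has_v]
    tell whether [c] and [v] occur at all. *)
Record triple_data := TripleData {
  sqa : bool * bool; sqb : bool * bool; sqc : bool * bool;
  cba : bool * bool; cca : bool * bool; ccb : bool * bool;
  has_c : bool; has_v : bool }.

Definition word := (bool * bool * bool * (bool * bool))%type.

Definition xorp (f g : bool * bool) := (f.1 (+) g.1, f.2 (+) g.2).
Definition scalep (b : bool) (f : bool * bool) := (b && f.1, b && f.2).

Lemma xorpC f g : xorp f g = xorp g f.
Proof. by rewrite /xorp addbC [f.2 (+) _]addbC. Qed.

Lemma xorpA f g h : xorp f (xorp g h) = xorp (xorp f g) h.
Proof. by rewrite /xorp /= !addbA. Qed.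

Section Triple.
Variable d : triple_data.

(** A word [(i, j, k, (l, m))] is the normal form [a^i b^j c^k u^l v^m]; collecting
    a product into that form only involves the squares and the commutators. *)
Definition wmul (x y : word) : word :=
  let: (i, j, k, f) := x in let: (i', j', k', f') := y in
  (i (+) i', j (+) j', k (+) k',
   xorp f (xorp (scalep (i && i') (sqa d)) (xorp (scalep (j && i') (cba d))
     (xorp (scalep (k && i') (cca d)) (xorp (scalep (j && j') (sqb d))
     (xorp (scalep (k && j') (ccb d)) (xorp (scalep (k && k') (sqc d)) f'))))))).

Definition wone : word := (false, false, false, (false, false)).

Definition words : seq word :=
  let bs := [:: false; true] in
  [seq w <- [seq (x, y) | x <- [seq (x, k) | x <- [seq (i, j) | i <- bs, j <- bs], k <- bs],
                          y <- [seq (l, m) | l <- bs, m <- bs]]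
  | (w.1.2 ==> has_c d) && (w.2.2 ==> has_v d)].

Definition parity (na nb nc : bool) (w : word) :=
  ~~ ((~~ na && w.1.1.1) (+) (~~ nb && w.1.1.2) (+) (~~ nc && w.1.2)).

Section Words.
Variables (G : groupType) (a b c : G) (z : bool * bool -> G).
Hypotheses (zM : forall f g, z (xorp f g) = z f * z g).
Hypotheses (za : forall f, commute (z f) a) (zb : forall f, commute (z f) b)
  (zc : forall f, commute (z f) c).
Hypotheses (aa : a ^+ 2 = z (sqa d)) (bb : b ^+ 2 = z (sqb d))
  (cc : c ^+ 2 = z (sqc d)) (ba : b * a = a * b * z (cba d))
  (ca : c * a = a * c * z (cca d)) (cb : c * b = b * c * z (ccb d)).

Let val (w : word) := a ^+ w.1.1.1 * b ^+ w.1.1.2 * c ^+ w.1.2 * z w.2.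

Let z0 : z (false, false) = 1.
Proof. by apply: (mulgI (z (false, false))); rewrite -zM mulg1. Qed.

Let sqE x f : x ^+ 2 = z f ->
  forall i : bool, x ^+ i * x = x ^+ (~~ i) * z (scalep i f).
Proof. by move=> x2 [] /=; rewrite ?mul1g ?z0 ?mulg1 //; case: f x2 => l m <-. Qed.

Let swap x y f : y * x = x * y * z f ->
  forall j : bool, y ^+ j * x = x * y ^+ j * z (scalep j f).
Proof. by move=> yx [] /=; rewrite ?mul1g ?z0 ?mulg1 //; case: f yx => l m <-. Qed.

Let zzM x f g : x * z f * z g = x * z (xorp f g).
Proof. by rewrite -mulgA zM. Qed.

Lemma word_mula i j k f : val (i, j, k, f) * a =
  val (~~ i, j, k, xorp f (xorp (scalep i (sqa d))
    (xorp (scalep j (cba d)) (scalep k (cca d))))).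
Proof.
have c_ f' : commute (z f') (c ^+ k) by apply: commuteX.
have b_ f' : commute (z f') (b ^+ j) by apply: commuteX.
rewrite /val /= -mulgA za !mulgA -(mulgA _ (c ^+ k)) (swap ca).
rewrite !mulgA -(mulgA _ (b ^+ j)) (swap ba) !mulgA (sqE aa).
rewrite -(mulgA (a ^+ _)) b_ mulgA -(mulgA _ (z (scalep j _))) c_ mulgA.
rewrite -(mulgA _ (z (scalep i _))) c_ mulgA.
by rewrite !zzM; congr (_ * z _); rewrite [RHS]xorpC -!xorpA.
Qed.

Lemma word_mulb i j k f : val (i, j, k, f) * b =
  val (i, ~~ j, k, xorp f (xorp (scalep j (sqb d)) (scalep k (ccb d)))).
Proof.
have c_ f' : commute (z f') (c ^+ k) by apply: commuteX.
rewrite /val /= -mulgA zb !mulgA -(mulgA _ (c ^+ k)) (swap cb).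
rewrite !mulgA -(mulgA _ (b ^+ j)) (sqE bb) mulgA.
rewrite -(mulgA _ (z (scalep j _))) c_ mulgA.
by rewrite !zzM; congr (_ * z _); rewrite [RHS]xorpC -!xorpA.
Qed.

Lemma word_mulc i j k f : val (i, j, k, f) * c =
  val (i, j, ~~ k, xorp f (scalep k (sqc d))).
Proof.
rewrite /val /= -mulgA zc !mulgA -(mulgA _ (c ^+ k)) (sqE cc) mulgA.
by rewrite -(mulgA _ (z (scalep k _))) -zM xorpC.
Qed.

Lemma word_mul x y : val (wmul x y) = val x * val y.
Proof.
case: x y => [[[i j] k] f] [[[i' j'] k'] f'].
have xF g : xorp g (false, false) = g by case: g => [[] []].
have -> : val (i', j', k', f') = a ^+ i' * b ^+ j' * c ^+ k' * z f' by [].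
rewrite !mulgA.
have -> : val (i, j, k, f) * a ^+ i' = val (i (+) i', j, k,
    xorp f (xorp (scalep (i && i') (sqa d)) (xorp (scalep (j && i') (cba d))
      (scalep (k && i') (cca d))))).
  case: i'; rewrite ?andbT ?andbF ?addbT ?addbF ?word_mula //.
  by rewrite mulg1 /scalep /= !xF.
set f1 := xorp f _.
have -> : val (i (+) i', j, k, f1) * b ^+ j' = val (i (+) i', j (+) j', k,
    xorp f1 (xorp (scalep (j && j') (sqb d)) (scalep (k && j') (ccb d)))).
  case: j'; rewrite ?andbT ?andbF ?addbT ?addbF ?word_mulb //.
  by rewrite mulg1 /scalep /= !xF.
set f2 := xorp f1 _.
have -> : val (i (+) i', j (+) j', k, f2) * c ^+ k' =
    val (i (+) i', j (+) j', k (+) k', xorp f2 (scalep (k && k') (sqc d))).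
  case: k'; rewrite ?andbT ?andbF ?addbT ?addbF ?word_mulc //.
  by rewrite mulg1 /scalep /= !xF.
rewrite /val /= zzM /f2 /f1; congr (_ * z _); by rewrite -!xorpA.
Qed.

End Words.

Variables (G : groupType) (a b c u v : G).

Definition zval (f : bool * bool) := u ^+ f.1 * v ^+ f.2.

Record triple : Prop := Triple {
  tr_u : u ^+ 2 = 1; tr_v : v ^+ 2 = 1; tr_uv : commute u v;
  tr_ua : commute u a; tr_ub : commute u b; tr_uc : commute u c;
  tr_va : commute v a; tr_vb : commute v b; tr_vc : commute v c;
  tr_a : a ^+ 2 = zval (sqa d); tr_b : b ^+ 2 = zval (sqb d);
  tr_c : c ^+ 2 = zval (sqc d);
  tr_ba : b * a = a * b * zval (cba d); tr_ca : c * a = a * c * zval (cca d);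
  tr_cb : c * b = b * c * zval (ccb d) }.

Definition wval (w : word) :=
  a ^+ w.1.1.1 * b ^+ w.1.1.2 * c ^+ w.1.2 * zval w.2.

Hypothesis tr : triple.

Lemma expg_addb (x : G) (i j : bool) :
  x ^+ 2 = 1 -> x ^+ (i (+) j) = x ^+ i * x ^+ j.
Proof. by case: i j => [] [] x2; rewrite /= ?mulg1 ?mul1g -?x2. Qed.

Lemma zvalM f g : zval (xorp f g) = zval f * zval g.
Proof.
case: f g => [l m] [l' m']; rewrite /zval /= !expg_addb ?(tr_u tr) ?(tr_v tr) //.
rewrite -!mulgA; congr (_ * _); rewrite !mulgA; congr (_ * _).
exact: commuteX2 (tr_uv tr).
Qed.

Lemma zval_commute f x : commute u x -> commute v x -> commute (zval f) x.
Proof.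
move=> ux vx; apply/commute_sym.
by apply: commuteM; apply: commuteX; apply/commute_sym.
Qed.

Lemma wvalM x y : wval (wmul x y) = wval x * wval y.
Proof.
case: tr => _ _ _ ua ub uc va vb vc aa bb cc ba ca cb.
by apply: (word_mul zvalM) => // f; apply: zval_commute.
Qed.

Lemma N_wval (N : pred G) w : (forall x y, N (x * y) = (N x == N y)) ->
  N u -> N v -> N (wval w) = parity (N a) (N b) (N c) w.
Proof.
move=> NM Nu Nv; have N1 := kernel1 NM.
have Nb x (i : bool) : N (x ^+ i) = ~~ (~~ N x && i).
  by case: i; rewrite ?andbT ?andbF ?negbK.
case: w => [[[i j] k] [l m]]; rewrite /wval /parity /zval !NM !Nb Nu Nv /=.
by case: (N a) (N b) (N c) i j k => [] [] [] [] [] [].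
Qed.

End Triple.

(** The groups generated by [a] of order 8 and [b] with [b^2 = a^4] and
    [a b = b a^r]: semidihedral for [r = 3], quaternion for [r = 7]. *)
Section Octic.
Variable r : nat.

Definition omul (x y : nat * bool) : nat * bool :=
  ((x.1 + (if x.2 then r * y.1 else y.1) + (if x.2 && y.2 then 4 else 0)) %% 8,
   x.2 (+) y.2)%N.

Definition octs : seq (nat * bool) :=
  [seq (i, j) | i <- iota 0 8, j <- [:: false; true]].

Definition oparity (na nb : bool) (x : nat * bool) :=
  ~~ ((~~ na && odd x.1) (+) (~~ nb && x.2)).

Variables (G : groupType) (a b : G).
Hypotheses (a8 : a ^+ 8 = 1) (bb : b ^+ 2 = a ^+ 4) (ab : a * b = b * a ^+ r)
  (rr : (r * r = 1 %[mod 8])%N).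

Definition oval (x : nat * bool) := a ^+ x.1 * b ^+ x.2.

Let a_mod i : a ^+ (i %% 8) = a ^+ i.
Proof. by rewrite [in RHS](divn_eq i 8) expgnDr mulnC expgnA a8 expg1n mul1g. Qed.

Lemma ovalM x y : oval (omul x y) = oval x * oval y.
Proof.
case: x y => [i j] [i' j']; rewrite /oval /= a_mod.
have aX k : a ^+ k * b = b * a ^+ (r * k).
  elim: k => [|k IHk]; rewrite ?muln0 ?mulg1 ?mul1g // expgS -mulgA IHk mulgA ab.
  by rewrite -mulgA -expgnDr mulnS.
have ba : b * a ^+ i' = a ^+ (r * i') * b.
  rewrite aX mulnA; congr (_ * _); rewrite -a_mod -[RHS]a_mod; congr (_ ^+ _).
  by rewrite -modnMml rr modnMml mul1n.
case: j => /=; last by rewrite addn0 expgnDr mulg1 !mulgA.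
rewrite !expgnDr -!mulgA; congr (_ * _); rewrite expg1 [b * (_ * _)]mulgA ba -!mulgA.
by congr (_ * _); case: j' => /=; rewrite ?mul1g ?mulg1 -?bb ?expg2.
Qed.

Lemma N_oval (N : pred G) x : (forall x y, N (x * y) = (N x == N y)) ->
  N (oval x) = oparity (N a) (N b) x.
Proof.
move=> NM; have N1 := kernel1 NM.
have NX z n : N (z ^+ n) = ~~ (~~ N z && odd n).
  elim: n => [|n IHn]; first by rewrite andbF.
  by rewrite expgS NM IHn /=; case: (N z) (odd n) => [] [].
rewrite /oval NM !NX /oparity; case: x => i j /=.
by case: (N a) (N b) (odd i) j => [] [] [] [].
Qed.

End Octic.

(** * Linear reasoning in elementary abelian 2-groups *)

(** A linear form is a list of coefficients modulo 2, a literal [(true, f)]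
    (resp. [(false, f)]) says that [f] vanishes (resp. does not vanish), and a
    clause is a disjunction of literals. *)
Definition form := seq bool.
Definition literal := (bool * form)%type.
Definition clause := seq literal.

Fixpoint addf (f g : form) : form :=
  match f, g with
  | [::], _ => g
  | _, [::] => f
  | b :: f', c :: g' => (b (+) c) :: addf f' g'
  end.

Definition zerof (f : form) := all negb f.

Definition simplify (nz : seq form) (cls : seq clause) : seq clause :=
  [seq [seq l <- c | if l.1 then l.2 \notin nz else ~~ zerof l.2] | c <- cls
     & ~~ has (fun l : literal => if l.1 then zerof l.2 else l.2 \in nz) c].

Definition eliminate (f g : form) := if nth false g (find id f) then addf g f else g.

Definition smallest_clause (c0 : clause) (cls : seq clause) :=
  foldr (fun c c' : clause => if size c < size c' then c else c')%N c0 cls.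

(** A refutation procedure: a literal of a shortest clause is assumed, a vanishing
    form being used to eliminate one variable. *)
Fixpoint refute (fuel : nat) (nz : seq form) (cls : seq clause) : bool :=
  if fuel is n.+1 then
    has zerof nz ||
    if simplify nz cls is c0 :: cls' then
      all (fun l : literal =>
        if l.1 then refute n (map (eliminate l.2) nz)
             [seq [seq (l'.1, eliminate l.2 l'.2) | l' <- c] | c <- c0 :: cls']
        else refute n (l.2 :: nz) (c0 :: cls')) (smallest_clause c0 cls')
    else false
  else false.

(** Refuting the negations of the goals along with the clauses shows that one of
    the goals holds; the fuel exceeds the depth of all the refutations below. *)
Definition entails (cls : seq clause) (goals : seq (seq literal)) :=
  refute 300 [::] ([seq [seq (~~ l.1, l.2) | l <- g] | g <- goals] ++ cls).

Section Forms.
Variables (G : groupType) (env : seq G).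
Hypotheses (env2 : forall z, z \in env -> z ^+ 2 = 1)
  (envC : forall z, z \in env -> forall g, commute z g).

Fixpoint evalf (e : seq G) (f : form) : G :=
  match e, f with
  | z :: e', b :: f' => z ^+ b * evalf e' f'
  | _, _ => 1
  end.

Definition holds (l : literal) : Prop :=
  if l.1 then evalf env l.2 = 1 else evalf env l.2 <> 1.

Definition holds_clause (c : clause) := exists2 l, l \in c & holds l.

Lemma evalfD f g : evalf env (addf f g) = evalf env f * evalf env g.
Proof.
elim: (env) env2 envC f g => [|z e IHe] e2 eC [|b f] [|c g] //=;
  rewrite ?mulg1 ?mul1g //.
rewrite IHe => [|y ye|y ye]; last 2 first.
- by apply: e2; rewrite inE ye orbT.
- by apply: eC; rewrite inE ye orbT.
have zC := eC z (mem_head _ _); have z2 := e2 z (mem_head _ _).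
have -> : z ^+ (b (+) c) = z ^+ b * z ^+ c.
  by case: b c => [] [] //=; rewrite ?mulg1 ?mul1g // -expg2 z2.
rewrite -!mulgA; congr (_ * _); rewrite !mulgA; congr (_ * _).
by case: (c); rewrite ?mulg1 ?mul1g // -zC.
Qed.

Lemma evalf_zero f : zerof f -> evalf env f = 1.
Proof.
elim: (env) f => [|z e IHe] [|b f] //= /andP[/negPf -> /IHe->].
by rewrite mulg1.
Qed.

Lemma evalf_eliminate f g : evalf env f = 1 -> evalf env (eliminate f g) = evalf env g.
Proof. by rewrite /eliminate; case: ifP => // _ f0; rewrite evalfD f0 mulg1. Qed.

Lemma holds_eliminate f (l : literal) : evalf env f = 1 ->
  holds l -> holds (l.1, eliminate f l.2).
Proof. by move=> f0; rewrite /holds /= evalf_eliminate. Qed.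

Lemma smallest_clause_in c0 cls : smallest_clause c0 cls \in c0 :: cls.
Proof.
rewrite /smallest_clause.
elim: cls => [|c cls IHcls] /=; first by rewrite mem_head.
case: ifP => _; first by rewrite !inE eqxx orbT.
by move: IHcls; rewrite !inE => /orP[->|->]; rewrite ?orbT.
Qed.

Lemma simplifyP nz cls : (forall f, f \in nz -> evalf env f <> 1) ->
  (forall c, c \in cls -> holds_clause c) ->
  forall c, c \in simplify nz cls -> holds_clause c.
Proof.
move=> hnz hcls c /mapP[c']; rewrite mem_filter => /andP[_ /hcls[l lc hl]] ->.
exists l => //; rewrite mem_filter lc andbT.
move: hl; rewrite /holds; case: l.1 => h.
  by apply/negP => /hnz.
by apply/negP => /evalf_zero.
Qed.

Lemma refuteP fuel nz cls : refute fuel nz cls ->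
  (forall f, f \in nz -> evalf env f <> 1) ->
  (forall c, c \in cls -> holds_clause c) -> False.
Proof.
elim: fuel nz cls => //= n IHn nz cls /orP[/hasP[f fnz /evalf_zero f1] hnz|].
  by move=> _; apply: (hnz f fnz).
move=> ref hnz hcls; have := simplifyP hnz hcls; move: ref.
case: (simplify nz cls) => // c0 cls' /allP ref hs.
have [l lc hl] := hs _ (smallest_clause_in c0 cls').
have := ref l lc; move: hl; rewrite {1}/holds; case: ifP => l1 hl r.
  apply: (IHn _ _ r) => [f /mapP[g gnz ->]|c].
    by rewrite evalf_eliminate //; apply: hnz.
  rewrite -(map_cons (fun c : clause => [seq (l'.1, eliminate l.2 l'.2) | l' <- c])).
  move=> /mapP[c' /hs[l' lc' hl'] ->].
  exists (l'.1, eliminate l.2 l'.2); last exact: holds_eliminate.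
  exact: (map_f (fun l' : literal => (l'.1, eliminate l.2 l'.2))).
by apply: (IHn _ _ r) => // f; rewrite inE => /predU1P[->|/hnz].
Qed.

Lemma entailsP cls goals : entails cls goals ->
  (forall c, c \in cls -> holds_clause c) ->
  exists2 g, g \in goals & forall l, l \in g -> holds l.
Proof.
rewrite /entails; move: 300 => fuel ref hcls; apply: contrapT => ng.
apply: (refuteP ref) => // c.
rewrite mem_cat => /orP[/mapP[g gg ->]|/hcls //].
apply: contrapT => nc; apply: ng; exists g => // l lg.
apply: contrapT => nl; apply: nc; exists (~~ l.1, l.2).
  exact: (map_f (fun l : literal => (~~ l.1, l.2))).
by move: nl; rewrite /holds /=; case: l.1 => // /contrapT.
Qed.

End Forms.

(** * Squares and commutators in groups of exponent 4 with central squares *)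

Fixpoint vecs n : seq form :=
  if n is m.+1 then map (cons false) (vecs m) ++ map (cons true) (vecs m)
  else [:: [::]].

(** The square of a word is the product of the squares of its letters and of the
    commutators of any two of them; this is the list of the exponents, in the
    order of [qenv]. The commutator of two words is given by the polar form. *)
Fixpoint qform (v : form) : form :=
  if v is b :: v' then b :: [seq b && c | c <- v'] ++ qform v' else [::].

Definition bform (u v : form) := addf (qform (addf u v)) (addf (qform u) (qform v)).

Lemma mem_vecs n v : (v \in vecs n) = (size v == n).
Proof.
elim: n v => [|n IHn] [|b v] //=; rewrite mem_cat.
  by apply/negbTE/negP => /orP[] /mapP[].
rewrite eqSS -IHn; apply/orP/idP => [[] /mapP[w wn [_ ->]]//|vn].
by case: b; [right|left]; apply: map_f.
Qed.

Lemma size_addf u v : size u = size v -> size (addf u v) = size v.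
Proof. by elim: u v => [|b u IHu] [|c v] //= [/IHu->]. Qed.

(** The first generator lies outside [N] and the others inside: the words outside
    [N] are those in which the first generator occurs. *)
Definition outs n := [seq v <- vecs n | head false v].
Definition ins n := [seq v <- vecs n | ~~ head false v].

(** Each family instantiates one condition on pairs at all pairs of words. *)
Definition out_clauses n : seq clause := [seq [:: (false, qform u)] | u <- outs n].

Definition mix_clauses n : seq clause := [seq [:: (true, qform v);
  (true, bform u v); (true, addf (bform u v) (qform u));
  (true, addf (qform u) (qform v))] | u <- outs n, v <- ins n].

Definition in_clauses n : seq clause := [seq [:: (true, qform u); (true, qform v);
  (true, bform u v); (true, qform (addf u v))] | u <- ins n, v <- ins n].

Definition tor_clauses n : seq clause := [seq [:: (false, qform v);
  (true, bform u v)] | u <- vecs n, v <- ins n].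

Definition abel_clauses n : seq clause :=
  [seq [:: (true, bform u v)] | u <- ins n, v <- ins n].

Definition q8_clauses n : seq clause := flatten
  [seq [:: [:: (true, bform u v); (true, addf (bform u v) (qform u))];
           [:: (true, bform u v); (true, addf (bform u v) (qform v))]]
  | u <- ins n, v <- ins n].

Section Class2.
Variable G : groupType.
Hypotheses (exp4 : forall g : G, g ^+ 4 = 1)
  (sqC : forall g h : G, commute (g ^+ 2) h).

(** Commutators are products of squares, and thus central of exponent 2. *)
Lemma comm_sqE (g h : G) : [~ g, h] = (g^-1) ^+ 2 * ((g * h^-1) ^+ 2 * h ^+ 2).
Proof. by rewrite commgEl conjgE !expg2 !mulgA !mulgVK. Qed.

Lemma sq_sq (g : G) : (g ^+ 2) ^+ 2 = 1. Proof. by rewrite -expgnA exp4. Qed.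

Lemma comm_central (g h k : G) : commute [~ g, h] k.
Proof.
rewrite comm_sqE; apply/commute_sym/commuteM; first exact/commute_sym/sqC.
by apply: commuteM; exact/commute_sym/sqC.
Qed.

Lemma comm_sq (g h : G) : [~ g, h] ^+ 2 = 1.
Proof.
rewrite comm_sqE expgMn; last exact: sqC.
by rewrite sq_sq mul1g expgMn ?sq_sq ?mulg1 //; apply: sqC.
Qed.

Lemma comm_sym2 (g h : G) : [~ g, h] = [~ h, g].
Proof. by have /sqg1 <- := comm_sq h g; rewrite invgR. Qed.

Lemma sqM (g h : G) : (g * h) ^+ 2 = g ^+ 2 * h ^+ 2 * [~ g, h].
Proof.
have -> : (g * h) ^+ 2 = g * (h * g) * h by rewrite expg2 !mulgA.
rewrite (commgC h g) (comm_sym2 h g); move: [~ g, h] (comm_central g h h) => z zh.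
by rewrite !expg2 -!mulgA zh.
Qed.

Lemma comm_mulr (g h k : G) : [~ g, h * k] = [~ g, h] * [~ g, k].
Proof.
have gh := commgC g h; have gk := commgC g k.
have ghk := commgC g (h * k); move: [~ g, h * k] ghk => x ghk.
move: [~ g, k] gk => z gk.
move: [~ g, h] gh (comm_central g h k) (comm_central g h z) => y gh yk yz.
apply: (mulgI (h * k * g)); rewrite -ghk mulgA gh -!mulgA; congr (_ * _).
by rewrite yk [in LHS]mulgA gk -!mulgA yz.
Qed.

Lemma commute_comm (g h : G) : commute g h <-> [~ g, h] = 1.
Proof. by split=> [/commgP/eqP|/eqP/commgP]. Qed.

Lemma inverts_comm (g h : G) : inverts h g <-> [~ g, h] = g ^+ 2.
Proof.
have gV : g^-1 = g * g ^+ 2.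
  by apply: mulg1_eq; rewrite -!expgS exp4.
rewrite /inverts gV mulgA commgC; split=> [/mulgI//|->//].
Qed.

Fixpoint qenv (gs : seq G) : seq G :=
  if gs is g :: gs' then g ^+ 2 :: [seq [~ g, h] | h <- gs'] ++ qenv gs' else [::].

Fixpoint gword (gs : seq G) (v : form) : G :=
  match gs, v with g :: gs', b :: v' => g ^+ b * gword gs' v' | _, _ => 1 end.

Lemma qenv_inv gs z : z \in qenv gs -> z ^+ 2 = 1 /\ forall g, commute z g.
Proof.
elim: gs => //= g gs IHgs; rewrite inE mem_cat.
case/orP=> [/eqP->|/orP[/mapP[h _ ->]|/IHgs//]].
  by split; [exact: sq_sq | exact: sqC].
by split; [exact: comm_sq | exact: comm_central].
Qed.

Lemma evalf_cat (e1 e2 : seq G) f1 f2 : size f1 = size e1 ->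
  evalf (e1 ++ e2) (f1 ++ f2) = evalf e1 f1 * evalf e2 f2.
Proof.
elim: e1 f1 => [|z e1 IHe] [|b f1] //=; first by rewrite mul1g.
by move=> [/IHe->]; rewrite mulgA.
Qed.

Lemma sq_gword gs v : size v = size gs ->
  gword gs v ^+ 2 = evalf (qenv gs) (qform v).
Proof.
elim: gs v => [|g gs IHgs] [|b v] //=; first by rewrite expg1n.
move=> [sv].
rewrite evalf_cat ?size_map // -IHgs //.
have <- : [~ g ^+ b, gword gs v] =
    evalf [seq [~ g, h] | h <- gs] [seq b && c | c <- v].
  elim: {IHgs} gs v sv => [|h gs IHgs] [|c v] //=; first by rewrite commg1.
  move=> [sv].
  rewrite comm_mulr IHgs //; congr (_ * _).
  by case: b c {IHgs} => [] []; rewrite //= ?comm1g ?commg1.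
rewrite sqM -mulgA -(comm_central _ _ (gword gs v ^+ 2)); congr (_ * _).
by case: b => //=; rewrite expg1n.
Qed.

Lemma gwordD gs u v : size u = size gs -> size v = size gs ->
  exists z, [/\ z ^+ 2 = 1, forall g, commute z g
               & gword gs u * gword gs v = gword gs (addf u v) * z].
Proof.
elim: gs u v => [|g gs IHgs] [|b u] [|c v] //=.
  by exists 1; rewrite expg1n; split=> // g; apply/commute_sym/commute1.
move=> [su] [sv]; have [z [z2 zC e]] := IHgs u v su sv.
have [y [y2 yC uy]] : exists y, [/\ y ^+ 2 = 1, forall h, commute y h
    & gword gs u * g ^+ c = g ^+ c * gword gs u * y].
  exists [~ gword gs u, g ^+ c]; rewrite comm_sq -commgC.
  by split=> // h; apply: comm_central.
pose x := if b && c then g ^+ 2 else 1.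
have xC h : commute x h.
  by rewrite /x; case: ifP => _; [apply: sqC | apply/commute_sym/commute1].
have x2 : x ^+ 2 = 1 by rewrite /x; case: ifP; rewrite ?sq_sq ?expg1n.
have xbc : g ^+ b * g ^+ c = g ^+ (b (+) c) * x.
  by rewrite /x; case: (b) (c) => [] []; rewrite /= ?mulg1 ?mul1g.
exists (x * (y * z)); split.
- by rewrite expgMn ?x2 ?mul1g ?expgMn ?y2 ?z2 ?mulg1 //; apply: xC.
- move=> h; apply/commute_sym; apply: commuteM; first exact/commute_sym.
  by apply: commuteM; apply/commute_sym; [apply: yC|apply: zC].
- rewrite -!mulgA [gword gs u * _]mulgA uy -!mulgA (yC (gword gs v)).
  rewrite [gword gs u * _]mulgA e !mulgA xbc -!mulgA; congr (_ * _).
  rewrite (xC (gword _ _ * _)) -!mulgA (xC (y * z)) -!mulgA (yC (z * x)) -!mulgA.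
  by rewrite (yC x).
Qed.

Lemma comm_gword gs u v : size u = size gs -> size v = size gs ->
  [~ gword gs u, gword gs v] = evalf (qenv gs) (bform u v).
Proof.
move=> su sv; have env2 z : z \in qenv gs -> z ^+ 2 = 1 by case/qenv_inv.
have envC z : z \in qenv gs -> forall g, commute z g by case/qenv_inv.
have suv : size (addf u v) = size gs by rewrite size_addf ?su.
have [z [z2 zC e]] := gwordD su sv.
rewrite /bform !evalfD // -!sq_gword //.
have -> : gword gs (addf u v) ^+ 2 = (gword gs u * gword gs v) ^+ 2.
  by rewrite e expgMn ?z2 ?mulg1 //; apply/commute_sym/zC.
rewrite sqM -mulgA (comm_central _ _ (_ * _)) mulgA -expg2.
rewrite expgMn; last exact: sqC.
by rewrite !sq_sq !mul1g.
Qed.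

Section Words.
Variables (N : pred G) (x : G) (gs : seq G).
Hypotheses (NM : forall g h, N (g * h) = (N g == N h)) (xN : ~~ N x)
  (gsN : all N gs).
Local Notation n := (size gs).+1.
Local Notation W v := (gword (x :: gs) v).
Local Notation sat c := (holds_clause (qenv (x :: gs)) c).

Lemma N_gword v : size v = n -> N (W v) = ~~ head false v.
Proof.
have N1 := kernel1 NM.
case: v => // b v [sv] /=; rewrite NM.
have -> : N (gword gs v).
  elim: gs gsN v sv => [|g l IHl] /= => [_ [|//]|/andP[Ng Nl] [|c v] //= [sv]].
    by rewrite N1.
  by rewrite NM IHl //; case: c; rewrite ?Ng ?N1.
by case: b; rewrite ?(negPf xN) ?N1.
Qed.

Lemma holds_q b v : size v = n -> holds (qenv (x :: gs)) (b, qform v) =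
  if b then W v ^+ 2 = 1 else W v ^+ 2 <> 1.
Proof. by move=> sv; rewrite /holds -sq_gword. Qed.

Lemma holds_b b u v : size u = n -> size v = n ->
  holds (qenv (x :: gs)) (b, bform u v) =
  if b then [~ W u, W v] = 1 else [~ W u, W v] <> 1.
Proof. by move=> su sv; rewrite /holds -comm_gword. Qed.

Let qenvD f g : evalf (qenv (x :: gs)) (addf f g) =
  evalf (qenv (x :: gs)) f * evalf (qenv (x :: gs)) g.
Proof. by apply: evalfD => z /qenv_inv[]. Qed.

Lemma holds_add b f g y z : evalf (qenv (x :: gs)) f = y ->
  evalf (qenv (x :: gs)) g = z -> z ^+ 2 = 1 ->
  holds (qenv (x :: gs)) (b, addf f g) = if b then y = z else y <> z.
Proof.
move=> fy gz z2; rewrite /holds qenvD fy gz.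
have -> // : (y * z = 1) = (y = z).
apply/propext; split=> [/mulg1_eq e|->]; last by rewrite -expg2.
by rewrite -[y]invgK e; apply/sqg1.
Qed.

Lemma holds_qq b u v : size u = n -> size v = n ->
  holds (qenv (x :: gs)) (b, addf (qform u) (qform v)) =
  if b then W u ^+ 2 = W v ^+ 2 else W u ^+ 2 <> W v ^+ 2.
Proof. by move=> su sv; apply: holds_add; rewrite -?sq_gword // sq_sq. Qed.

Lemma holds_bq b u v w : size u = n -> size v = n -> size w = n ->
  holds (qenv (x :: gs)) (b, addf (bform u v) (qform w)) =
  if b then [~ W u, W v] = W w ^+ 2 else [~ W u, W v] <> W w ^+ 2.
Proof.
by move=> su sv sw; apply: holds_add; rewrite -?sq_gword -?comm_gword // sq_sq.
Qed.

Lemma holds_bqq b u v w y : size u = n -> size v = n -> size w = n -> size y = n ->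
  holds (qenv (x :: gs)) (b, addf (bform u v) (addf (qform w) (qform y))) =
  if b then [~ W u, W v] = W w ^+ 2 * W y ^+ 2
  else [~ W u, W v] <> W w ^+ 2 * W y ^+ 2.
Proof.
move=> su sv sw sy; apply: holds_add; rewrite -?comm_gword ?qenvD -?sq_gword //.
by rewrite expgMn ?sq_sq ?mulg1 //; apply: sqC.
Qed.

Lemma outsP v : v \in outs n -> size v = n /\ ~~ N (W v).
Proof.
by rewrite mem_filter mem_vecs => /andP[hv /eqP sv]; rewrite N_gword // hv.
Qed.

Lemma insP v : v \in ins n -> size v = n /\ N (W v).
Proof.
by rewrite mem_filter mem_vecs => /andP[hv /eqP sv]; rewrite N_gword // hv.
Qed.

Lemma out_sound c : (forall y, ~~ N y -> y ^+ 2 <> 1) ->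
  c \in out_clauses n -> sat c.
Proof.
move=> hout /mapP[v /outsP[sv Nv] ->]; exists (false, qform v); rewrite ?mem_head //.
by rewrite holds_q //; apply: hout.
Qed.

Lemma mix_sound c :
  (forall y m, ~~ N y -> N m -> [\/ m ^+ 2 = 1, [~ y, m] = 1, [~ y, m] = y ^+ 2
     | y ^+ 2 = m ^+ 2]) ->
  c \in mix_clauses n -> sat c.
Proof.
move=> hmix /allpairsP[[u v] /= [/outsP[su Nu] /insP[sv Nv] ->]].
case: (hmix _ _ Nu Nv) => h.
- by exists (true, qform v); rewrite ?inE ?eqxx ?orbT //; rewrite holds_q.
- by exists (true, bform u v); rewrite ?inE ?eqxx ?orbT //; rewrite holds_b.
- exists (true, addf (bform u v) (qform u)); rewrite ?inE ?eqxx ?orbT //.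
  by rewrite holds_bq.
- exists (true, addf (qform u) (qform v)); rewrite ?inE ?eqxx ?orbT //.
  by rewrite holds_qq.
Qed.

Lemma in_sound c :
  (forall g h, N g -> N h -> [\/ g ^+ 2 = 1, h ^+ 2 = 1, [~ g, h] = 1
     | (g * h) ^+ 2 = 1]) ->
  c \in in_clauses n -> sat c.
Proof.
move=> hin /allpairsP[[u v] /= [/insP[su Nu] /insP[sv Nv] ->]].
case: (hin _ _ Nu Nv) => h.
- by exists (true, qform u); rewrite ?inE ?eqxx ?orbT //; rewrite holds_q.
- by exists (true, qform v); rewrite ?inE ?eqxx ?orbT //; rewrite holds_q.
- by exists (true, bform u v); rewrite ?inE ?eqxx ?orbT //; rewrite holds_b.
- exists (true, qform (addf u v)); rewrite ?inE ?eqxx ?orbT //.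
  rewrite holds_q; last by rewrite size_addf ?su.
  have [z [z2 zC e]] := @gwordD (x :: gs) u v su sv.
  by move: h; rewrite e expgMn ?z2 ?mulg1 //; apply/commute_sym/zC.
Qed.

Lemma tor_sound c :
  (forall g h, N g -> g ^+ 2 = 1 -> commute h g) -> c \in tor_clauses n -> sat c.
Proof.
move=> htor /allpairsP[[u v] /= [uv /insP[sv Nv] ->]].
have su : size u = n by apply/eqP; rewrite -mem_vecs.
have [v2|/eqP v2] := eqVneq (W v ^+ 2) 1.
  exists (true, bform u v); rewrite ?inE ?eqxx ?orbT //.
  by rewrite holds_b //; apply/commute_comm/htor.
by exists (false, qform v); rewrite ?inE ?eqxx ?orbT //; rewrite holds_q.
Qed.

Lemma abel_sound c :
  (forall g h, N g -> N h -> commute g h) -> c \in abel_clauses n -> sat c.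
Proof.
move=> hab /allpairsP[[u v] /= [/insP[su Nu] /insP[sv Nv] ->]].
exists (true, bform u v); rewrite ?inE ?eqxx ?orbT //.
by rewrite holds_b //; apply/commute_comm/hab.
Qed.

Lemma q8_sound c :
  (forall g h, N g -> N h -> commute g h \/ [~ g, h] = g ^+ 2 /\ [~ g, h] = h ^+ 2) ->
  c \in q8_clauses n -> sat c.
Proof.
move=> hq /flattenP[cs /allpairsP[[u v] /= [/insP[su Nu] /insP[sv Nv] ->]]].
case: (hq _ _ Nu Nv) => [/commute_comm h|[h1 h2]].
  rewrite !inE => /orP[] /eqP->; exists (true, bform u v);
    by rewrite ?inE ?eqxx ?orbT //; rewrite holds_b.
rewrite !inE => /orP[] /eqP->.
  exists (true, addf (bform u v) (qform u)); rewrite ?inE ?eqxx ?orbT //.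
  by rewrite holds_bq.
exists (true, addf (bform u v) (qform v)); rewrite ?inE ?eqxx ?orbT //.
by rewrite holds_bq.
Qed.

Lemma entails_words cls goals : entails cls goals ->
  (forall c, c \in cls -> sat c) ->
  exists2 g, g \in goals & forall l, l \in g -> holds (qenv (x :: gs)) l.
Proof.
by apply: entailsP => z /qenv_inv[].
Qed.

End Words.

End Class2.

(** * Classification when squares are central and the exponent is 4 *)

Definition Omega (G : groupType) (N : pred G) : set G :=
  [set w | [/\ N w, w ^+ 2 = 1 & forall g, commute w g]].

(** Two elements commute or generate a quaternion group of order 8. *)
Definition Q8pair (G : groupType) (g h : G) :=
  commute g h \/ [/\ inverts h g, g ^+ 2 = h ^+ 2 & g ^+ 4 = 1].

Section UnitClauses.
Variables (G : groupType) (env : seq G).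

Definition allsat (cls : seq clause) := forall c, c \in cls -> holds_clause env c.
Definition allhold (g : seq literal) := forall l, l \in g -> holds env l.

Lemma allsat_cat cls1 cls2 : allsat cls1 -> allsat cls2 -> allsat (cls1 ++ cls2).
Proof. by move=> s1 s2 c; rewrite mem_cat => /orP[/s1|/s2]. Qed.

Lemma allsat_units g : allhold g -> allsat [seq [:: l] | l <- g].
Proof. by move=> hg _ /mapP[l /hg hl ->]; exists l; rewrite ?mem_head. Qed.

Lemma allhold1 l : allhold [:: l] = holds env l.
Proof.
by apply/propext; split=> [|hl l']; [apply; apply: mem_head | rewrite inE => /eqP->].
Qed.

Lemma allhold2 l l' g : allhold (l :: l' :: g) = (holds env l /\ allhold (l' :: g)).
Proof.
apply/propext; split=> [h|[hl hg] k].
  by split=> [|k kg]; apply: h; rewrite ?mem_head // inE kg orbT.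
by rewrite inE => /predU1P[->//|/hg].
Qed.

End UnitClauses.

Local Notation T := true.
Local Notation F := false.

Definition basic n := out_clauses n ++ mix_clauses n.

(** Configurations of a word [x] outside [N] and words of [N], each of which
    determines one of the groups with central squares. *)
Definition lits10 x k h : seq literal := [:: (T, qform k); (T, bform x k);
  (T, bform x h); (T, addf (bform k h) (qform x)); (F, bform k h);
  (F, qform h); (F, addf (bform k h) (qform h))].
Definition lits8 x k h : seq literal := [:: (T, qform k); (T, qform h);
  (T, bform x k); (T, addf (bform k h) (qform x)); (F, bform k h);
  (F, bform x h); (F, addf (bform x h) (qform x))].
Definition lits9 x k h : seq literal := [:: (T, qform k); (T, bform x h);
  (T, addf (bform k h) (qform h)); (F, bform k h);
  (T, addf (bform x k) (addf (qform x) (qform h))); (F, addf (qform x) (qform h))].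
Definition lits6 x k h : seq literal := [:: (T, bform x k);
  (T, addf (bform x h) (qform x)); (T, addf (qform k) (qform h));
  (T, addf (bform k h) (qform k)); (F, qform k); (F, addf (qform x) (qform k))].
Definition lits5 x n : seq literal := [:: (T, addf (bform x n) (qform x));
  (F, addf (qform x) (qform n)); (F, qform n)].

Definition xw := [:: T; F; F; F].
Definition kw := [:: F; T; F; F].
Definition hw := [:: F; F; T; F].

(** Corrected by [k] and [h], the last letter becomes an involution commuting with
    [x], [k] and [h]. *)
Definition split_goals := [seq [:: (T, qform w); (T, bform xw w);
  (T, bform kw w); (T, bform hw w)]
  | w <- [seq [:: F; p.1; p.2; T] | p <- [seq (i, j) | i <- [:: F; T], j <- [:: F; T]]]].

(** In each configuration this correction is possible for an arbitrary fourth
    letter in [N]. *)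
Lemma split10 : entails ([seq [:: l] | l <- lits10 xw kw hw] ++ basic 4 ++ in_clauses 4)
  split_goals.
Proof. by vm_compute. Qed.

Lemma split8 : entails ([seq [:: l] | l <- lits8 xw kw hw] ++ basic 4 ++ in_clauses 4)
  split_goals.
Proof. by vm_compute. Qed.

Lemma split9 : entails ([seq [:: l] | l <- lits9 xw kw hw] ++ basic 4 ++ in_clauses 4)
  split_goals.
Proof. by vm_compute. Qed.

Lemma split6 : entails ([seq [:: l] | l <- lits6 xw kw hw] ++ basic 4 ++
  tor_clauses 4 ++ q8_clauses 4) split_goals.
Proof. by vm_compute. Qed.

Definition word_pairs := [seq p <- [seq (u, v) | u <- behead (ins 3), v <- behead (ins 3)]
  | p.1 != p.2].

Definition core_goals us ps :=
  [seq lits10 x y.1 y.2 | x <- us, y <- ps] ++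
  [seq lits8 x y.1 y.2 | x <- us, y <- ps] ++
  [seq lits9 x y.1 y.2 | x <- us, y <- ps].

Lemma core_goalsP us ps g : g \in core_goals us ps ->
  exists u p, [/\ u \in us, p \in ps
    & [\/ g = lits10 u p.1 p.2, g = lits8 u p.1 p.2 | g = lits9 u p.1 p.2]].
Proof.
rewrite !mem_cat => /or3P[] /allpairsP[[u p] /= [uo pp ->]]; exists u, p; split=> //.
- by constructor 1.
- by constructor 2.
- by constructor 3.
Qed.

Lemma word_pairsP p : p \in word_pairs -> p.1 \in ins 3 /\ p.2 \in ins 3.
Proof.
rewrite mem_filter => /andP[_ /allpairsP[[u v] /= [un vn ->]]].
by split; apply: mem_behead.
Qed.

(** A noncommuting pair in [N] leads to one of three configurations after
    replacing [x], [k] and [h] by other words in them. *)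
Lemma core_8_9_10 : entails ([:: [:: (F, bform [:: F; T; F] [:: F; F; T])]] ++
  basic 3 ++ in_clauses 3) (core_goals (outs 3) word_pairs).
Proof. by vm_compute. Qed.

(** Quaternion pairs in [N] and central involutions leave one configuration unless
    the square of [x] is the commutator of the pair. *)
Lemma core_6 : entails ([:: [:: (F, bform [:: F; T; F] [:: F; F; T])];
    [:: (F, addf (bform [:: F; T; F] [:: F; F; T]) (qform [:: T; F; F]))]] ++
  basic 3 ++ tor_clauses 3 ++ q8_clauses 3)
  [seq lits6 [:: T; F; F] p.1 p.2 | p <- word_pairs].
Proof. by vm_compute. Qed.

(** Involutions of [N] commuting with [x] commute with each other. *)
Lemma involutions_commute : entails ([seq [:: l] | l <- [:: (T, qform [:: F; T; F]);
    (T, qform [:: F; F; T]); (T, bform [:: T; F; F] [:: F; T; F]);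
    (T, bform [:: T; F; F] [:: F; F; T])]] ++ basic 3 ++ in_clauses 3)
  [:: [:: (T, bform [:: F; T; F] [:: F; F; T])]].
Proof. by vm_compute. Qed.

(** With [N] abelian, an element of order 4 in [N] forces the involutions of [N]
    to commute with [x]. *)
Lemma abelian_involutions : entails ([seq [:: l] | l <- [:: (T, qform [:: F; T; F]);
    (F, qform [:: F; F; T])]] ++ basic 3 ++ abel_clauses 3)
  [:: [:: (T, bform [:: T; F; F] [:: F; T; F])]].
Proof. by vm_compute. Qed.

Lemma core_5 : entails ([:: [:: (F, bform [:: T; F] [:: F; T])];
    [:: (F, addf (bform [:: T; F] [:: F; T]) (qform [:: T; F]));
        (F, addf (bform [:: T; F] [:: F; T]) (qform [:: F; T]))]] ++
  basic 2 ++ tor_clauses 2)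
  [seq lits5 x [:: F; T] | x <- outs 2].
Proof. by vm_compute. Qed.

Lemma split5 : entails ([seq [:: l] | l <- lits5 [:: T; F; F] [:: F; T; F]] ++
  basic 3 ++ abel_clauses 3 ++ tor_clauses 3)
  [seq [:: (T, qform w); (T, bform [:: T; F; F] w)] | w <- [seq [:: F; i; T] | i <- [:: F; T]]].
Proof. by vm_compute. Qed.

(** The meaning of these configurations for elements of a group. *)
Definition core10 (G : groupType) (x k h : G) :=
  k ^+ 2 = 1 /\ [~ x, k] = 1 /\ [~ x, h] = 1 /\ [~ k, h] = x ^+ 2 /\
  [~ k, h] <> 1 /\ h ^+ 2 <> 1 /\ [~ k, h] <> h ^+ 2.
Definition core8 (G : groupType) (x k h : G) :=
  k ^+ 2 = 1 /\ h ^+ 2 = 1 /\ [~ x, k] = 1 /\ [~ k, h] = x ^+ 2 /\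
  [~ k, h] <> 1 /\ [~ x, h] <> 1 /\ [~ x, h] <> x ^+ 2.
Definition core9 (G : groupType) (x k h : G) :=
  k ^+ 2 = 1 /\ [~ x, h] = 1 /\ [~ k, h] = h ^+ 2 /\ [~ k, h] <> 1 /\
  [~ x, k] = x ^+ 2 * h ^+ 2 /\ x ^+ 2 <> h ^+ 2.
Definition core6 (G : groupType) (x k h : G) :=
  [~ x, k] = 1 /\ [~ x, h] = x ^+ 2 /\ k ^+ 2 = h ^+ 2 /\ [~ k, h] = k ^+ 2 /\
  k ^+ 2 <> 1 /\ x ^+ 2 <> k ^+ 2.
Definition core5 (G : groupType) (x n : G) :=
  [~ x, n] = x ^+ 2 /\ x ^+ 2 <> n ^+ 2 /\ n ^+ 2 <> 1.

Section Classification.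
Variables (G : groupType) (N : pred G).
Hypotheses (exp4 : forall g : G, g ^+ 4 = 1)
  (sqC : forall g h : G, commute (g ^+ 2) h)
  (NM : forall g h, N (g * h) = (N g == N h))
  (hout : forall y, ~~ N y -> y ^+ 2 <> 1)
  (hmix : forall y m, ~~ N y -> N m -> [\/ m ^+ 2 = 1, [~ y, m] = 1,
     [~ y, m] = y ^+ 2 | y ^+ 2 = m ^+ 2]).

Local Notation sat gs := (allsat (qenv gs)).
Local Notation hold gs := (allhold (qenv gs)).

Lemma basic_sat x gs n : ~~ N x -> all N gs -> n = (size gs).+1 ->
  sat (x :: gs) (basic n).
Proof.
move=> xN gN ->; apply: allsat_cat => c; first exact: out_sound.
exact: mix_sound.
Qed.

Section Lits.
Variables (x : G) (gs : seq G).
Local Notation W v := (gword (x :: gs) v).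
Local Notation n := (size gs).+1.

Definition litE := (allhold2, allhold1, holds_q exp4 sqC x (gs := gs),
  holds_b exp4 sqC x (gs := gs), holds_qq exp4 sqC x (gs := gs),
  holds_bq exp4 sqC x (gs := gs), holds_bqq exp4 sqC x (gs := gs)).

Lemma hold_lits10 u v w : size u = n -> size v = n -> size w = n ->
  hold (x :: gs) (lits10 u v w) = core10 (W u) (W v) (W w).
Proof. by move=> su sv sw; rewrite /lits10 !litE. Qed.

Lemma hold_lits8 u v w : size u = n -> size v = n -> size w = n ->
  hold (x :: gs) (lits8 u v w) = core8 (W u) (W v) (W w).
Proof. by move=> su sv sw; rewrite /lits8 !litE. Qed.

Lemma hold_lits9 u v w : size u = n -> size v = n -> size w = n ->
  hold (x :: gs) (lits9 u v w) = core9 (W u) (W v) (W w).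
Proof. by move=> su sv sw; rewrite /lits9 !litE. Qed.

Lemma hold_lits6 u v w : size u = n -> size v = n -> size w = n ->
  hold (x :: gs) (lits6 u v w) = core6 (W u) (W v) (W w).
Proof. by move=> su sv sw; rewrite /lits6 !litE. Qed.

Lemma hold_lits5 u v : size u = n -> size v = n ->
  hold (x :: gs) (lits5 u v) = core5 (W u) (W v).
Proof. by move=> su sv; rewrite /lits5 !litE. Qed.

End Lits.

Let N1 : N 1 := kernel1 NM.

Let NV : forall g, N g^-1 = N g := kernelV NM.

Let NX g (b : bool) : N g -> N (g ^+ b). Proof. by case: b => //=; rewrite N1. Qed.

Definition centralizes3 (x k h d : G) :=
  d ^+ 2 = 1 /\ [~ x, d] = 1 /\ [~ k, d] = 1 /\ [~ h, d] = 1.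

Lemma split_sound x k h cls1 cls2 m : ~~ N x -> N k -> N h -> N m ->
  entails (cls1 ++ basic 4 ++ cls2) split_goals ->
  sat [:: x; k; h; m] cls1 -> sat [:: x; k; h; m] cls2 ->
  exists i j : bool, centralizes3 x k h (k ^+ i * (h ^+ j * m)).
Proof.
move=> Nx Nk Nh Nm ent s1 s2.
have gN : all N [:: k; h; m] by rewrite /= Nk Nh Nm.
have /(entails_words exp4 sqC ent)[g gg hg] : sat [:: x; k; h; m] (cls1 ++ basic 4 ++ cls2).
  by apply: allsat_cat => //; apply: allsat_cat => //; apply: basic_sat.
have [i [j eg]] : exists i j, g = [:: (T, qform [:: F; i; j; T]);
    (T, bform xw [:: F; i; j; T]); (T, bform kw [:: F; i; j; T]);
    (T, bform hw [:: F; i; j; T])].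
  case/mapP: gg => w /mapP[[i j] _ ->] ->; by exists i, j.
exists i, j; move: hg; rewrite -/(allhold _ _) eg !litE //=.
by rewrite !mulg1 !mul1g.
Qed.

(** The corrected elements commute with each other and with [k] and [h], and these
    generate [N] together: being also centralized by [x], they are central. *)
Lemma omega_split x k h : ~~ N x -> N k -> N h ->
  (forall m, N m -> exists i j : bool, centralizes3 x k h (k ^+ i * (h ^+ j * m))) ->
  (forall d d', N d -> N d' -> centralizes3 x k h d -> centralizes3 x k h d' ->
     commute d d') ->
  forall m, N m -> exists i j : bool, Omega N (k ^+ i * (h ^+ j * m)).
Proof.
move=> Nx Nk Nh spl comD m Nm; have [i [j cd]] := spl m Nm; exists i, j.
move: cd; set d := _ * (_ * m) => cd.
have Nd : N d by rewrite !NM !NX.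
have [d2 [xd [kd hd]]] := cd.
have dx : commute d x by apply/commute_sym/commute_comm.
have dk : commute d k by apply/commute_sym/commute_comm.
have dh : commute d h by apply/commute_sym/commute_comm.
have dN g : N g -> commute d g.
  move=> Ng; have [i' [j' cd']] := spl g Ng.
  have -> : g = h ^- j' * (k ^- i' * (k ^+ i' * (h ^+ j' * g))) by rewrite !mulKg.
  apply: commuteM; first exact/commuteV/commuteX.
  apply: commuteM; first exact/commuteV/commuteX.
  by apply: comD => //; rewrite !NM !NX.
split=> // g; have [/dN//|gN] := boolP (N g).
rewrite -(mulVKg x g); apply: commuteM => //; apply: dN.
by rewrite NM NV (negPf Nx) (negPf gN).
Qed.

Section NotTorsion.
Hypothesis hin : forall g h, N g -> N h ->
  [\/ g ^+ 2 = 1, h ^+ 2 = 1, [~ g, h] = 1 | (g * h) ^+ 2 = 1].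

Lemma in_sat x gs n : ~~ N x -> all N gs -> n = (size gs).+1 ->
  sat (x :: gs) (in_clauses n).
Proof. by move=> xN gN -> c; apply: in_sound. Qed.

Lemma class2_core x k h : ~~ N x -> N k -> N h -> ~ commute k h ->
  exists x' k' h', [/\ ~~ N x', N k', N h'
    & core10 x' k' h' \/ core8 x' k' h' \/ core9 x' k' h'].
Proof.
move=> Nx Nk Nh kh; have gN : all N [:: k; h] by rewrite /= Nk Nh.
have [|g gg hg] := entails_words exp4 sqC (x := x) (gs := [:: k; h]) core_8_9_10.
  apply: allsat_cat; last first.
    by apply: allsat_cat; [exact: basic_sat | exact: in_sat].
  move=> c; rewrite inE => /eqP->; eexists; first exact: mem_head.
  by rewrite holds_b //= !mulg1 !mul1g => /commute_comm.
have cfg u (p : form * form) : u \in outs 3 -> p \in word_pairs ->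
    [/\ size u = 3, size p.1 = 3, size p.2 = 3, ~~ N (gword [:: x; k; h] u)
      & N (gword [:: x; k; h] p.1) /\ N (gword [:: x; k; h] p.2)].
  move=> /(outsP NM Nx gN)[su Nu] /word_pairsP[].
  by move=> /(insP NM Nx gN)[sv Nv] /(insP NM Nx gN)[sw Nw].
have [u [p [uo pp gE]]] := core_goalsP gg.
have [su sv sw Nu [Nv Nw]] := cfg u p uo pp.
exists (gword [:: x; k; h] u), (gword [:: x; k; h] p.1), (gword [:: x; k; h] p.2).
split=> //; move: hg; rewrite -/(allhold _ _); case: gE => ->.
- by rewrite hold_lits10 //; left.
- by rewrite hold_lits8 //; right; left.
- by rewrite hold_lits9 //; right; right.
Qed.

Lemma class2_split x k h : ~~ N x -> N k -> N h ->
  core10 x k h \/ core8 x k h \/ core9 x k h ->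
  forall m, N m -> exists i j : bool, Omega N (k ^+ i * (h ^+ j * m)).
Proof.
move=> Nx Nk Nh cfg; apply: (omega_split Nx Nk Nh) => [m Nm|d d' Nd Nd' cd cd'].
  have gN : all N [:: k; h; m] by rewrite /= Nk Nh Nm.
  have ins4 : sat [:: x; k; h; m] (in_clauses 4) by apply: in_sat.
  case: cfg => [c|[c|c]].
  - apply: (split_sound Nx Nk Nh Nm split10) => //; apply: allsat_units.
    by rewrite hold_lits10 //= !mulg1 !mul1g.
  - apply: (split_sound Nx Nk Nh Nm split8) => //; apply: allsat_units.
    by rewrite hold_lits8 //= !mulg1 !mul1g.
  - apply: (split_sound Nx Nk Nh Nm split9) => //; apply: allsat_units.
    by rewrite hold_lits9 //= !mulg1 !mul1g.
have gN : all N [:: d; d'] by rewrite /= Nd Nd'.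
have [|g] := entails_words exp4 sqC (x := x) (gs := [:: d; d']) involutions_commute.
  apply: allsat_cat; last by apply: allsat_cat; [exact: basic_sat | exact: in_sat].
  apply: allsat_units; rewrite !litE //= !mulg1 !mul1g.
  by case: cd cd' => [? [? _]] [? [? _]].
rewrite inE => /eqP->; rewrite -/(allhold _ _) !litE //= !mulg1 !mul1g.
by move/commute_comm.
Qed.

End NotTorsion.

Section Torsion.
Hypotheses (htor : forall g h, N g -> g ^+ 2 = 1 -> commute h g)
  (hq8 : forall g h, N g -> N h ->
     commute g h \/ [~ g, h] = g ^+ 2 /\ [~ g, h] = h ^+ 2).

Lemma tor_sat x gs n : ~~ N x -> all N gs -> n = (size gs).+1 ->
  sat (x :: gs) (tor_clauses n).
Proof. by move=> xN gN -> c; apply: tor_sound. Qed.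

Lemma q8_sat x gs n : ~~ N x -> all N gs -> n = (size gs).+1 ->
  sat (x :: gs) (q8_clauses n).
Proof. by move=> xN gN -> c; apply: q8_sound. Qed.

Lemma class2_core6 x k h : ~~ N x -> N k -> N h -> ~ commute k h ->
  [~ k, h] <> x ^+ 2 ->
  exists k' h', [/\ N k', N h' & core6 x k' h'].
Proof.
move=> Nx Nk Nh kh nx; have gN : all N [:: k; h] by rewrite /= Nk Nh.
have [|g /mapP[p /word_pairsP[pi1 pi2] ->]] :=
    entails_words exp4 sqC (x := x) (gs := [:: k; h]) core_6.
  apply: allsat_cat; last first.
    by apply: allsat_cat; [exact: basic_sat | apply: allsat_cat;
      [exact: tor_sat | exact: q8_sat]].
  move=> c; rewrite !inE => /orP[] /eqP->; eexists; try exact: mem_head.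
    by rewrite holds_b //= !mulg1 !mul1g => /commute_comm.
  by rewrite holds_bq //= !mulg1 !mul1g.
have [sv Nv] := insP NM Nx gN pi1; have [sw Nw] := insP NM Nx gN pi2.
rewrite -/(allhold _ _) hold_lits6 // => cfg.
exists (gword [:: x; k; h] p.1), (gword [:: x; k; h] p.2); split=> //.
by move: cfg; rewrite /= !mulg1.
Qed.

Lemma class2_split6 x k h : ~~ N x -> N k -> N h -> core6 x k h ->
  forall m, N m -> exists i j : bool, Omega N (k ^+ i * (h ^+ j * m)).
Proof.
move=> Nx Nk Nh cfg; apply: (omega_split Nx Nk Nh) => [m Nm|d d' Nd Nd' cd [d2 _]].
  have gN : all N [:: k; h; m] by rewrite /= Nk Nh Nm.
  apply: (split_sound Nx Nk Nh Nm split6).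
    by apply: allsat_units; rewrite hold_lits6 //= !mulg1 !mul1g.
  by apply: allsat_cat; [exact: tor_sat | exact: q8_sat].
exact: htor.
Qed.

End Torsion.

Section Abelian.
Hypothesis hab : forall g h, N g -> N h -> commute g h.

Lemma abel_sat x gs n : ~~ N x -> all N gs -> n = (size gs).+1 ->
  sat (x :: gs) (abel_clauses n).
Proof. by move=> xN gN -> c; apply: abel_sound. Qed.

Lemma class2_abelian_tor m : N m -> m ^+ 2 <> 1 ->
  forall g h, N g -> g ^+ 2 = 1 -> commute h g.
Proof.
move=> Nm m2 g h Ng g2; have [Nh|Nh] := boolP (N h); first exact: hab.
have gN : all N [:: g; m] by rewrite /= Ng Nm.
have [|l] := entails_words exp4 sqC (x := h) (gs := [:: g; m]) abelian_involutions.
  apply: allsat_cat; last by apply: allsat_cat; [exact: basic_sat | exact: abel_sat].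
  by apply: allsat_units; rewrite !litE //= !mulg1 !mul1g.
rewrite inE => /eqP->; rewrite -/(allhold _ _) !litE //= !mulg1 !mul1g.
by move/commute_comm.
Qed.

Lemma class2_core5 m x n : N m -> m ^+ 2 <> 1 -> ~~ N x -> N n -> ~ commute x n ->
  ([~ x, n] = x ^+ 2 -> [~ x, n] <> n ^+ 2) ->
  exists2 x', ~~ N x' & core5 x' n.
Proof.
move=> Nm m2 Nx Nn xn nq.
have [|l /mapP[u uo ->]] := entails_words exp4 sqC (x := x) (gs := [:: n]) core_5.
  apply: allsat_cat; last first.
    apply: allsat_cat; first by apply: basic_sat; rewrite //= Nn.
    by apply: (tor_sat (class2_abelian_tor Nm m2)); rewrite //= Nn.
  move=> c; rewrite !inE => /orP[] /eqP->.
    eexists; first exact: mem_head.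
    by rewrite holds_b //= !mulg1 !mul1g => /commute_comm.
  have [e|/eqP e] := eqVneq [~ x, n] (x ^+ 2).
    eexists; first by rewrite inE; apply/orP; right; apply: mem_head.
    by rewrite holds_bq //= !mulg1 !mul1g; apply: nq.
  eexists; first exact: mem_head.
  by rewrite holds_bq //= !mulg1 !mul1g.
have gN : all N [:: n] by rewrite /= Nn.
have [su Nu] := outsP NM Nx gN uo.
rewrite -/(allhold _ _) hold_lits5 // => cfg.
exists (gword [:: x; n] u) => //.
by move: cfg; rewrite /= !mulg1 !mul1g.
Qed.

Lemma class2_split5 m0 x n : N m0 -> m0 ^+ 2 <> 1 -> ~~ N x -> N n -> core5 x n ->
  forall m, N m -> exists i : bool, Omega N (n ^+ i * m).
Proof.
move=> Nm0 m02 Nx Nn cfg m Nm; have gN : all N [:: n; m] by rewrite /= Nn Nm.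
have htor := class2_abelian_tor Nm0 m02.
have [|l] := entails_words exp4 sqC (x := x) (gs := [:: n; m]) split5.
  apply: allsat_cat.
    by apply: allsat_units; rewrite hold_lits5 //= !mulg1 !mul1g.
  apply: allsat_cat; first exact: basic_sat.
  by apply: allsat_cat; [exact: abel_sat | exact: (tor_sat htor)].
move=> /mapP[w /mapP[i _ ->] ->]; rewrite -/(allhold _ _) !litE //= !mulg1 !mul1g.
case=> [d2 /commute_comm xd]; exists i.
have Nd : N (n ^+ i * m) by rewrite NM Nm NX.
by split=> // g; apply/commute_sym/htor.
Qed.

End Abelian.

End Classification.

(** * The presentations *)

Import Presentation.

Definition pres1 := Grel (a : b : a ^+ 8 = 1, b ^+ 2 = a ^+ 4, a * b = b * a ^+ 3).
Definition pres2 := Grel (a : b : a ^+ 8 = 1, b ^+ 2 = a ^+ 4, a * b = b * a ^-1).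
Definition pres5 := Grel (a : b : a ^+ 4 = b ^+ 4 = 1, a * b = b ^-1 * a).
Definition pres6 := Grel (a : b : c : a ^+ 4 = b ^+ 4 = 1, c ^+ 2 = a ^+ 2,
  a * b = b * a, a * c = c * a ^-1, b * c = c * b ^-1).
Definition pres7 := Grel (a : b : c : a ^+ 2 = 1, b ^+ 2 = 1, c ^+ 2 = 1,
  a * b * c = b * c * a = c * a * b).
Definition pres8 := Grel (a : b : c : d :
  a ^+ 4 = 1, b ^+ 2 = 1, c ^+ 2 = 1, d ^+ 2 = 1,
  a * b = b * a, a * c = c * a, a * d = d * a * b,
  b * c = c * b, b * d = d * b, c * d = d * a ^+ 2 * c).
Definition pres9 := Grel (a : b : c : a ^+ 4 = b ^+ 4 = 1, c ^+ 2 = 1,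
  a * b = b * a, a * c = c * a ^-1, b * c = c * a ^+ 2 * b ^-1).
Definition pres10 := Grel (a : b : c : a ^+ 4 = b ^+ 4 = 1, c ^+ 2 = 1,
  a * b = b * a, a * c = c * a, b * c = c * a ^+ 2 * b).

Definition tab5 := TripleData (true, false) (false, true) (false, false)
  (false, true) (false, false) (false, false) false true.
Definition tab6 := TripleData (true, false) (false, true) (true, false)
  (false, false) (true, false) (false, true) true true.
Definition tab7 := TripleData (false, false) (false, false) (false, false)
  (true, false) (true, false) (true, false) true false.
Definition tab8 := TripleData (true, false) (false, false) (false, false)
  (false, false) (false, true) (true, false) true true.
Definition tab9 := TripleData (true, false) (false, true) (false, false)
  (false, false) (true, false) (true, true) true true.
Definition tab10 := TripleData (true, false) (false, true) (false, false)
  (false, false) (false, false) (true, false) true true.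

Lemma tab5_ok : table_ok (wmul tab5) wone (words tab5).
Proof. by vm_compute. Qed.
Lemma tab6_ok : table_ok (wmul tab6) wone (words tab6).
Proof. by vm_compute. Qed.
Lemma tab7_ok : table_ok (wmul tab7) wone (words tab7).
Proof. by vm_compute. Qed.
Lemma tab8_ok : table_ok (wmul tab8) wone (words tab8).
Proof. by vm_compute. Qed.
Lemma tab9_ok : table_ok (wmul tab9) wone (words tab9).
Proof. by vm_compute. Qed.
Lemma tab10_ok : table_ok (wmul tab10) wone (words tab10).
Proof. by vm_compute. Qed.

Section Relations.
Variables (H : groupType) (e : seq H).

Lemma seq2 : size e = 2 -> exists a b, e = [:: a; b].
Proof. by case: e => [|a [|b []]] //; exists a, b. Qed.

Lemma seq3 : size e = 3 -> exists a b c, e = [:: a; b; c].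
Proof. by case: e => [|a [|b [|c []]]] //; exists a, b, c. Qed.

Lemma seq4 : size e = 4 -> exists a b c d, e = [:: a; b; c; d].
Proof. by case: e => [|a [|b [|c [|d []]]]] //; exists a, b, c, d. Qed.

Let sq2 (x : H) : x ^+ 4 = 1 -> (x ^+ 2) ^+ 2 = 1.
Proof. by rewrite -expgnA. Qed.

Let sqV (x : H) : x ^+ 4 = 1 -> x^-1 = x * x ^+ 2.
Proof. by move=> x4; apply: mulg1_eq; rewrite -!expgS. Qed.

Let inv_sq (x y : H) : x ^+ 4 = 1 -> inverts y x -> commute (x ^+ 2) y.
Proof.
move=> x4; rewrite /inverts /commute => xy.
have e2 : x^-1 * x^-1 = x * x by rewrite -invgM -expg2; apply/sqg1; rewrite sq2.
by rewrite !expg2 -mulgA xy mulgA xy -mulgA e2.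
Qed.

Let inv_swap (x y : H) : inverts y x -> y * x = x * y * x ^+ 2.
Proof. by move=> xy; rewrite xy -mulgA expg2 mulKg. Qed.

Let comX2 (x y : H) : commute x y -> commute (x ^+ 2) y.
Proof. by move=> xy; apply/commute_sym/commuteX/commute_sym. Qed.

(* For the tables whose third element is trivial. *)
Let c1 (x : H) : commute x 1. Proof. exact: commute1. Qed.

Let sq_swap (x y z : H) : x * y = y * x * z -> commute z x -> z ^+ 2 = 1 ->
  commute (x ^+ 2) y.
Proof.
move=> xy zx z2; rewrite /commute expg2 -mulgA xy !mulgA xy -!mulgA.
by rewrite [z * (x * z)]mulgA zx -mulgA -expg2 z2 mulg1.
Qed.

(** Each presentation makes the squares and the commutators of its generators
    central, with the values collected in its table. *)
Lemma pres5_triple : relations e pres5 ->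
  exists a b, e = [:: a; b] /\ triple tab5 a b 1 (a ^+ 2) (b ^+ 2).
Proof.
rewrite /relations /= => -[[[a4 b4] ab] /seq2[a [b ee]]]; exists a, b; split=> //.
move: a4 b4 ab; rewrite ee /= => a4 b4 ab.
have ba : b * a = a * b * b ^+ 2.
  by rewrite -mulgA -sqV //; apply: (mulgI b^-1); rewrite mulKg mulgA -ab mulgK.
have b2a : commute (b ^+ 2) a.
  apply: inv_sq => //; apply: (mulgI b^-1); rewrite mulKg mulgA -ab.
  by rewrite mulgK.
have a2b : commute (a ^+ 2) b.
  have abV : a * b^-1 = b * a by apply: (mulgI b^-1); rewrite mulgA -ab mulgK mulKg.
  by rewrite /commute !expg2 -mulgA ab mulgA abV mulgA.
split; rewrite ?sq2 ?expg1n /zval /= ?mulg1 ?mul1g //.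
- exact: comX2.
- exact: comX2.
- exact: comX2.
Qed.

Lemma pres6_triple : relations e pres6 ->
  exists a b c, e = [:: a; b; c] /\ triple tab6 a b c (a ^+ 2) (b ^+ 2).
Proof.
rewrite /relations /= => -[] rel /seq3[a [b [c ee]]]; exists a, b, c; split=> //.
move: rel; rewrite ee /= => -[[a4 b4] [cc [ab [ac bc]]]].
have a2c := inv_sq a4 ac; have b2c := inv_sq b4 bc.
split; rewrite ?sq2 /zval /= ?mulg1 ?mul1g -?inv_swap //; by [exact: comX2 | exact: esym | exact: commuteX2].
Qed.

(** The product [c a b] is central, and its square is the commutator of any two of
    the generators. *)
Lemma pres7_triple : relations e pres7 ->
  exists a b c, e = [:: a; b; c] /\ triple tab7 a b c ((a * b) ^+ 2) 1.
Proof.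
rewrite /relations /= => -[] rel /seq3[a [b [c ee]]]; exists a, b, c; split=> //.
move: rel; rewrite ee /= => -[a2 [b2 [c2]]].
set t := c * a * b => -[tE1 tE2].
have [aK bK] : (forall y, a * (a * y) = y) /\ (forall y, b * (b * y) = y).
  by split=> y; rewrite mulgA -expg2 ?a2 ?b2 mul1g.
have ta : commute t a by rewrite /commute -{1}tE1 -tE2 !mulgA.
have tb : commute t b by rewrite /commute -{1}tE2 !mulgA.
have tc : commute t c by rewrite /commute -{2}tE1 !mulgA.
clearbody t.
have cE : c = b * a * t by rewrite -tE1 -!mulgA aK bK.
have tt : t ^+ 2 = (a * b) ^+ 2.
  have [aV bV] : a^-1 = a /\ b^-1 = b by split; apply/sqg1.
  have tba : commute (b * a) t by apply/commute_sym/commuteM.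
  rewrite -{1}aV -{1}bV -invgM expVgn; apply/esym/mulg1_eq.
  by rewrite -expgMn // -cE.
have tt' : t ^+ 2 = (b * a) ^+ 2.
  apply: (mulgI a); rewrite -(comX2 ta).
  by rewrite tt !expg2 !mulgA.
have uC x : commute t x -> commute ((a * b) ^+ 2) x by rewrite -tt => /comX2.
have u2 : (a * b) ^+ 2 ^+ 2 = 1.
  by rewrite expg2 -{2}tt tt' !expg2 -!mulgA bK aK bK -expg2 a2.
have ba : b * a = a * b * (a * b) ^+ 2.
  by rewrite -tt tt' !expg2 -!mulgA bK aK.
split; rewrite /zval /= ?expg1n ?mulg1 ?mul1g //; try exact: uC;
  try exact/commute_sym/commute1.
- rewrite expg1 cE -!mulgA ta aK -(uC t (commute_refl t)).
  by rewrite !expg2 -!mulgA aK bK aK.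
- rewrite expg1 cE -!mulgA tb bK -(uC t (commute_refl t)).
  by rewrite !expg2 -!mulgA aK.
Qed.

Lemma pres8_triple : relations e pres8 ->
  exists a b c d, e = [:: a; b; c; d] /\ triple tab8 a c d (a ^+ 2) b.
Proof.
rewrite /relations /= => -[] rel /seq4[a [b [c [d ee]]]]; exists a, b, c, d; split=> //.
move: rel; rewrite ee /= => -[a4 [b2 [c2 [d2 [ab [ac [ad [bc [bd cd]]]]]]]]].
have a2d : commute (a ^+ 2) d.
  have bab : b * (a * b) = a by rewrite ab mulgA -expg2 b2 mul1g.
  by rewrite /commute expg2 -[LHS]mulgA ad !mulgA ad -!mulgA bab.
have da : d * a = a * d * b by rewrite ad -mulgA -expg2 b2 mulg1.
have dc : d * c = c * d * a ^+ 2.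
  have a2ca2 : a ^+ 2 * c * a ^+ 2 = c.
    by rewrite (comX2 ac) -mulgA -expgnDr a4 mulg1.
  by rewrite cd -(mulgA d) -(mulgA d) a2ca2.
split; rewrite ?sq2 /zval /= ?mulg1 ?mul1g //; by [exact: comX2 | exact: esym].
Qed.

Lemma pres9_triple : relations e pres9 ->
  exists a b c, e = [:: a; b; c] /\ triple tab9 a b c (a ^+ 2) (b ^+ 2).
Proof.
rewrite /relations /= => -[] rel /seq3[a [b [c ee]]]; exists a, b, c; split=> //.
move: rel; rewrite ee /= => -[[a4 b4] [c2 [ab [ac bc]]]].
have a2c := inv_sq a4 ac.
have a2b : commute (a ^+ 2) b by apply: comX2.
have a2b2 : commute (a ^+ 2) (b ^+ 2) by apply: commuteX.
have bc' : b * c = c * b * (a ^+ 2 * b ^+ 2).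
  rewrite bc (sqV b4) -!(mulgA c); congr (_ * _).
  by rewrite [LHS]mulgA a2b -mulgA.
have u2 : (a ^+ 2 * b ^+ 2) * (a ^+ 2 * b ^+ 2) = 1.
  by rewrite -expg2 expgMn // !sq2 // mulg1.
have cb : c * b = b * c * (a ^+ 2 * b ^+ 2) by rewrite bc' -mulgA u2 mulg1.
have b2c : commute (b ^+ 2) c.
  apply: sq_swap bc' _ _; last by rewrite expgMn // !sq2 // mulg1.
  by apply/commute_sym/commuteM; [apply/commute_sym | apply: commuteX].
split; rewrite ?sq2 /zval /= ?mulg1 ?mul1g -?inv_swap //; by [exact: comX2 | exact: esym | exact: commuteX].
Qed.

Lemma pres10_triple : relations e pres10 ->
  exists a b c, e = [:: a; b; c] /\ triple tab10 a b c (a ^+ 2) (b ^+ 2).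
Proof.
rewrite /relations /= => -[] rel /seq3[a [b [c ee]]]; exists a, b, c; split=> //.
move: rel; rewrite ee /= => -[[a4 b4] [c2 [ab [ac bc]]]].
have a2c := comX2 ac; have a2b := comX2 ab.
have bc' : b * c = c * b * a ^+ 2 by rewrite bc -(mulgA c) a2b mulgA.
have cb : c * b = b * c * a ^+ 2.
  by rewrite bc' -mulgA -expgnDr a4 mulg1.
have b2c : commute (b ^+ 2) c by apply: sq_swap bc' a2b _; rewrite sq2.
split; rewrite ?sq2 /zval /= ?mulg1 ?mul1g //; by [exact: comX2 | exact: esym | exact: commuteX].
Qed.

Lemma pres2_octic : relations e pres2 ->
  exists a b, [/\ e = [:: a; b], a ^+ 8 = 1, b ^+ 2 = a ^+ 4 & a * b = b * a ^+ 7].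
Proof.
rewrite /relations /= => -[] rel /seq2[a [b ee]]; exists a, b; split=> //;
  move: rel; rewrite ee /= => -[a8 [b2 ab]] //.
by rewrite ab; congr (_ * _); apply: mulg1_eq; rewrite -expgS.
Qed.

Lemma pres1_octic : relations e pres1 ->
  exists a b, [/\ e = [:: a; b], a ^+ 8 = 1, b ^+ 2 = a ^+ 4 & a * b = b * a ^+ 3].
Proof.
rewrite /relations /= => -[] rel /seq2[a [b ee]]; exists a, b; split=> //;
  by move: rel; rewrite ee /= => -[a8 [b2 ab]].
Qed.

End Relations.

(** * Recognizing the groups of the list *)

Section Recognition.
Variables (G : groupType) (N : pred G).
Hypothesis NM : forall g h, N (g * h) = (N g == N h).

Let N1 : N 1 := kernel1 NM.

Let NV : forall g, N g^-1 = N g := kernelV NM.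

Lemma Omega1 : Omega N 1.
Proof. by split; rewrite ?expg1n // => g; apply/commute_sym/commute1. Qed.

Lemma OmegaM x y : Omega N x -> Omega N y -> Omega N (x * y).
Proof.
move=> [Nx x2 xC] [Ny y2 yC]; split; first by rewrite NM Nx Ny.
  by rewrite expgMn ?x2 ?y2 ?mulg1.
by move=> g; apply/commute_sym/commuteM; apply/commute_sym.
Qed.

Section Table.
Variables (M : eqType) (mul : M -> M -> M) (one : M) (els : seq M) (ev : M -> G).
Variables (S gs ls : seq M) (NP : pred M).

Definition split_ok := let l := generated mul one ls in
  [&& table_ok mul one els, nondeg mul one els S, closure_ok mul one els gs,
    all (mem (generated mul one gs)) els, closure_ok mul one els ls
    & all (fun m => NP m == (m \in l)) els].

Lemma table_split p : (forall x y, ev (mul x y) = ev x * ev y) -> split_ok ->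
  (forall m, N (ev m) = NP m) -> (forall s, s \in S -> ev s <> 1) ->
  (forall g, exists2 k, gen (map ev gs) k & Omega N (k * g)) ->
  relations (map ev gs) p ->
  (forall (H : groupType) (e' : seq H), relations e' p ->
     exists2 evH : M -> H, forall x y, evH (mul x y) = evH x * evH y
     & map evH gs = e') ->
  exists E, [/\ elem_abelian2 E, presents (map ev gs) p,
     [set: G] = dprod (gen (map ev gs)) E & [set x | N x] = dprod (gen (map ev ls)) E].
Proof.
move=> evM /and5P[ok nd gok gall /andP[lok lNP]] NE nS GO rel univ.
apply: (model_split evM ok (NM := NP) (Om := Omega N) _ _ Omega1 OmegaM _ _ _ nd nS) => //.
- by move=> x y Nx Ny; rewrite NM Nx Ny.
- by move=> x; rewrite NV.
- move=> g; have [k Kk Ow] := GO g.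
  have [_ _ genV] := subgroup_gen (map ev gs).
  have /(gen_closureP evM ok _ gok)[m mc mE] := genV _ Kk.
  exists m, (k * g); split=> //; last by rewrite -mE mulKg.
  by case/and4P: gok => _ _ /allP/(_ m mc).
Qed.

End Table.

Lemma triple_split d S gs ls p a b c u v : triple d a b c u v -> N u -> N v ->
  split_ok (wmul d) wone (words d) S gs ls (parity (N a) (N b) (N c)) ->
  (forall s, s \in S -> wval a b c u v s <> 1) ->
  (forall g, exists2 k, gen (map (wval a b c u v) gs) k & Omega N (k * g)) ->
  relations (map (wval a b c u v) gs) p ->
  (forall (H : groupType) (e' : seq H), relations e' p -> exists a' b' c' u' v',
     triple d a' b' c' u' v' /\ map (wval a' b' c' u' v') gs = e') ->
  exists E, [/\ elem_abelian2 E, presents (map (wval a b c u v) gs) p,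
     [set: G] = dprod (gen (map (wval a b c u v) gs)) E
     & [set x | N x] = dprod (gen (map (wval a b c u v) ls)) E].
Proof.
move=> tr Nu Nv ok nS GO rel univ; apply: (table_split _ ok) => //.
- exact: (wvalM tr).
- by move=> w; apply: N_wval.
move=> H e' /univ[a' [b' [c' [u' [v' [tr' e'E]]]]]].
by exists (wval a' b' c' u' v') => //; apply: (wvalM tr').
Qed.

Lemma octic_split r S gs ls p a b : (r * r = 1 %[mod 8])%N ->
  a ^+ 8 = 1 -> b ^+ 2 = a ^+ 4 -> a * b = b * a ^+ r ->
  split_ok (omul r) (0%N, false) octs S gs ls (oparity (N a) (N b)) ->
  (forall s, s \in S -> oval a b s <> 1) ->
  (forall g, exists2 k, gen (map (oval a b) gs) k & Omega N (k * g)) ->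
  relations (map (oval a b) gs) p ->
  (forall (H : groupType) (e' : seq H), relations e' p -> exists a' b',
     [/\ a' ^+ 8 = 1, b' ^+ 2 = a' ^+ 4, a' * b' = b' * a' ^+ r
       & map (oval a' b') gs = e']) ->
  exists E, [/\ elem_abelian2 E, presents (map (oval a b) gs) p,
     [set: G] = dprod (gen (map (oval a b) gs)) E
     & [set x | N x] = dprod (gen (map (oval a b) ls)) E].
Proof.
move=> rr a8 bb ab ok nS GO rel univ; apply: (table_split _ ok) => //.
- exact: ovalM.
- by move=> w; apply: N_oval.
move=> H e' /univ[a' [b' [a8' bb' ab' e'E]]].
by exists (oval a' b') => //; apply: ovalM.
Qed.

(** Multiplication by [x] brings the elements outside [N] into [N]. *)
Lemma gen_Omega s x k h : ~~ N x -> gen s x -> gen s k -> gen s h ->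
  (forall m, N m -> exists i j : bool, Omega N (k ^+ i * (h ^+ j * m))) ->
  forall g, exists2 y, gen s y & Omega N (y * g).
Proof.
move=> Nx sx sk sh spl g; have sgs := subgroup_gen s; have [_ sM _] := sgs.
have sX y n : gen s y -> gen s (y ^+ n) by apply: subgroupX.
have [Ng|Ng] := boolP (N g).
  have [i [j Om]] := spl g Ng; exists (k ^+ i * h ^+ j); last by rewrite -mulgA.
  exact: sM (sX _ i sk) (sX _ j sh).
have Nxg : N (x * g) by rewrite NM (negPf Nx) (negPf Ng).
have [i [j Om]] := spl _ Nxg; exists (k ^+ i * (h ^+ j * x)); last by rewrite -!mulgA.
exact: sM (sX _ i sk) (sM _ _ (sX _ j sh) sx).
Qed.

End Recognition.

Notation wa := (true, false, false, (false, false)).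
Notation wb := (false, true, false, (false, false)).
Notation wc := (false, false, true, (false, false)).
Notation wu := (false, false, false, (true, false)).
Notation wv := (false, false, false, (false, true)).
Notation wuv := (false, false, false, (true, true)).

Lemma wvalE (G : groupType) (a b c u v : G) :
  (wval a b c u v wa = a) * (wval a b c u v wb = b) * (wval a b c u v wc = c) *
  (wval a b c u v wu = u) * (wval a b c u v wv = v) * (wval a b c u v wuv = u * v).
Proof. by rewrite /wval /zval /= !mulg1 !mul1g. Qed.

Lemma ovalE (G : groupType) (a b : G) : (oval a b (1%N, false) = a) *
  (oval a b (0%N, true) = b) * (oval a b (1%N, true) = a * b) *
  (oval a b (2%N, false) = a ^+ 2) * (oval a b (4%N, false) = a ^+ 4).
Proof. by rewrite /oval /= !mulg1 !mul1g. Qed.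

Section Items.
Variables (G : groupType) (N : pred G).
Hypothesis NM : forall g h, N (g * h) = (N g == N h).

Local Notation decomposes s := (forall g, exists2 y, gen s y & Omega N (y * g)).
Local Notation splits p s L := (exists E : set G, [/\ elem_abelian2 E, presents s p,
  [set: G] = dprod (gen s) E & [set x | N x] = dprod L E]).

Let N1 : N 1 := kernel1 NM.

Let wuvS (a b c u v : G) : u <> 1 -> v <> 1 -> u <> v -> v ^+ 2 = 1 ->
  forall s, s \in [:: wu; wv; wuv] -> wval a b c u v s <> 1.
Proof.
move=> u1 v1 uv v2 s; rewrite !inE => /or3P[] /eqP->; rewrite !wvalE //.
by move=> /mulg1_eq uV; apply: uv; rewrite -(invgK u) uV; apply/sqg1.
Qed.

(** The listed generators of the intersection of [N] with the presented subgroup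
    are found to generate its elements of even parity by computing in the table. *)
Lemma pres5_recognize (a b : G) : relations [:: a; b] pres5 -> N a -> ~~ N b ->
  a ^+ 2 <> 1 -> b ^+ 2 <> 1 -> a ^+ 2 <> b ^+ 2 -> decomposes [:: a; b] ->
  splits pres5 [:: a; b] (gen [:: a; b ^+ 2]).
Proof.
move=> rel Na Nb a2 b2 ab dec; have [_ [_ [[<- <-] tr]]] := pres5_triple rel.
have b4 : b ^+ 2 ^+ 2 = 1 by case: tr.
have ok : split_ok (wmul tab5) wone (words tab5) [:: wu; wv; wuv]
  [:: wa; wb] [:: wa; wv] (parity (N a) (N b) (N 1)).
  by rewrite Na (negPf Nb) N1; vm_compute.
move: (triple_split NM (p := pres5) tr (kernel_sq NM a) (kernel_sq NM b) ok) => {ok}.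
rewrite /= !wvalE; apply=> //.
- by move=> s; apply: wuvS.
- move=> H e' /pres5_triple[a' [b' [-> tr']]].
  by exists a', b', 1, (a' ^+ 2), (b' ^+ 2); rewrite !wvalE.
Qed.

Lemma pres6_recognize (a b c : G) : relations [:: a; b; c] pres6 ->
  N a -> ~~ N b -> N c -> a ^+ 2 <> 1 -> b ^+ 2 <> 1 -> a ^+ 2 <> b ^+ 2 ->
  decomposes [:: a; b; c] ->
  splits pres6 [:: a; b; c] (dprod (gen [:: a; c]) (gen [:: b ^+ 2])).
Proof.
move=> rel Na Nb Nc a2 b2 ab dec.
have [_ [_ [_ [[<- <- <-] tr]]]] := pres6_triple rel.
have b4 : b ^+ 2 ^+ 2 = 1 by case: tr.
have nS s : s \in [:: wu; wv; wuv] -> wval a b c (a ^+ 2) (b ^+ 2) s <> 1.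
  exact: wuvS.
have -> : dprod (gen [:: a; c]) (gen [:: b ^+ 2]) = gen [:: a; c; b ^+ 2].
  have ok : dprod_ok (wmul tab6) wone (words tab6) [:: wu; wv; wuv] [:: wa; wc] [:: wv].
    by vm_compute.
  move: (dprod_closure (wvalM tr) tab6_ok ok nS) => {ok}.
  by rewrite /= !wvalE.
have ok : split_ok (wmul tab6) wone (words tab6) [:: wu; wv; wuv]
  [:: wa; wb; wc] [:: wa; wc; wv] (parity (N a) (N b) (N c)).
  by rewrite Na (negPf Nb) Nc; vm_compute.
move: (triple_split NM (p := pres6) tr (kernel_sq NM a) (kernel_sq NM b) ok) => {ok}.
rewrite /= !wvalE; apply=> //.
- move=> H e' /pres6_triple[a' [b' [c' [-> tr']]]].
  by exists a', b', c', (a' ^+ 2), (b' ^+ 2); rewrite !wvalE.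
Qed.

Lemma pres7_recognize (a b c : G) : relations [:: a; b; c] pres7 ->
  N a -> N b -> ~~ N c -> (a * b) ^+ 2 <> 1 -> decomposes [:: a; b; c] ->
  splits pres7 [:: a; b; c] (gen [:: a; b]).
Proof.
move=> rel Na Nb Nc u1 dec.
have [_ [_ [_ [[<- <- <-] tr]]]] := pres7_triple rel.
have ok : split_ok (wmul tab7) wone (words tab7) [:: wu]
  [:: wa; wb; wc] [:: wa; wb] (parity (N a) (N b) (N c)).
  by rewrite Na Nb (negPf Nc); vm_compute.
move: (triple_split NM (p := pres7) tr (kernel_sq NM _) N1 ok) => {ok}.
rewrite /= !wvalE; apply=> //.
- by move=> s; rewrite inE => /eqP->; rewrite !wvalE.
- move=> H e' /pres7_triple[a' [b' [c' [-> tr']]]].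
  by exists a', b', c', ((a' * b') ^+ 2), 1; rewrite !wvalE.
Qed.

Lemma pres8_recognize (a b c d : G) : relations [:: a; b; c; d] pres8 ->
  ~~ N a -> N b -> N c -> N d -> a ^+ 2 <> 1 -> b <> 1 -> a ^+ 2 <> b ->
  decomposes [:: a; b; c; d] ->
  splits pres8 [:: a; b; c; d] (dprod (gen [:: b]) (gen [:: c; d])).
Proof.
move=> rel Na Nb Nc Nd a2 b1 ab dec.
have [_ [_ [_ [_ [[<- <- <- <-] tr]]]]] := pres8_triple rel.
have b2 : b ^+ 2 = 1 by case: tr.
have nS s : s \in [:: wu; wv; wuv] -> wval a c d (a ^+ 2) b s <> 1.
  exact: wuvS.
have -> : dprod (gen [:: b]) (gen [:: c; d]) = gen [:: b; c; d].
  have ok : dprod_ok (wmul tab8) wone (words tab8) [:: wu; wv; wuv] [:: wv] [:: wb; wc].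
    by vm_compute.
  move: (dprod_closure (wvalM tr) tab8_ok ok nS) => {ok}.
  by rewrite /= !wvalE.
have ok : split_ok (wmul tab8) wone (words tab8) [:: wu; wv; wuv]
  [:: wa; wv; wb; wc] [:: wv; wb; wc] (parity (N a) (N c) (N d)).
  by rewrite (negPf Na) Nc Nd; vm_compute.
move: (triple_split NM (p := pres8) tr (kernel_sq NM a) Nb ok) => {ok}.
rewrite /= !wvalE; apply=> //.
- move=> H e' /pres8_triple[a' [b' [c' [d' [-> tr']]]]].
  by exists a', c', d', (a' ^+ 2), b'; rewrite !wvalE.
Qed.

Lemma pres9_recognize (a b c : G) : relations [:: a; b; c] pres9 ->
  N a -> ~~ N b -> N c -> a ^+ 2 <> 1 -> b ^+ 2 <> 1 -> a ^+ 2 <> b ^+ 2 ->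
  decomposes [:: a; b; c] ->
  splits pres9 [:: a; b; c] (dprod (gen [:: a; c]) (gen [:: b ^+ 2])).
Proof.
move=> rel Na Nb Nc a2 b2 ab dec.
have [_ [_ [_ [[<- <- <-] tr]]]] := pres9_triple rel.
have b4 : b ^+ 2 ^+ 2 = 1 by case: tr.
have nS s : s \in [:: wu; wv; wuv] -> wval a b c (a ^+ 2) (b ^+ 2) s <> 1.
  exact: wuvS.
have -> : dprod (gen [:: a; c]) (gen [:: b ^+ 2]) = gen [:: a; c; b ^+ 2].
  have ok : dprod_ok (wmul tab9) wone (words tab9) [:: wu; wv; wuv] [:: wa; wc] [:: wv].
    by vm_compute.
  move: (dprod_closure (wvalM tr) tab9_ok ok nS) => {ok}.
  by rewrite /= !wvalE.
have ok : split_ok (wmul tab9) wone (words tab9) [:: wu; wv; wuv]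
  [:: wa; wb; wc] [:: wa; wc; wv] (parity (N a) (N b) (N c)).
  by rewrite Na (negPf Nb) Nc; vm_compute.
move: (triple_split NM (p := pres9) tr (kernel_sq NM a) (kernel_sq NM b) ok) => {ok}.
rewrite /= !wvalE; apply=> //.
- move=> H e' /pres9_triple[a' [b' [c' [-> tr']]]].
  by exists a', b', c', (a' ^+ 2), (b' ^+ 2); rewrite !wvalE.
Qed.

Lemma pres10_recognize (a b c : G) : relations [:: a; b; c] pres10 ->
  ~~ N a -> N b -> N c -> a ^+ 2 <> 1 -> b ^+ 2 <> 1 -> a ^+ 2 <> b ^+ 2 ->
  decomposes [:: a; b; c] ->
  splits pres10 [:: a; b; c] (gen [:: b; c]).
Proof.
move=> rel Na Nb Nc a2 b2 ab dec.
have [_ [_ [_ [[<- <- <-] tr]]]] := pres10_triple rel.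
have b4 : b ^+ 2 ^+ 2 = 1 by case: tr.
have ok : split_ok (wmul tab10) wone (words tab10) [:: wu; wv; wuv]
  [:: wa; wb; wc] [:: wb; wc] (parity (N a) (N b) (N c)).
  by rewrite (negPf Na) Nb Nc; vm_compute.
move: (triple_split NM (p := pres10) tr (kernel_sq NM a) (kernel_sq NM b) ok) => {ok}.
rewrite /= !wvalE; apply=> //.
- by move=> s; apply: wuvS.
- move=> H e' /pres10_triple[a' [b' [c' [-> tr']]]].
  by exists a', b', c', (a' ^+ 2), (b' ^+ 2); rewrite !wvalE.
Qed.

Lemma pres1_recognize (a b : G) : relations [:: a; b] pres1 -> ~~ N a -> ~~ N b ->
  a ^+ 4 <> 1 -> decomposes [:: a; b] ->
  splits pres1 [:: a; b] (gen [:: a ^+ 2; a * b]).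
Proof.
move=> rel Na Nb a4 dec.
have [_ [_ [[<- <-] a8 bb ab]]] := pres1_octic rel.
have ok : split_ok (omul 3) (0%N, false) octs [:: (4%N, false)]
  [:: (1%N, false); (0%N, true)] [:: (2%N, false); (1%N, true)] (oparity (N a) (N b)).
  by rewrite (negPf Na) (negPf Nb); vm_compute.
move: (octic_split NM (r := 3) (p := pres1) erefl a8 bb ab ok) => {ok}.
rewrite /= !ovalE; apply=> //.
- by move=> s; rewrite inE => /eqP->; rewrite ovalE.
- move=> H e' /pres1_octic[a' [b' [-> a8' bb' ab']]].
  by exists a', b'; rewrite !ovalE.
Qed.

Lemma pres2_recognize (a b : G) : relations [:: a; b] pres2 -> ~~ N a -> N b ->
  a ^+ 4 <> 1 -> decomposes [:: a; b] ->
  splits pres2 [:: a; b] (gen [:: a ^+ 2; b]).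
Proof.
move=> rel Na Nb a4 dec.
have [_ [_ [[<- <-] a8 bb ab]]] := pres2_octic rel.
have ok : split_ok (omul 7) (0%N, false) octs [:: (4%N, false)]
  [:: (1%N, false); (0%N, true)] [:: (2%N, false); (0%N, true)] (oparity (N a) (N b)).
  by rewrite (negPf Na) Nb; vm_compute.
move: (octic_split NM (r := 7) (p := pres2) erefl a8 bb ab ok) => {ok}.
rewrite /= !ovalE; apply=> //.
- by move=> s; rewrite inE => /eqP->; rewrite ovalE.
- move=> H e' /pres2_octic[a' [b' [-> a8' bb' ab']]].
  by exists a', b'; rewrite !ovalE.
Qed.

End Items.

(** * Quaternion pairs and involutions outside the kernel *)

Section Hamiltonian.
Variable G : groupType.

Lemma Q8pair_conj (g h : G) : Q8pair g h -> g ^ h = g \/ g ^ h = g^-1.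
Proof.
rewrite conjgE => -[gh|[gh _ _]]; [left|right]; apply: (mulgI h);
  by rewrite mulVKg; exact: gh.
Qed.

Lemma Q8pair_mul (y z g h : G) : y ^+ 2 = 1 -> z ^+ 2 = 1 ->
  (forall k, k \in [:: z; g; h] -> commute y k) ->
  (forall k, k \in [:: g; h] -> commute z k) ->
  Q8pair g h -> Q8pair (y * g) (z * h).
Proof.
move=> y2 z2 yC zC; have yz : commute y z by apply: yC; rewrite mem_head.
have yg : commute y g by apply: yC; rewrite !inE eqxx orbT.
have yh : commute y h by apply: yC; rewrite !inE eqxx !orbT.
have zg : commute z g by apply: zC; rewrite mem_head.
have zh : commute z h by apply: zC; rewrite !inE eqxx orbT.
have swap4 (k l m n : G) : commute l m -> k * l * (m * n) = k * m * (l * n).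
  by move=> lm; rewrite -!mulgA (mulgA l) lm -!mulgA.
case=> [gh|[gh e2 e4]]; [left|right].
  rewrite /commute swap4; last exact: esym.
  by rewrite [RHS]swap4; [rewrite gh yz | exact: esym].
split; first 1 last.
- by rewrite !expgMn // y2 z2 e2.
- by rewrite expgMn // (expgnA y 2 2) y2 expg1n mul1g.
rewrite /inverts swap4; last exact: esym.
rewrite gh yz invgM ((sqg1 y).1 y2).
rewrite -[g^-1 * y](commuteV yg) swap4 //; exact/commute_sym.
Qed.

(** An element [x] with [x ^+ 4 <> 1] would be central; for a noncommuting pair
    [g], [h] it would turn [g] into an element [g x] with the same property. *)
Lemma Q8pairs_hamiltonian (A : set G) : subgroup A -> ~ comm_set A ->
  (forall g h, A g -> A h -> Q8pair g h) -> hamiltonian2 A.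
Proof.
move=> sA nab q8; have [A1 AM AV] := sA; split=> //; last first.
  move=> B [_ _ BV] BA x y Ax By.
  by case: (Q8pair_conj (q8 y x (BA _ By) Ax)) => -> //; apply: BV.
move=> x Ax; exists 2%N; apply: contrapT => x4; apply: nab => g h Ag Ah.
have com y : A y -> commute x y.
  by move=> Ay; case: (q8 x y Ax Ay) => // -[_ _ /x4].
case: (q8 g h Ag Ah) => // -[_ _ g4]; case: (q8 (g * x) h (AM _ _ Ag Ax) Ah).
  move=> e; apply: (mulIg x); rewrite -mulgA -(com h Ah) mulgA e -mulgA.
  by [].
case=> _ _; rewrite expgMn; last exact/commute_sym/com.
by rewrite g4 mul1g => /x4.
Qed.

End Hamiltonian.

Section Forward.
Variables (G : groupType) (N : pred G) (t c : Prop).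
Hypotheses (NM : forall g h, N (g * h) = (N g == N h))
  (nonabelian : ~ comm_set [set: G]) (C : skew_commute t c N).

Local Notation decomposes s := (forall g, exists2 y, gen s y & Omega N (y * g)).

Let N1 : N 1 := kernel1 NM.

Let NV : forall g, N g^-1 = N g := kernelV NM.

Let NMin g h : N g -> N h -> N (g * h). Proof. by rewrite NM => -> ->. Qed.

Let NMout g h : ~~ N g -> N h -> ~~ N (g * h).
Proof. by rewrite NM => /negPf-> ->. Qed.

Let NMoo g h : ~~ N g -> ~~ N h -> N (g * h).
Proof. by rewrite NM => /negPf-> /negPf->. Qed.

Let invoV (x y : G) : x ^+ 2 = 1 -> y ^+ 2 = 1 -> (x * y) ^+ 2 = 1 -> commute x y.
Proof.
move=> /sqg1 xV /sqg1 yV /sqg1; rewrite invgM xV yV => e; exact: esym.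
Qed.

(** The quotient of two elements outside [N] lies in [N]. *)
Lemma abelian_noncommuting : (forall g h, N g -> N h -> commute g h) ->
  exists x n, [/\ ~~ N x, N n & ~ commute x n].
Proof.
move=> ab; apply: contrapT => nex.
have com x n : ~~ N x -> N n -> commute x n.
  by move=> Nx Nn; apply: contrapT => xn; apply: nex; exists x, n.
apply: nonabelian => g h _ _.
have [Ng|Ng] := boolP (N g); have [Nh|Nh] := boolP (N h).
- exact: ab.
- exact/commute_sym/com.
- exact: com.
rewrite -(mulVKg g h); apply: commuteM => //; apply: com => //.
by apply: NMoo; rewrite ?NV.
Qed.

(** For noncommuting [x] outside [N] and [n] in [N], torsion makes [n] invert both
    [x] and [x n]; but [x n] is then an involution, which inversion fixes. *)
Lemma elementary_not_torsion : (forall n, N n -> n ^+ 2 = 1) -> ~ t.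
Proof.
move=> N2 ht; have ab g h : N g -> N h -> commute g h.
  by move=> Ng Nh; apply: invoV; apply: N2 => //; apply: NMin.
have [x [n [Nx Nn xn]]] := abelian_noncommuting ab.
have n2 := N2 n Nn; have nV := (sqg1 n).1 n2.
case: (sc_tor C ht x Nn n2) => [/commute_sym//|nx|[]]; last by rewrite (negPf Nx).
have xn2 : (x * n) ^+ 2 = 1.
  by rewrite expg2 mulgA nx -(mulgA n) mulVg mulg1 -expg2.
have nxnF : n * (x * n) = x * n * n -> False.
  by move=> nxn; apply: xn; apply: (mulIg n); rewrite -[in RHS]mulgA nxn.
case: (sc_tor C ht (x * n) Nn n2) => [/nxnF//|e|[]]; last first.
  by rewrite (negPf (NMout Nx Nn)).
by move: e; rewrite /inverts ((sqg1 _).1 xn2) => e; exact: nxnF (esym e).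
Qed.

Lemma elementary_abelian2 : (forall n, N n -> n ^+ 2 = 1) -> elem_abelian2 [set x | N x].
Proof.
move=> N2; split=> [|g h Ng Nh|//].
  by split=> [|x y|x] //=; [exact: NMin | rewrite NV].
by apply: invoV; apply: N2 => //; apply: NMin.
Qed.

(** An involution [x] outside [N] is centralized by the elements of [N] of order
    more than 2; should some [k] in [N] not commute with it, then [N] is the
    generalized dihedral extension by [k] of the centralizer of [x] in [N]. *)
Lemma outer_involution x k h : ~~ N x -> x ^+ 2 = 1 -> N k -> ~ commute x k ->
  N h -> h ^+ 2 <> 1 ->
  ~ t /\ exists (a b c : G) (E : set G), [/\ elem_abelian2 E,
    presents [:: a; b; c] pres7, [set: G] = dprod (gen [:: a; b; c]) E
    & [set x | N x] = dprod (gen [:: a; b]) E].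
Proof.
move=> Nx x2 Nk xk Nh h2; have xV := (sqg1 x).1 x2.
have nc n : N n -> n ^+ 2 <> 1 -> commute x n.
  move=> Nn n2; case: (sc_mix C Nx Nn) => //; last by case=> /esym; rewrite x2.
  by rewrite /inverts xV.
have inv1 y : N y -> ~ commute x y -> y ^+ 2 = 1.
  by move=> Ny xy; apply: contrapT => /(nc y Ny).
have inv y z : N y -> ~ commute x y -> N z -> commute x z -> inverts y z.
  move=> Ny xy Nz xz; have y2 := inv1 y Ny xy.
  have zy : (z * y) ^+ 2 = 1.
    apply: inv1; first exact: NMin.
    move=> xzy; apply: xy; rewrite -(mulKg z y).
    by apply: commuteM => //; apply: commuteV.
  have [e _] := sq_mul_eq zy; rewrite /inverts.
  have -> : y * z^-1 = (z * y)^-1 by rewrite invgM ((sqg1 y).1 y2).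
  by apply/esym/sqg1.
have k2 := inv1 k Nk xk; have kV := (sqg1 k).1 k2.
have xh := nc h Nh h2; have kh := inv k h Nk xk Nh xh.
have Cab y z : N y -> N z -> commute x y -> commute x z -> commute y z.
  move=> Ny Nz xy xz; apply: (mulIg k).
  rewrite (inv k _ Nk xk (NMin Nz Ny) (commuteM xz xy)) invgM.
  rewrite -mulgA (inv k z Nk xk Nz xz) mulgA (inv k y Nk xk Ny xy).
  by rewrite mulgA.
have wE n : N n -> commute x n -> n ^+ 2 <> 1 -> n ^+ 2 = (x * k) ^+ 2.
  move=> Nn xn n2; have kn := inv k n Nk xk Nn xn.
  have xkn : x * k * n = n^-1 * (x * k).
    have [_ _ kn' _] := inverts_quad kn; rewrite -mulgA -kn' !mulgA.
    by congr (_ * _); apply/commuteV.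
  case: (sc_mix C (NMout Nx Nk) Nn) => [e|e|[-> //]|//].
    by case: n2; apply/sqg1; apply: (mulIg (x * k)); rewrite -xkn.
  move: e; rewrite /inverts xkn => e; rewrite !expg2; apply: (mulgI n^-1).
  by rewrite mulKg mulgA e mulgVK.
have h4 : h ^+ 2 ^+ 2 = 1.
  apply/sqg1; rewrite -expVgn (wE h) // (wE h^-1) ?NV //; first exact: commuteV.
  by move=> /sqg1; rewrite invgK => e; apply: h2; apply/sqg1.
have kk y : N y -> ~ commute x y -> commute x (k * y).
  move=> Ny xy; apply: contrapT => xky; case: h2; apply/sqg1.
  have Nky : N (k * y) by apply: NMin.
  have := inv (k * y) h Nky xky Nh xh; rewrite /inverts mulgA kh.
  rewrite -!mulgA => /mulgI; rewrite -(inv y h Ny xy Nh xh).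
  exact: mulIg.
have OmC n : N n -> commute x n -> n ^+ 2 = 1 -> Omega N n.
  move=> Nn xn n2; split=> //.
  have nk : commute n k by have := inv k n Nk xk Nn xn; rewrite /inverts ((sqg1 n).1 n2).
  have nN y : N y -> commute n y.
    move=> Ny; have [xy|xy] := pselect (commute x y); first exact: Cab.
    rewrite -(mulKg k y) kV; apply: commuteM => //; apply: Cab => //; first exact: NMin.
    exact: kk.
  move=> y; have [/nN//|Ny] := boolP (N y).
  rewrite -(mulKg x y) xV; apply: commuteM; first exact/commute_sym.
  by apply: nN; apply: NMoo.
have kkK y : k * (k * y) = y by rewrite mulgA -expg2 k2 mul1g.
split.
  move=> ht; case: (sc_tor C ht x Nk k2) => [/commute_sym//|e|[]]; last first.
    by rewrite (negPf Nx).
  by apply: xk; move: e; rewrite /inverts xV.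
pose s := [:: k; k * h; x]; have [_ genM _] := subgroup_gen s.
have sk : gen s k by apply: mem_gen; rewrite mem_head.
have sx : gen s x by apply: mem_gen; rewrite !inE eqxx !orbT.
have sh : gen s h.
  by rewrite -(kkK h); apply: genM => //; apply: mem_gen; rewrite !inE eqxx !orbT.
have decC n : N n -> commute x n -> exists2 y, gen s y & Omega N (y * n).
  move=> Nn xn; have [n2|/eqP n2] := eqVneq (n ^+ 2) 1.
    by exists 1; [case: (subgroup_gen s) | rewrite mul1g; apply: OmC].
  exists h => //; apply: OmC; [exact: NMin | exact: commuteM |].
  rewrite expgMn; last exact: Cab.
  by rewrite (wE n) // -(wE h) // -expg2.
have decN n : N n -> exists2 y, gen s y & Omega N (y * n).
  move=> Nn; have [xn|xn] := pselect (commute x n); first exact: decC.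
  have [y sy Oy] := decC _ (NMin Nk Nn) (kk n Nn xn).
  by exists (y * k); [exact: genM | rewrite -mulgA].
have dec : decomposes s.
  move=> g; have [/decN//|Ng] := boolP (N g).
  have [y sy Oy] := decN _ (NMoo Nx Ng).
  by exists (y * x); [exact: genM | rewrite -mulgA].
have kxk : k * x * k = x * h ^+ 2.
  by rewrite (wE h) // expg2 -!mulgA (mulgA x x) -expg2 x2 mul1g.
have rel : relations s pres7.
  rewrite /relations /=; split=> //; split=> //; split.
    rewrite expg2 mulgA -(mulgA k h k) kh mulgA -expg2 k2 mul1g.
    by rewrite mulVg.
  split=> //; rewrite -!mulgA !kkK; split; first exact/esym.
  rewrite (mulgA h) -xh -mulgA kh !mulgA kxk expg2 -!mulgA mulgV.
  by rewrite mulg1.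
exists k, (k * h), x; apply: pres7_recognize => //; first exact: NMin.
by rewrite kkK.
Qed.

(** When the outer involutions centralize [N], multiplying by one of them moves
    the conditions on mixed pairs inside [N]. *)
Lemma central_outer_involution x : ~~ N x -> x ^+ 2 = 1 ->
  (forall y, ~~ N y -> y ^+ 2 = 1 -> forall n, N n -> commute y n) ->
  [/\ c, hamiltonian2 [set: G] & hamiltonian2 [set n | N n]].
Proof.
move=> Nx x2 cen; have xV := (sqg1 x).1 x2; have xC := cen x Nx x2.
have cN n : N n -> n ^+ 2 = 1 -> forall m, N m -> commute n m.
  move=> Nn n2 m Nm; rewrite -(mulKg x n) xV; apply/commute_sym.
  apply: commuteM; first exact/commute_sym/xC.
  apply/commute_sym/cen => //; first exact: NMout.
  by rewrite expgMn ?x2 ?n2 ?mulg1 //; apply: xC.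
have key g h : N g -> N h -> ~ commute g h ->
    [/\ c, inverts h g, g ^+ 2 = h ^+ 2 & g ^+ 4 = 1].
  move=> Ng Nh gh.
  have g2 : g ^+ 2 <> 1 by move=> /(cN g Ng)/(_ h Nh).
  have h2 : h ^+ 2 <> 1 by move=> /(cN h Nh)/(_ g Ng)/commute_sym.
  case: (sc_in C Ng Nh g2 h2) => // -[/(cN _ (NMin Ng Nh)) ghC _].
  by case: gh; rewrite -{1}(mulgK h g); apply/commute_sym/commuteM;
    [apply/commute_sym/ghC | apply: commuteV].
have q8N g h : N g -> N h -> Q8pair g h.
  move=> Ng Nh; have [|/(key g h Ng Nh)[_ ? ? ?]] := pselect (commute g h); first by left.
  by right.
have q8G (g h : G) : Q8pair g h.
  have get y : exists z n, [/\ N n, y = z * n & z = 1 \/ z = x].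
    have [Ny|Ny] := boolP (N y); first by exists 1, y; rewrite mul1g; split=> //; left.
    exists x, (x * y); rewrite NMoo // mulgA -expg2 x2 mul1g.
    by split=> //; right.
  have [y [n [Nn -> yE]]] := get g; have [z [m [Nm -> zE]]] := get h.
  have oneC (k : G) : commute 1 k by apply/commute_sym/commute1.
  have yzC (w k : G) : w = 1 \/ w = x -> N k -> commute w k.
    by case=> -> Nk; [exact: oneC | exact: xC].
  apply: Q8pair_mul; last exact: q8N.
  - by case: yE => ->; rewrite ?expg1n.
  - by case: zE => ->; rewrite ?expg1n.
  - move=> k; rewrite !inE => /or3P[] /eqP->; [|exact: yzC|exact: yzC].
    by case: yE zE => -> [] ->; rewrite ?mulg1; [exact: oneC|exact: oneC|exact: commute1|].
  - by move=> k; rewrite !inE => /orP[] /eqP->; exact: yzC.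
have nabN : ~ comm_set [set n | N n].
  move=> ab; have [y [n [Ny Nn yn]]] := abelian_noncommuting ab.
  apply: yn; rewrite -(mulKg x y) xV; apply/commute_sym/commuteM.
    exact/commute_sym/xC.
  by apply: ab => //; apply: NMoo.
have sN := kernel_subgroup NM.
split; last 2 first.
- by apply: Q8pairs_hamiltonian nonabelian _.
- by apply: Q8pairs_hamiltonian nabN _.
apply: contrapT => nc; apply: nabN => g h Ng Nh; apply: contrapT => gh.
by case: (key g h Ng Nh gh) => /nc.
Qed.

End Forward.

(** * No involution outside the kernel *)

Section Inversion.
Variable G : groupType.
Implicit Types g h x : G.

Lemma conj_commute g h : g ^ h = g <-> commute g h.
Proof.
rewrite conjgE; split=> [e|gh]; last by rewrite gh mulKg.
by apply: (mulgI h^-1); rewrite e mulKg.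
Qed.

Lemma conj_inverts g h : g ^ h = g^-1 <-> inverts h g.
Proof.
rewrite conjgE /inverts; split=> [e|gh]; last by rewrite gh mulKg.
by apply: (mulgI h^-1); rewrite e mulKg.
Qed.

Lemma invertsX g h n : inverts h g -> inverts h (g ^+ n).
Proof. by move=> /conj_inverts e; apply/conj_inverts; rewrite conjXg e expVgn. Qed.

Lemma inverts_sq g h : inverts h g -> commute g (h ^+ 2).
Proof.
move=> /conj_inverts e; apply/conj_commute.
by rewrite expg2 conjgM e conjVg e invgK.
Qed.

Lemma inverts_commute g h : inverts h g -> commute g h -> g ^+ 2 = 1.
Proof. by move=> /conj_inverts e /conj_commute; rewrite e => /sqg1. Qed.

Lemma inverts_mulC g h k : inverts h g -> inverts k g -> commute g (h * k).
Proof.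
move=> /conj_inverts eh /conj_inverts ek; apply/conj_commute.
by rewrite conjgM eh conjVg ek invgK.
Qed.

Lemma inverts_mul_sq g h : inverts h g -> (g * h) ^+ 2 = h ^+ 2.
Proof.
move=> e; by rewrite !expg2 {1}e !mulgA mulgVK.
Qed.

Lemma Q8pair_sym g h : Q8pair g h -> Q8pair h g.
Proof.
case=> [/commute_sym|[e gh g4]]; [by left | right; split; rewrite -?(expgnA h 2 2) -?gh //].
- have [_ e2 _ _] := inverts_quad e; rewrite /inverts e2.
  apply: (mulgI h); apply: (mulIg g); rewrite mulVKg mulVg mulgA -expg2 -mulgA -expg2.
  by rewrite -gh -expg2 -expgnA.
- by rewrite (expgnA h 2 2) -gh -expgnA.
Qed.

Lemma Q8pair_mulr g h : Q8pair g h -> Q8pair g (g * h).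
Proof.
case=> [gh|[e gh g4]]; [left; exact: commuteM | right; split=> //].
- by apply/conj_inverts; rewrite conjgM (conj_commute g g).2 //; apply/conj_inverts.
- by rewrite (inverts_mul_sq e) -gh.
Qed.

Lemma Q8pair_mull g h : Q8pair g h -> Q8pair g (h * g).
Proof.
case=> [gh|[e gh g4]]; [left; exact: commuteM | right; split=> //].
  apply/conj_inverts; rewrite conjgM ((conj_inverts g h).2 e) conjVg.
  by rewrite (conj_commute g g).2.
case: (Q8pair_sym (or_intror (And3 e gh g4))) => [/commute_sym hg|[e' _ _]].
  by rewrite expgMn // -gh -expgnDr g4 (inverts_commute e hg).
by rewrite (inverts_mul_sq e').
Qed.

End Inversion.

Section NoOuterInvolution.
Variables (G : groupType) (N : pred G) (t c : Prop).
Hypotheses (NM : forall g h, N (g * h) = (N g == N h))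
  (nonabelian : ~ comm_set [set: G]) (C : skew_commute t c N)
  (nontrivial : exists x, ~~ N x) (hout : forall y, ~~ N y -> y ^+ 2 <> 1).

Local Notation decomposes s := (forall g, exists2 y, gen s y & Omega N (y * g)).
Local Notation splits p s L := (exists E : set G, [/\ elem_abelian2 E, presents s p,
  [set: G] = dprod (gen s) E & [set x | N x] = dprod L E]).

Let N1 : N 1 := kernel1 NM.

Let NV : forall g, N g^-1 = N g := kernelV NM.

Let NMin g h : N g -> N h -> N (g * h). Proof. by rewrite NM => -> ->. Qed.

Let NMout g h : ~~ N g -> N h -> ~~ N (g * h).
Proof. by rewrite NM => /negPf-> ->. Qed.

Let NMoo g h : ~~ N g -> ~~ N h -> N (g * h).
Proof. by rewrite NM => /negPf-> /negPf->. Qed.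

Let Nsq : forall g, N (g ^+ 2) := kernel_sq NM.

Let central_of_outer n x : ~~ N x -> (forall y, ~~ N y -> commute n y) ->
  forall g, commute n g.
Proof.
move=> Nx nC g; have [Ng|/nC//] := boolP (N g).
rewrite -(mulKg x g); apply: commuteM; first exact/commuteV/nC.
by apply: nC; apply: NMout.
Qed.

Lemma mixed_pair x n : ~~ N x -> N n -> n ^+ 2 <> 1 ->
  [\/ commute x n, inverts n x | x ^+ 2 = n ^+ 2 /\ n ^+ 4 = 1].
Proof.
move=> Nx Nn n2; case: (sc_mix C Nx Nn) => // [?|?|[e x4]].
- by constructor 1.
- by constructor 2.
by constructor 3; split=> //; rewrite (expgnA n 2 2) -e -expgnA.
Qed.

(** This comes from the pair [x], [x n] outside [N]. *)
Lemma mixed_involution x n : ~~ N x -> N n -> n ^+ 2 = 1 ->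
  commute x n \/ inverts n (x ^+ 2).
Proof.
move=> Nx Nn n2; have nV := (sqg1 n).1 n2.
case: (sc_out C Nx (NMout Nx Nn)) => [e|e|e|[e _]].
- left; apply: (mulgI x); rewrite e /commute -!mulgA; congr (_ * _).
- right; apply: invertsX; apply/conj_inverts.
  by move/conj_inverts: e; rewrite conjgM (conj_commute x x).2.
- case: (hout Nx); move: e; rewrite /inverts invgM nV mulgA -mulgA.
  rewrite -!mulgA => /mulgI/mulgI e; apply/sqg1; exact/esym.
right; rewrite /inverts expg2; move: e; rewrite (mulgA x x) => /sq_mul_eq[-> _].
by rewrite nV.
Qed.

(** The equality of squares is excluded, as it would give [x ^+ 4 = 1]. *)
Lemma deep_pair x n : ~~ N x -> x ^+ 4 <> 1 -> N n ->
  commute x n \/ inverts n (x ^+ 2) /\ (n ^+ 2 <> 1 -> inverts n x).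
Proof.
move=> Nx x4 Nn; have [n2|/eqP n2] := eqVneq (n ^+ 2) 1.
  by case: (mixed_involution Nx Nn n2); [left | right; split].
case: (mixed_pair Nx Nn n2) => [|e|[e n4]]; first by left.
  by right; split=> // ; apply: invertsX.
by case: x4; rewrite (expgnA x 2 2) e -expgnA.
Qed.

(** If [n] inverts [g], then [g n] and [n] have the same square; should [n] invert
    [g n] as well, it would invert its own square. *)
Lemma in_exp4_noncommuting g n : ~~ N g -> N n -> ~ commute g n -> n ^+ 4 = 1.
Proof.
move=> Ng Nn gn; have [n2|/eqP n2] := eqVneq (n ^+ 2) 1.
  by rewrite (expgnA n 2 2) n2 expg1n.
case: (mixed_pair Ng Nn n2) => [//|e|[]//]; have e2 := inverts_mul_sq e.
case: (mixed_pair (NMout Ng Nn) Nn n2) => [gnn|e'|[]//].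
  case: gn; apply: (mulIg n); rewrite gnn; exact: mulgA.
have en : inverts n (n ^+ 2) by rewrite -e2; apply: invertsX.
have nn : commute (n ^+ 2) n by apply/commute_sym/commuteX.
by have := inverts_commute en nn; rewrite -expgnA.
Qed.

(** A central [n] is multiplied by a noncentral element, whose fourth power is
    already known. *)
Lemma in_exp4 n : N n -> n ^+ 4 = 1.
Proof.
have [x Nx] := nontrivial.
have noncentral m g : N m -> ~ commute g m -> m ^+ 4 = 1.
  move=> Nm gm; have [Ng|Ng] := boolP (N g); last exact: in_exp4_noncommuting gm.
  have [xm|xm] := pselect (commute x m); last exact: in_exp4_noncommuting xm.
  apply: (in_exp4_noncommuting (NMout Nx Ng) Nm) => xgm; apply: gm.
  rewrite -(mulKg x g); apply/commute_sym/commuteM; last exact/commute_sym.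
  exact/commuteV/commute_sym.
move=> Nn; apply: contrapT => n4.
have nC g : commute g n.
  by apply: contrapT => gn; apply: n4; apply: noncentral gn.
have mC m g : N m -> commute g m.
  move=> Nm; apply: contrapT => gm; have m4 := noncentral m g Nm gm.
  have nm4 : (n * m) ^+ 4 = 1.
    apply: (noncentral _ g (NMin Nn Nm)) => gnm; apply: gm.
    by rewrite -(mulKg n m); apply: commuteM => //; apply: commuteV.
  by apply: n4; rewrite -nm4 expgMn ?m4 ?mulg1 //; apply/commute_sym/nC.
have [|y [m [_ Nm ym]]] := abelian_noncommuting NM nonabelian.
  by move=> g h Ng Nh; apply: mC.
by apply: ym; apply: mC.
Qed.

Lemma in_sq_central n : N n -> forall g, commute (n ^+ 2) g.
Proof.
have [x Nx] := nontrivial; move=> Nn; apply: (central_of_outer Nx) => y Ny.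
apply/commute_sym; have [->|/eqP n2] := eqVneq (n ^+ 2) 1; first exact: commute1.
case: (mixed_pair Ny Nn n2) => [yn|e|[<- _]]; [exact: commuteX | exact: inverts_sq |].
exact: commuteX.
Qed.

Section Deep.
Variable x : G.
Hypotheses (Nx : ~~ N x) (x4 : x ^+ 4 <> 1).

Let x2x2 : x ^+ 2 ^+ 2 = x ^+ 4. Proof. by rewrite -expgnA. Qed.

Let x8 : x ^+ 8 = 1. Proof. by rewrite (expgnA x 2 4) in_exp4. Qed.

Let deepM m : N m -> commute x m -> (x * m) ^+ 4 <> 1.
Proof. by move=> Nm xm; rewrite expgMn // (in_exp4 Nm) mulg1. Qed.

(** The square of [x m] is fixed by [d]; having a nontrivial square itself, it
    cannot be inverted by [d]. *)
Lemma deep_centralizer_abelian m d : N m -> N d -> commute x m -> commute x d ->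
  commute m d.
Proof.
move=> Nm Nd xm xd.
have y2d : commute ((x * m) ^+ 2) d.
  rewrite expgMn //; apply/commute_sym/commuteM; first exact/commuteX/commute_sym.
  exact/commute_sym/in_sq_central.
case: (deep_pair (NMout Nx Nm) (deepM Nm xm) Nd) => [e|[e _]].
  rewrite -(mulKg x m); apply/commute_sym/commuteM; last exact/commute_sym.
  exact/commuteV/commute_sym.
by case: (deepM Nm xm); rewrite (expgnA _ 2 2); apply: inverts_commute e y2d.
Qed.

Lemma deep_noncommuting : exists2 h, N h & ~ commute x h.
Proof.
apply: contrapT => nex; have xC h : N h -> commute x h.
  by move=> Nh; apply: contrapT => xh; apply: nex; exists h.
have [|y [m [Ny Nm ym]]] := abelian_noncommuting NM nonabelian.
  by move=> g h Ng Nh; apply: deep_centralizer_abelian => //; apply: xC.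
apply: ym; rewrite -(mulKg x y); apply/commute_sym/commuteM.
  exact/commuteV/commute_sym/xC.
have Ni : N (x * y) by apply: NMoo.
by apply: deep_centralizer_abelian => //; apply: xC.
Qed.

(** Two elements inverting [x ^+ 2] have a product which fixes it. *)
Lemma deep_mul_commute h n : N h -> N n -> ~ commute x h -> ~ commute x n ->
  commute x (h * n).
Proof.
move=> Nh Nn xh xn.
case: (deep_pair Nx x4 Nh) => [//|[eh _]]; case: (deep_pair Nx x4 Nn) => [//|[en _]].
case: (deep_pair Nx x4 (NMin Nh Nn)) => [//|[ehn _]].
by case: x4; rewrite -x2x2; apply: inverts_commute ehn (inverts_mulC eh en).
Qed.

(** [N] is the union of the centralizer of [x] in [N] and its coset of [h]; up to
    [x ^+ 2], an element of the centralizer is an involution. *)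
Lemma deep_decomposes s h : gen s x -> gen s h -> N h -> ~ commute x h ->
  (forall d, N d -> commute x d ->
     inverts h d /\ (d ^+ 2 <> 1 -> d ^+ 2 = x ^+ 4)) ->
  decomposes s.
Proof.
move=> sx sh Nh xh hC; have [s1 sM sV] := subgroup_gen s.
have OmC d : N d -> commute x d -> d ^+ 2 = 1 -> Omega N d.
  move=> Nd xd d2; split=> //; have dV := (sqg1 d).1 d2.
  have hd : commute d h by have [+ _] := hC d Nd xd; rewrite /inverts dV.
  apply: (central_of_outer Nx) => y Ny; rewrite -(mulKg x^-1 y) invgK.
  apply: commuteM; first exact/commute_sym.
  have Nm : N (x^-1 * y) by apply: NMoo; rewrite ?NV.
  have [xm|xm] := pselect (commute x (x^-1 * y)).
    exact: deep_centralizer_abelian.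
  rewrite -(mulKg h (x^-1 * y)); apply: commuteM; first exact: commuteV.
  apply: deep_centralizer_abelian => //; first exact: NMin.
  exact: deep_mul_commute.
have decC d : N d -> commute x d -> exists2 y, gen s y & Omega N (y * d).
  move=> Nd xd; have [d2|/eqP d2] := eqVneq (d ^+ 2) 1.
    by exists 1; rewrite ?mul1g //; apply: OmC.
  have [_ /(_ d2) e] := hC d Nd xd.
  exists (x ^+ 2); first by rewrite expg2; apply: sM.
  have xx : commute x (x ^+ 2) by apply: commuteX.
  have xxd : commute (x ^+ 2) d by apply/commute_sym/commuteX/commute_sym.
  apply: OmC; [exact: NMin | exact: commuteM |].
  by rewrite expgMn // e x2x2 -expgnDr x8.
have decN d : N d -> exists2 y, gen s y & Omega N (y * d).
  move=> Nd; have [xd|xd] := pselect (commute x d); first exact: decC.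
  have [y sy Oy] := decC _ (NMin Nh Nd) (deep_mul_commute Nh Nd xh xd).
  by exists (y * h); [exact: sM | rewrite -mulgA].
move=> g; have [/decN//|Ng] := boolP (N g).
have [y sy Oy] := decN _ (NMoo Nx Ng).
by exists (y * x); [exact: sM | rewrite -mulgA].
Qed.

(** Both [x] and [d] being inverted by [h], the pair [x * h], [d] forces their
    squares together. *)
Lemma deep_square h d : N h -> N d -> commute x d -> inverts h x -> inverts h d ->
  d ^+ 2 <> 1 -> h ^+ 2 = d ^+ 2.
Proof.
move=> Nh Nd xd ix id d2; have [_ x_h _ _] := inverts_quad ix.
have [_ _ d_h _] := inverts_quad id.
have /conj_inverts idx : inverts (x * h) d.
  by apply/conj_inverts; rewrite conjgM (conj_commute d x).2; [apply/conj_inverts|].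
case: (mixed_pair (NMout Nx Nh) Nd d2) => [/commute_sym e|e|[<- _]].
- by case: d2; apply: inverts_commute e; apply/conj_inverts.
- move: e; rewrite /inverts invgM -x_h -(mulgA x h) -d_h !mulgA -xd -!mulgA => /mulgI.
  move=> e; rewrite !expg2; apply: (mulgI d^-1); apply: (mulIg h^-1).
  by rewrite mulKg -(mulgA d^-1) mulgK e.
by rewrite inverts_mul_sq.
Qed.

(** Here [<x, h>] is a generalized quaternion group of order 16, and the condition
    on the pair [x ^+ 2], [h] in [N] gives [c]. *)
Lemma deep_quaternion h : N h -> ~ commute x h -> h ^+ 2 <> 1 ->
  c /\ exists (a b : G), splits pres2 [:: a; b] (gen [:: a ^+ 2; b]).
Proof.
move=> Nh xh h2.
case: (deep_pair Nx x4 Nh) => [//|[iq /(_ h2) ix]].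
have xx : commute x (x ^+ 2) by apply: commuteX.
have s2 : x ^+ 2 ^+ 2 <> 1 by rewrite x2x2.
have hx : h ^+ 2 = x ^+ 4 by rewrite (deep_square Nh (Nsq x)).
have hC d : N d -> commute x d -> inverts h d /\ (d ^+ 2 <> 1 -> d ^+ 2 = x ^+ 4).
  move=> Nd xd; suff id : inverts h d.
    by split=> // d2; rewrite -(deep_square Nh Nd).
  have /conj_inverts ex := ix; apply/conj_inverts.
  case: (deep_pair (NMout Nx Nd) (deepM Nd xd) Nh) => [|[_ /(_ h2)]].
    move=> /conj_commute; rewrite conjMg ex => e.
    have dE : d ^ h = x ^+ 2 * d by apply: (mulgI x^-1); rewrite e expg2 -!mulgA mulKg.
    have := conjXg d h 2; rewrite (conj_commute _ _).2; last exact: in_sq_central.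
    rewrite dE expgMn; last exact/commute_sym/commuteX/commute_sym.
    by rewrite x2x2 -{1}[d ^+ 2]mul1g => /mulIg/esym.
  move=> /conj_inverts; rewrite conjMg ex invgM => e.
  apply: (mulgI x^-1); rewrite e; apply/commute_sym/commuteV/commute_sym.
  exact: commuteV.
split.
  case: (sc_in C (Nsq x) Nh s2 h2) => [e|[e _]|[]//].
    by case: s2; apply: inverts_commute e.
  by case: h2; rewrite -(inverts_mul_sq iq).
exists x, h; apply: pres2_recognize => //.
apply: deep_decomposes Nh xh hC; apply: mem_gen; rewrite !inE eqxx ?orbT //.
Qed.

(** Here [<x, h>] is semidihedral of order 16, with [h] a noncentral involution;
    [x] and [x h] satisfy the relations. *)
Lemma deep_semidihedral h : N h -> ~ commute x h ->
  (forall n, N n -> ~ commute x n -> n ^+ 2 = 1) ->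
  ~ t /\ exists (a b : G), splits pres1 [:: a; b] (gen [:: a ^+ 2; a * b]).
Proof.
move=> Nh xh inv; have h2 := inv h Nh xh; have hV := (sqg1 h).1 h2.
case: (deep_pair Nx x4 Nh) => [//|[iq _]].
have id d : N d -> commute x d -> inverts h d.
  move=> Nd xd; have hd : (h * d) ^+ 2 = 1.
    apply: inv; [exact: NMin | move=> xhd; apply: xh].
    by rewrite -(mulgK d h); apply: commuteM => //; apply: commuteV.
  by have [_] := sq_mul_eq hd; rewrite hV => e; exact: esym.
have key d : N d -> commute x d -> d ^+ 2 <> 1 ->
    x * h = d ^+ 2 * (h * x^-1) \/ (x * h) ^+ 2 = d ^+ 2.
  move=> Nd xd d2; have ed := id d Nd xd; have [_ _ d_h _] := inverts_quad ed.
  have idx : inverts (x * h) d.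
    by apply/conj_inverts; rewrite conjgM (conj_commute d x).2 //; apply/conj_inverts.
  case: (mixed_pair (NMout Nx Nh) Nd d2) => [/commute_sym e|e|[-> _]]; last by right.
    by case: d2; apply: inverts_commute e.
  left; move: e; rewrite /inverts invgM hV -(mulgA x h) -d_h mulgA (commuteV xd) => e.
  by apply: (mulgI d^-1); rewrite mulgA e expg2 -mulgA mulKg.
have xx : commute x (x ^+ 2) by apply: commuteX.
have s2 : x ^+ 2 ^+ 2 <> 1 by rewrite x2x2.
have x4C g : commute (x ^+ 4) g by rewrite -x2x2; apply: in_sq_central.
have x4V : x ^- 4 = x ^+ 4 by apply/sqg1; rewrite -expgnA x8.
have xhE : x * h = h * x ^+ 3.
  case: (key _ (Nsq x) xx s2) => [->|]; rewrite x2x2.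
    by rewrite mulgA x4C -mulgA; congr (_ * _); rewrite (expgnDr x 3 1) mulgK.
  rewrite expg2 (expgnDr x 1 3) -mulgA => /mulgI e.
  by rewrite -e !mulgA -expg2 h2 mul1g.
have xh2 : (x * h) ^+ 2 = x ^+ 4.
  rewrite expg2 {1}xhE -mulgA (mulgA (x ^+ 3)) -(expgnDr x 3 1) x4C mulgA.
  by rewrite -expg2 h2 mul1g.
have hC d : N d -> commute x d -> inverts h d /\ (d ^+ 2 <> 1 -> d ^+ 2 = x ^+ 4).
  move=> Nd xd; split=> [|d2]; first exact: id.
  case: (key d Nd xd d2) => [|<-//]; rewrite xhE (mulgA (d ^+ 2)).
  rewrite (in_sq_central Nd h) -(mulgA h) => /mulgI e; apply: (mulIg x^-1).
  by rewrite -e (expgnDr x 3 1) mulgK.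
split.
  move=> ht; case: (sc_tor C ht x Nh h2) => [/commute_sym//|e|[]].
    by apply: (hout (NMout Nx Nh)); rewrite inverts_mul_sq.
  by rewrite (negPf Nx).
have hE : x^-1 * (x * h) = h by rewrite mulKg.
have [_ sM sV] := subgroup_gen [:: x; x * h].
have sx : gen [:: x; x * h] x by apply: mem_gen; rewrite mem_head.
exists x, (x * h); have rel : relations [:: x; x * h] pres1.
  by rewrite /relations /=; split=> //; rewrite x8 xh2; split=> //; rewrite -mulgA -xhE.
apply: pres1_recognize => //; first exact: NMout.
apply: deep_decomposes Nh xh hC => //; rewrite -[X in gen _ X]hE.
by apply: sM; [exact: sV | apply: mem_gen; rewrite !inE eqxx orbT].
Qed.

End Deep.

Section Shallow.
Hypothesis out4 : forall y, ~~ N y -> y ^+ 4 = 1.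

Let exp4 (g : G) : g ^+ 4 = 1.
Proof. by have [/in_exp4|/out4] := boolP (N g). Qed.

Let sqC (g h : G) : commute (g ^+ 2) h.
Proof.
have [Ng|Ng] := boolP (N g); first exact: in_sq_central.
have g4 : g ^+ 2 ^+ 2 = 1 by rewrite -expgnA exp4.
have inC n : N n -> commute (g ^+ 2) n.
  move=> Nn; apply/commute_sym; have [n2|/eqP n2] := eqVneq (n ^+ 2) 1.
    case: (mixed_involution Ng Nn n2) => [/commute_sym|]; first exact: commuteX.
    by rewrite /inverts ((sqg1 _).1 g4) => /esym.
  case: (mixed_pair Ng Nn n2) => [/commute_sym||[-> _]]; first exact: commuteX.
    by move=> /(invertsX 2); rewrite /inverts ((sqg1 _).1 g4) => /esym.
  exact: commuteX.
have [Nh|Nh] := boolP (N h); first exact: inC.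
rewrite -(mulKg g h); apply: commuteM; last by apply: inC; apply: NMoo.
exact/commuteV/commute_sym/commuteX.
Qed.

Let hmix y m : ~~ N y -> N m ->
  [\/ m ^+ 2 = 1, [~ y, m] = 1, [~ y, m] = y ^+ 2 | y ^+ 2 = m ^+ 2].
Proof.
move=> Ny Nm; have [m2|/eqP m2] := eqVneq (m ^+ 2) 1; first by constructor 1.
case: (mixed_pair Ny Nm m2) => [e|e|[e _]].
- by constructor 2; apply/commute_comm.
- by constructor 3; apply/(inverts_comm exp4).
by constructor 4.
Qed.

Let sN : subgroup [set n | N n] := kernel_subgroup NM.

(** Two elements [g], [h] outside [N] are [g] and [g m] for some [m] in [N]. *)
Lemma Q8pairs_outer : (forall g h, N g -> N h -> Q8pair g h) ->
  (forall x n, ~~ N x -> N n -> Q8pair x n) -> hamiltonian2 [set: G].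
Proof.
move=> qN qx; apply: Q8pairs_hamiltonian => // g h _ _.
have [Ng|Ng] := boolP (N g); have [Nh|Nh] := boolP (N h).
- exact: qN.
- exact/Q8pair_sym/qx.
- exact: qx.
rewrite -(mulVKg g h); apply/Q8pair_mulr/qx => //.
by apply: NMoo; rewrite ?NV.
Qed.

(** Only the mixed pairs may fail to be Q8 pairs. *)
Lemma shallow_abelian m0 : (forall g h, N g -> N h -> commute g h) ->
  N m0 -> m0 ^+ 2 <> 1 ->
  hamiltonian2 [set: G] \/
  exists (a b : G), splits pres5 [:: a; b] (gen [:: a; b ^+ 2]).
Proof.
move=> ab Nm0 m02.
have [q8|nq8] := pselect (forall x n, ~~ N x -> N n -> Q8pair x n).
  by left; apply: Q8pairs_outer => // g h Ng Nh; left; apply: ab.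
right; have [x [n [Nx Nn xn nq]]] : exists x n, [/\ ~~ N x, N n, ~ commute x n
    & [~ x, n] = x ^+ 2 -> [~ x, n] <> n ^+ 2].
  apply: contrapT => nex; apply: nq8 => x n Nx Nn.
  have [xn|xn] := pselect (commute x n); [by left | right].
  apply: contrapT => nqx; apply: nex; exists x, n; split=> // e1 e2; apply: nqx.
  by split; [apply/(inverts_comm exp4) | rewrite -e1 -e2 | exact: exp4].
have [x' Nx' cfg] := class2_core5 exp4 sqC NM hout hmix ab Nm0 m02 Nx Nn xn nq.
have spl := class2_split5 exp4 sqC NM hout hmix ab Nm0 m02 Nx' Nn cfg.
have [e [x2 n2]] := cfg.
have [_ _ xn' _] := inverts_quad ((inverts_comm exp4 _ _).2 e).
have rel : relations [:: n; x'] pres5.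
  by rewrite /relations /=; split=> //; rewrite !exp4.
exists n, x'; apply: pres5_recognize => //; [exact: hout | exact/nesym |].
have sn : gen [:: n; x'] n by apply: mem_gen; rewrite mem_head.
have sx : gen [:: n; x'] x' by apply: mem_gen; rewrite !inE eqxx orbT.
apply: (gen_Omega NM Nx' sx sn sn) => m Nm; have [i Om] := spl m Nm.
by exists i, false; rewrite /= mul1g.
Qed.

(** With torsion, the involutions of [N] are central, which turns the conditions
    within [N] into: any two elements form a Q8 pair. *)
Lemma shallow_torsion k h : t -> N k -> N h -> ~ commute k h ->
  c /\ ((hamiltonian2 [set: G] /\ hamiltonian2 [set n | N n]) \/
    exists (a b d : G), splits pres6 [:: a; b; d]
      (dprod (gen [:: a; d]) (gen [:: b ^+ 2]))).
Proof.
move=> ht Nk Nh kh; have [x0 Nx0] := nontrivial.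
have htor g m : N g -> g ^+ 2 = 1 -> commute m g.
  move=> Ng g2; apply/commute_sym/(central_of_outer Nx0) => y Ny.
  case: (sc_tor C ht y Ng g2) => [//|e|[]]; last by rewrite (negPf Ny).
  by case: (hout (NMout Ny Ng)); rewrite inverts_mul_sq.
have key g m : N g -> N m -> ~ commute g m ->
    [/\ c, inverts m g, g ^+ 2 = m ^+ 2 & g ^+ 4 = 1].
  move=> Ng Nm gm.
  have g2 : g ^+ 2 <> 1 by move=> /(htor g m Ng)/commute_sym.
  have m2 : m ^+ 2 <> 1 by move=> /(htor m g Nm).
  case: (sc_in C Ng Nm g2 m2) => // -[/(htor _ g (NMin Ng Nm)) ggm _].
  by case: gm; rewrite -(mulKg g m); apply: commuteM => //; apply: commuteV.
have [hc _ _ _] := key k h Nk Nh kh; split=> //.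
have q8N g m : N g -> N m -> Q8pair g m.
  by move=> Ng Nm; have [|/(key g m Ng Nm)[]] := pselect (commute g m); [left | right].
have hq8 g m : N g -> N m -> commute g m \/ [~ g, m] = g ^+ 2 /\ [~ g, m] = m ^+ 2.
  move=> Ng Nm; case: (q8N g m Ng Nm) => [|[/(inverts_comm exp4) -> -> _]].
    by left.
  by right.
have [allz|nall] := pselect (forall x k h, ~~ N x ->
    N k -> N h -> ~ commute k h -> [~ k, h] = x ^+ 2);
  [left|right]; last first.
  have [x [k' [h' [Nx Nk' Nh' kh' nz]]]] : exists x k h,
      [/\ ~~ N x, N k, N h, ~ commute k h & [~ k, h] <> x ^+ 2].
    apply: contrapT => nex; apply: nall => x k' h' Nx Nk' Nh' kh'.
    by apply: contrapT => nz; apply: nex; exists x, k', h'.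
  have [a [d [Na Nd cfg]]] := class2_core6 exp4 sqC NM hout hmix htor hq8 Nx Nk' Nh' kh' nz.
  have spl := class2_split6 exp4 sqC NM hout hmix htor hq8 Nx Na Nd cfg.
  have [/commute_comm xa [/(inverts_comm exp4) xd [ad [/(inverts_comm exp4) ida [a2 xa2]]]]] := cfg.
  have rel : relations [:: a; x; d] pres6.
    by rewrite /relations /=; split=> //; rewrite !exp4; do !split=> //; exact/esym.
  exists a, x, d; apply: pres6_recognize => //; [exact: hout | exact/nesym |].
  by apply: (gen_Omega NM Nx _ _ _ spl); apply: mem_gen; rewrite !inE eqxx ?orbT.
 split; last first.
  apply: Q8pairs_hamiltonian => // ab; apply: kh; exact: ab.
apply: Q8pairs_outer => // x n Nx Nn.
have xz y : ~~ N y -> y ^+ 2 = [~ k, h] by move=> Ny; rewrite (allz y k h).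
have [xn|xn] := pselect (commute x n); [by left | right].
have n2 : n ^+ 2 <> 1 by move=> /(htor n x Nn).
have same : x ^+ 2 = n ^+ 2.
  case: (mixed_pair Nx Nn n2) => [//|e|[//]].
  by rewrite -(inverts_mul_sq e) !xz //; apply: NMout.
split=> //; apply/(inverts_comm exp4).
have := sqM exp4 sqC x n; rewrite (xz _ (NMout Nx Nn)) -same (xz x Nx) -expg2.
by rewrite (comm_sq exp4 sqC) mul1g => <-.
Qed.

(** Without quaternion pairs in [N], the possible configurations are those of
    three groups. *)
Lemma shallow_torsion_free k h : ~ c -> N k -> N h -> ~ commute k h ->
  [\/ exists (a b d e : G), splits pres8 [:: a; b; d; e]
        (dprod (gen [:: b]) (gen [:: d; e])),
      exists (a b d : G), splits pres9 [:: a; b; d]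
        (dprod (gen [:: a; d]) (gen [:: b ^+ 2]))
    | exists (a b d : G), splits pres10 [:: a; b; d] (gen [:: b; d])].
Proof.
move=> nc Nk Nh kh; have [x0 Nx0] := nontrivial.
have hin g m : N g -> N m ->
    [\/ g ^+ 2 = 1, m ^+ 2 = 1, [~ g, m] = 1 | (g * m) ^+ 2 = 1].
  move=> Ng Nm; have [g2|/eqP g2] := eqVneq (g ^+ 2) 1; first by constructor 1.
  have [m2|/eqP m2] := eqVneq (m ^+ 2) 1; first by constructor 2.
  case: (sc_in C Ng Nm g2 m2) => [/commute_comm|[]|[/nc]//]; first by constructor 3.
  by constructor 4.
have [x [a [b [Nx Na Nb cfg]]]] := class2_core exp4 sqC NM hout hmix hin Nx0 Nk Nh kh.
have spl := class2_split exp4 sqC NM hout hmix hin Nx Na Nb cfg.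
have x2 := hout Nx; have cC := comm_central sqC.
have swap : commute a (x ^+ 2) by apply/commute_sym/sqC.
case: cfg => [cfg|[cfg|cfg]].
- have [a2 [/commute_comm xa [/commute_comm xb [e [nab [b2 e']]]]]] := cfg.
  constructor 3; exists x, b, a.
  have rel : relations [:: x; b; a] pres10.
    rewrite /relations /=; split=> //; rewrite !exp4; do !split=> //.
    by rewrite -(mulgA a) (sqC x b) mulgA (commgC b a) (comm_sym2 exp4 sqC b a) e.
  apply: pres10_recognize => //; first by rewrite -e.
  by apply: (gen_Omega NM Nx _ _ _ spl); apply: mem_gen; rewrite !inE eqxx ?orbT.
- have [a2 [b2 [/commute_comm xa [e [nab [nxb nxb2]]]]]] := cfg.
  constructor 1; exists x, [~ x, b], a, b.
  have rel : relations [:: x; [~ x, b]; a; b] pres8.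
    rewrite /relations /=; split=> //; rewrite exp4 (comm_sq exp4 sqC) a2 b2.
    do !split=> //; try exact/esym/cC; try exact: cC; try exact: commgC.
    by rewrite -(mulgA b) -swap mulgA (commgC a b) e.
  have Nxb : N [~ x, b].
    by rewrite !NM !NV (negPf Nx) Nb.
  apply: pres8_recognize => //; first exact/nesym.
  by apply: (gen_Omega NM Nx _ _ _ spl); apply: mem_gen; rewrite !inE eqxx ?orbT.
have [a2 [/commute_comm xb [e [nab [exa ne]]]]] := cfg.
constructor 2; exists b, x, a.
have ba : b * a = a * b^-1.
  by apply/(inverts_comm exp4); rewrite (comm_sym2 exp4 sqC).
have rel : relations [:: b; x; a] pres9.
  rewrite /relations /=; split=> //; rewrite !exp4; do !split=> //.
  have xV : x^-1 = x * x ^+ 2 by apply: mulg1_eq; rewrite -!expgS exp4.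
  rewrite commgC exa xV; move: (sqC x) (sqC b); move: (x ^+ 2) (b ^+ 2) => y z yC zC.
  rewrite -!mulgA; congr (_ * _).
  by rewrite (zC (x * y)) mulgA.
apply: pres9_recognize => //; first by rewrite -e.
  exact/nesym.
by apply: (gen_Omega NM Nx _ _ _ spl); apply: mem_gen; rewrite !inE eqxx ?orbT.
Qed.

End Shallow.

End NoOuterInvolution.

Section Classification.
Variables (G : groupType) (N : pred G) (t c : Prop).
Hypotheses (NM : forall g h, N (g * h) = (N g == N h))
  (nonabelian : ~ comm_set [set: G]) (C : skew_commute t c N)
  (nontrivial : exists x, ~~ N x) (ct : c -> t).

Local Notation NS := [set x | N x].
Local Notation splits p s L := (exists E : set G, [/\ elem_abelian2 E, presents s p,
  [set: G] = dprod (gen s) E & NS = dprod L E]).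

(** The cases are separated by the existence of involutions outside [N], then by
    the exponent outside [N], then by the commutativity of [N] and by [t]. *)
Lemma classification :
  (~ t /\ exists a b : G, splits pres1 [:: a; b] (gen [:: a ^+ 2; a * b])) \/
  (c /\ exists a b : G, splits pres2 [:: a; b] (gen [:: a ^+ 2; b])) \/
  (~ t /\ elem_abelian2 NS) \/
  (hamiltonian2 [set: G] /\ (comm_set NS \/ (hamiltonian2 NS /\ c))) \/
  (exists a b : G, splits pres5 [:: a; b] (gen [:: a; b ^+ 2])) \/
  (c /\ exists a b d : G, splits pres6 [:: a; b; d]
    (dprod (gen [:: a; d]) (gen [:: b ^+ 2]))) \/
  (~ t /\ exists a b d : G, splits pres7 [:: a; b; d] (gen [:: a; b])) \/
  (~ t /\ exists a b d e : G, splits pres8 [:: a; b; d; e]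
    (dprod (gen [:: b]) (gen [:: d; e]))) \/
  (~ t /\ exists a b d : G, splits pres9 [:: a; b; d]
    (dprod (gen [:: a; d]) (gen [:: b ^+ 2]))) \/
  (~ t /\ exists a b d : G, splits pres10 [:: a; b; d] (gen [:: b; d])).
Proof.
have [N2|[m0 [Nm0 m02]]] : (forall n, N n -> n ^+ 2 = 1) \/
    exists m, N m /\ m ^+ 2 <> 1.
  have [|nN2] := pselect (forall n, N n -> n ^+ 2 = 1); [by left | right].
  apply: contrapT => nex; apply: nN2 => n Nn; apply: contrapT => n2.
  by apply: nex; exists n.
  right; right; left; split; first exact: (elementary_not_torsion NM nonabelian C N2).
  exact: (elementary_abelian2 NM N2).
have [hout|inv] := pselect (forall y, ~~ N y -> y ^+ 2 <> 1); last first.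
  have [y [Ny y2]] : exists y, ~~ N y /\ y ^+ 2 = 1.
    by apply: contrapT => nex; apply: inv => y Ny y2; apply: nex; exists y.
  have [cen|ncen] := pselect (forall y, ~~ N y -> y ^+ 2 = 1 ->
      forall n, N n -> commute y n).
    have [? ? ?] := central_outer_involution NM nonabelian C Ny y2 cen.
    by do 3!right; left; split=> //; right.
  have [x [k [Nx x2 Nk xk]]] : exists x k, [/\ ~~ N x, x ^+ 2 = 1, N k & ~ commute x k].
    apply: contrapT => nex; apply: ncen => x Nx x2 k Nk; apply: contrapT => xk.
    by apply: nex; exists x, k.
  have := outer_involution NM C Nx x2 Nk xk Nm0 m02.
  by do 6!right; left.
have [out4|ndeep] := pselect (forall y, ~~ N y -> y ^+ 4 = 1); last first.
  have [x [Nx x4]] : exists x, ~~ N x /\ x ^+ 4 <> 1.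
    by apply: contrapT => nex; apply: ndeep => y Ny; apply: contrapT => y4;
       apply: nex; exists y.
  have [inv|ninv] := pselect (forall n, N n -> ~ commute x n -> n ^+ 2 = 1).
    have [h Nh xh] := deep_noncommuting NM nonabelian C nontrivial hout Nx x4.
    left; exact: (deep_semidihedral NM nonabelian C nontrivial hout Nx x4 Nh xh inv).
  have [h [Nh xh h2]] : exists h, [/\ N h, ~ commute x h & h ^+ 2 <> 1].
    apply: contrapT => nex; apply: ninv => n Nn xn; apply: contrapT => n2.
    by apply: nex; exists n.
  right; left; exact: (deep_quaternion NM nonabelian C nontrivial hout Nx x4 Nh xh h2).
have [ab|nab] := pselect (forall g h, N g -> N h -> commute g h).
  case: (shallow_abelian NM nonabelian C nontrivial hout out4 ab Nm0 m02) => [ham|].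
    by do 3!right; left; split=> //; left.
  by do 4!right; left.
have [k [h [Nk Nh kh]]] : exists k h, [/\ N k, N h & ~ commute k h].
  apply: contrapT => nex; apply: nab => g h Ng Nh; apply: contrapT => gh.
  by apply: nex; exists g, h.
have [ht|nt] := pselect t.
  case: (shallow_torsion NM nonabelian C nontrivial hout out4 ht Nk Nh kh).
  move=> hc [[hamG hamN]|it]; first by do 3!right; left; split=> //; right.
  by do 5!right; left.
have nc : ~ c by move/ct.
case: (shallow_torsion_free NM nonabelian C nontrivial hout out4 nc Nk Nh kh) => it.
- by do 7!right; left.
- by do 8!right; left.
by do 9!right.
Qed.

End Classification.

(** * Commutativity for the groups of the list *)

Section Quaternion.
Import fingroup cyclic extremal.

(** The generalized quaternion group of order 16 is a model of one of the
    presentations and its elements [x ^+ 2], [1] and [y] satisfy two others; this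
    shows that a power of a generator is nontrivial in the presented groups. *)
Lemma quaternion16 : exists (H : groupType) (x y : H),
  [/\ x ^+ 8 = 1, x ^+ 4 <> 1, y ^+ 2 = x ^+ 4 & x * y = y * x^-1].
Proof.
have [|[x y] [_ _ ox _] [oy y2 xy]] := @generators_quaternion _ [set: 'Q_(2 ^ 4)]%G 4 isT.
  exact: morphism.isog_refl.
exists ('Q_16)%type, x, y; split.
- by have := expg_order x; rewrite ox.
- by move=> /eqP; rewrite -order_dvdn ox.
- exact: y2.
by rewrite conjgC xy.
Qed.

End Quaternion.

(** The homomorphism given by the universal property maps a power of a generator
    to the same power of its image. *)
Lemma presents_power (G H : groupType) (e : seq G) (e' : seq H) p i n :
  presents e p -> relations e' p -> (i < size e)%N ->
  nth 1 e i ^+ n = 1 -> nth 1 e' i ^+ n = 1.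
Proof.
move=> [_ univ] /univ[f [fM <-]] ie en; rewrite (nth_map 1) //.
have [g1 _ _] := subgroup_gen e; have gi := mem_gen (mem_nth 1 ie).
have f1 : f 1 = 1 by apply: (mulgI (f 1)); rewrite -fM // !mulg1.
have fX m : f (nth 1 e i ^+ m) = f (nth 1 e i) ^+ m.
  elim: m => [|m IHm]; rewrite ?f1 // !expgS fM ?IHm //.
  exact: subgroupX (subgroup_gen e) gi.
by rewrite -fX en.
Qed.

Lemma dprod_left (G : groupType) (A B : set G) z x :
  dprod A B z -> A x -> dprod A B x.
Proof.
case=> sA sB AB ti _ Ax; split=> //; exists x, 1; rewrite mulg1.
by split=> //; case: sB.
Qed.

Lemma dprod_right (G : groupType) (A B : set G) z x :
  dprod A B z -> B x -> dprod A B x.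
Proof.
case=> sA sB AB ti _ Bx; split=> //; exists 1, x; rewrite mul1g.
by split=> //; case: sA.
Qed.

Section Backward.
Variables (G : groupType) (N : pred G) (c : Prop).
Hypotheses (NM : forall g h, N (g * h) = (N g == N h)) (nontrivial : exists x, ~~ N x).

Local Notation NS := [set x | N x].

Let N1 : N 1 := kernel1 NM.

Let NV : forall g, N g^-1 = N g := kernelV NM.

Let sN : subgroup NS := kernel_subgroup NM.

Definition involutions_central := forall g h, N g -> g ^+ 2 = 1 -> commute g h.

Section Product.
Variables (s : seq G) (E L : set G).
Hypotheses (eE : elem_abelian2 E) (GE : [set: G] = dprod (gen s) E)
  (NE : NS = dprod L E).

Lemma factor_in x : L x -> N x.
Proof.
move=> Lx; suff : NS x by []; have : NS 1 := N1; rewrite NE => h.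
exact: dprod_left h Lx.
Qed.

Lemma complement_in x : E x -> N x.
Proof.
move=> Ex; suff : NS x by []; have : NS 1 := N1; rewrite NE => h.
exact: dprod_right h Ex.
Qed.

(** Generators in [N] would give [N = G]. *)
Lemma outer_generator : has (fun x => ~~ N x) s.
Proof.
apply: contrapT => /negP/hasPn sin; have [x /negP[]] := nontrivial.
have : dprod (gen s) E x by rewrite -GE.
case=> _ _ _ _ [k [e [sk Ee ->]]]; rewrite NM (complement_in Ee).
suff gN : gen s `<=` NS by rewrite (gN _ sk).
by apply: gen_min sN _ => y /sin; rewrite negbK.
Qed.

(** An element of the complement is central, hence changes nothing to the
    conditions checked on the table. *)
Lemma table_backward (M : eqType) mul one els (ev : M -> G) gs NP cf tor w :
  (forall x y, ev (mul x y) = ev x * ev y) -> table_ok mul one els ->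
  closure_ok mul one els gs -> map ev gs = s -> (forall m, N (ev m) = NP m) ->
  skew_ok mul one els NP cf && (tor ==> torsion_ok mul els NP w) -> (cf -> c) ->
  skew_commute False c N /\ (tor -> ev w <> 1 -> involutions_central).
Proof.
move=> evM ok gok gsE evN /andP[sok tok] cfc.
have [sE Eab E2] := eE.
have dec g : exists m e, [/\ m \in els, g = ev m * e, e ^+ 2 = 1,
    forall h, commute e h & N g = NP m].
  have : dprod (gen s) E g by rewrite -GE.
  case=> _ _ sEC _ [k [e [sk Ee ->]]].
  have [m mc kE] : exists2 m, m \in generated mul one gs & k = ev m.
    by apply/(gen_closureP evM ok k gok); rewrite gsE.
  exists m, e; split; [| by rewrite kE | exact: E2 | |].
  - by case/and4P: gok => _ _ /allP/(_ m mc).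
  - move=> h; have : dprod (gen s) E h by rewrite -GE.
    case=> _ _ _ _ [k' [e' [sk' Ee' ->]]]; apply: commuteM; last exact: Eab.
    by apply/commute_sym; apply: sEC.
  by rewrite NM (complement_in Ee) kE evN; case: (NP m).
split; first exact: (model_skew evM ok cfc dec sok).
by move=> ht wn; apply: (model_torsion evM dec _ wn); apply: implyP tok ht.
Qed.

Lemma triple_backward d a b g u v gs cf tor :
  triple d a b g u v -> N u -> N v -> table_ok (wmul d) wone (words d) ->
  closure_ok (wmul d) wone (words d) gs -> map (wval a b g u v) gs = s ->
  skew_ok (wmul d) wone (words d) (parity (N a) (N b) (N g)) cf &&
    (tor ==> torsion_ok (wmul d) (words d) (parity (N a) (N b) (N g)) wu) -> (cf -> c) ->
  skew_commute False c N /\ (tor -> u <> 1 -> involutions_central).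
Proof.
move=> tr Nu Nv ok gok gsE chk cfc.
have uE : wval a b g u v wu = u by rewrite wvalE.
rewrite -[X in X <> 1]uE.
by apply: (table_backward (wvalM tr) ok gok gsE _ chk cfc) => w; apply: N_wval.
Qed.

Lemma octic_backward r a b gs cf tor : (r * r = 1 %[mod 8])%N ->
  a ^+ 8 = 1 -> b ^+ 2 = a ^+ 4 -> a * b = b * a ^+ r ->
  table_ok (omul r) (0%N, false) octs -> closure_ok (omul r) (0%N, false) octs gs ->
  map (oval a b) gs = s ->
  skew_ok (omul r) (0%N, false) octs (oparity (N a) (N b)) cf &&
    (tor ==> torsion_ok (omul r) octs (oparity (N a) (N b)) (4%N, false)) -> (cf -> c) ->
  skew_commute False c N /\ (tor -> a ^+ 4 <> 1 -> involutions_central).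
Proof.
move=> rr a8 bb ab ok gok gsE chk cfc.
have -> : a ^+ 4 = oval a b (4%N, false) by rewrite /oval mulg1.
have evM x y : oval a b (omul r x y) = oval a b x * oval a b y by apply: ovalM.
by apply: (table_backward evM ok gok gsE _ chk cfc) => w; apply: N_oval.
Qed.

End Product.

Section Items.
Variables (E L : set G).
Hypotheses (eE : elem_abelian2 E) (NE : NS = dprod L E).

Let Nsq : forall g, N (g ^+ 2) := kernel_sq NM.

(** Some generator lies outside [N]; together with the elements of [L] at hand
    this determines the kernel on the generators, hence on the whole table. *)
Lemma pres1_commute a b : presents [:: a; b] pres1 ->
  [set: G] = dprod (gen [:: a; b]) E -> L (a * b) -> skew_commute False c N.
Proof.
move=> [rel _] GE /(factor_in NE); rewrite NM => /eqP Nab.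
have := outer_generator GE NE; rewrite /= Nab orbF orbb => Nb.
have [_ [_ [[<- <-] a8 bb ab]]] := pres1_octic rel.
have ok : table_ok (omul 3) (0%N, false) octs by vm_compute.
have gok : closure_ok (omul 3) (0%N, false) octs [:: (1%N, false); (0%N, true)].
  by vm_compute.
have chk : skew_ok (omul 3) (0%N, false) octs (oparity (N a) (N b)) false && true.
  by rewrite Nab (negPf Nb); vm_compute.
have gsE : map (oval a b) [:: (1%N, false); (0%N, true)] = [:: a; b].
  by rewrite /= !ovalE.
by have [] := octic_backward (r := 3) (tor := false) eE GE NE erefl a8 bb ab ok gok gsE chk.
Qed.

Lemma pres2_commute a b : presents [:: a; b] pres2 ->
  [set: G] = dprod (gen [:: a; b]) E -> L b \/ L (a * b) -> c ->
  skew_commute False c N /\ involutions_central.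
Proof.
move=> pr GE Lb hc; have [rel _] := pr; have := outer_generator GE NE.
have a4 : a ^+ 4 <> 1.
  have [H [x [y [x8 x4 y2 xy]]]] := quaternion16 => a4; apply: x4.
  have rel' : relations [:: x; y] pres2 by [].
  exact: (presents_power (i := 0) pr rel' isT a4).
have [_ [_ [[<- <-] a8 bb ab]]] := pres2_octic rel.
have ok : table_ok (omul 7) (0%N, false) octs by vm_compute.
have gok : closure_ok (omul 7) (0%N, false) octs [:: (1%N, false); (0%N, true)].
  by vm_compute.
move=> /= out; have Na : N a = false.
  by case: Lb out => /(factor_in NE); rewrite ?NM; case: (N a); case: (N b).
have chk : skew_ok (omul 7) (0%N, false) octs (oparity (N a) (N b)) true &&
    (true ==> torsion_ok (omul 7) octs (oparity (N a) (N b)) (4%N, false)).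
  by rewrite Na; case: (N b); vm_compute.
have gsE : map (oval a b) [:: (1%N, false); (0%N, true)] = [:: a; b].
  by rewrite /= !ovalE.
have [//|sk tor] := octic_backward (r := 7) eE GE NE erefl a8 bb ab ok gok gsE chk.
by split; last exact: tor.
Qed.

Lemma pres5_commute a b : presents [:: a; b] pres5 ->
  [set: G] = dprod (gen [:: a; b]) E -> L a \/ L (a * b) ->
  skew_commute False c N /\ involutions_central.
Proof.
move=> pr GE La; have [rel _] := pr; have := outer_generator GE NE.
have a2 : a ^+ 2 <> 1.
  have [H [x [y [x8 x4 _ _]]]] := quaternion16 => a2; apply: x4.
  have rel' : relations [:: x ^+ 2; 1] pres5.
    by rewrite /relations /= -expgnA x8 expg1n invg1 mulg1 mul1g.
  rewrite (expgnA x 2 2); exact: (presents_power (i := 0) pr rel' isT a2).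
have [_ [_ [[<- <-] tr]]] := pres5_triple rel => /= out.
have Nb : N b = false.
  by case: La out => /(factor_in NE); rewrite ?NM; case: (N a); case: (N b).
have chk : skew_ok (wmul tab5) wone (words tab5) (parity (N a) (N b) (N 1)) false &&
    (true ==> torsion_ok (wmul tab5) (words tab5) (parity (N a) (N b) (N 1)) wu).
  by rewrite Nb N1; case: (N a); vm_compute.
have gok : closure_ok (wmul tab5) wone (words tab5) [:: wa; wb] by vm_compute.
have gsE : map (wval a b 1 (a ^+ 2) (b ^+ 2)) [:: wa; wb] = [:: a; b].
  by rewrite /= !wvalE.
have [//|sk tor] := triple_backward eE GE NE tr (Nsq a) (Nsq b) tab5_ok gok gsE chk.
by split; last exact: tor.
Qed.

Lemma pres6_commute a b d : presents [:: a; b; d] pres6 ->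
  [set: G] = dprod (gen [:: a; b; d]) E -> L a -> L d \/ L (b * d) -> c ->
  skew_commute False c N /\ involutions_central.
Proof.
move=> pr GE La Ld hc; have [rel _] := pr; have := outer_generator GE NE.
have a2 : a ^+ 2 <> 1.
  have [H [x [y [x8 x4 y2 xy]]]] := quaternion16 => a2; apply: x4.
  have rel' : relations [:: x ^+ 2; 1; y] pres6.
    rewrite /relations /= -!expgnA x8 expg1n invg1 !mulg1 !mul1g; do !split=> //.
    exact: (invertsX 2 xy).
  rewrite (expgnA x 2 2); exact: (presents_power (i := 0) pr rel' isT a2).
have [_ [_ [_ [[<- <- <-] tr]]]] := pres6_triple rel => /= out.
have Na := factor_in NE La; have Nb : N b = false.
  by case: Ld out => /(factor_in NE); rewrite ?NM Na; case: (N d); case: (N b).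
have chk : skew_ok (wmul tab6) wone (words tab6) (parity (N a) (N b) (N d)) true &&
    (true ==> torsion_ok (wmul tab6) (words tab6) (parity (N a) (N b) (N d)) wu).
  by rewrite Na Nb; case: (N d); vm_compute.
have gok : closure_ok (wmul tab6) wone (words tab6) [:: wa; wb; wc] by vm_compute.
have gsE : map (wval a b d (a ^+ 2) (b ^+ 2)) [:: wa; wb; wc] = [:: a; b; d].
  by rewrite /= !wvalE.
have [//|sk tor] := triple_backward eE GE NE tr (Nsq a) (Nsq b) tab6_ok gok gsE chk.
by split; last exact: tor.
Qed.

Lemma pres7_commute a b d : presents [:: a; b; d] pres7 ->
  [set: G] = dprod (gen [:: a; b; d]) E ->
  [\/ L a /\ L b, L a /\ L d | L b /\ L d] -> skew_commute False c N.
Proof.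
move=> [rel _] GE LL; have := outer_generator GE NE.
have [_ [_ [_ [[<- <- <-] tr]]]] := pres7_triple rel => /= out.
have chk : skew_ok (wmul tab7) wone (words tab7) (parity (N a) (N b) (N d)) false &&
    (false ==> torsion_ok (wmul tab7) (words tab7) (parity (N a) (N b) (N d)) wu).
  by case: LL out => -[/(factor_in NE)-> /(factor_in NE)->] /=;
     rewrite ?orbF => /negPf->; vm_compute.
have gok : closure_ok (wmul tab7) wone (words tab7) [:: wa; wb; wc] by vm_compute.
have gsE : map (wval a b d ((a * b) ^+ 2) 1) [:: wa; wb; wc] = [:: a; b; d].
  by rewrite /= !wvalE.
by have [] := triple_backward eE GE NE tr (Nsq (a * b)) N1 tab7_ok gok gsE chk.
Qed.

Lemma pres8_commute a b d e : presents [:: a; b; d; e] pres8 ->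
  [set: G] = dprod (gen [:: a; b; d; e]) E -> L b -> L d -> L e ->
  skew_commute False c N.
Proof.
move=> [rel _] GE /(factor_in NE) Nb /(factor_in NE) Nd /(factor_in NE) Ne.
have := outer_generator GE NE; rewrite /= Nb Nd Ne !orbF => Na.
have [_ [_ [_ [_ [[<- <- <- <-] tr]]]]] := pres8_triple rel.
have chk : skew_ok (wmul tab8) wone (words tab8) (parity (N a) (N d) (N e)) false &&
    (false ==> torsion_ok (wmul tab8) (words tab8) (parity (N a) (N d) (N e)) wu).
  by rewrite (negPf Na) Nd Ne; vm_compute.
have gok : closure_ok (wmul tab8) wone (words tab8) [:: wa; wv; wb; wc] by vm_compute.
have gsE : map (wval a d e (a ^+ 2) b) [:: wa; wv; wb; wc] = [:: a; b; d; e].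
  by rewrite /= !wvalE.
by have [] := triple_backward eE GE NE tr (Nsq a) Nb tab8_ok gok gsE chk.
Qed.

Lemma pres9_commute a b d : presents [:: a; b; d] pres9 ->
  [set: G] = dprod (gen [:: a; b; d]) E -> L a -> L d -> skew_commute False c N.
Proof.
move=> [rel _] GE /(factor_in NE) Na /(factor_in NE) Nd.
have := outer_generator GE NE; rewrite /= Na Nd !orbF => Nb.
have [_ [_ [_ [[<- <- <-] tr]]]] := pres9_triple rel.
have chk : skew_ok (wmul tab9) wone (words tab9) (parity (N a) (N b) (N d)) false &&
    (false ==> torsion_ok (wmul tab9) (words tab9) (parity (N a) (N b) (N d)) wu).
  by rewrite Na (negPf Nb) Nd; vm_compute.
have gok : closure_ok (wmul tab9) wone (words tab9) [:: wa; wb; wc] by vm_compute.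
have gsE : map (wval a b d (a ^+ 2) (b ^+ 2)) [:: wa; wb; wc] = [:: a; b; d].
  by rewrite /= !wvalE.
by have [] := triple_backward eE GE NE tr (Nsq a) (Nsq b) tab9_ok gok gsE chk.
Qed.

Lemma pres10_commute a b d : presents [:: a; b; d] pres10 ->
  [set: G] = dprod (gen [:: a; b; d]) E -> L b \/ L (a * b) -> L d ->
  skew_commute False c N.
Proof.
move=> [rel _] GE Lb /(factor_in NE) Nd; have := outer_generator GE NE.
have [_ [_ [_ [[<- <- <-] tr]]]] := pres10_triple rel => /= out.
have Na : N a = false.
  by case: Lb out => /(factor_in NE); rewrite ?NM Nd; case: (N a); case: (N b).
have chk : skew_ok (wmul tab10) wone (words tab10) (parity (N a) (N b) (N d)) false &&
    (false ==> torsion_ok (wmul tab10) (words tab10) (parity (N a) (N b) (N d)) wu).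
  by rewrite Na Nd; case: (N b); vm_compute.
have gok : closure_ok (wmul tab10) wone (words tab10) [:: wa; wb; wc] by vm_compute.
have gsE : map (wval a b d (a ^+ 2) (b ^+ 2)) [:: wa; wb; wc] = [:: a; b; d].
  by rewrite /= !wvalE.
by have [] := triple_backward eE GE NE tr (Nsq a) (Nsq b) tab10_ok gok gsE chk.
Qed.

End Items.

End Backward.

(** * Hamiltonian 2-groups *)

Section Dedekind.
Variable G : groupType.
Implicit Types (x y z : G).

Lemma odd_power_trivial x m k : x ^+ (2 ^ m) = 1 -> odd k -> x ^+ k = 1 -> x = 1.
Proof.
elim: m x => [//|m IHm] x xm ko xk.
have x2 : x ^+ 2 = 1.
  apply: (IHm (x ^+ 2)) => //; first by rewrite -expgnA -expnS.
  by rewrite -expgnA mulnC expgnA xk expg1n.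
by move: xk; rewrite -(odd_double_half k) ko expgnDr -mul2n expgnA x2 expg1n mulg1.
Qed.

(** A cyclic 2-group has a single involution. *)
Lemma cyclic_involution x m k : x ^+ (2 ^ m.+1) = 1 -> x ^+ (2 ^ m) <> 1 ->
  x ^+ k <> 1 -> x ^+ k ^+ 2 = 1 -> x ^+ k = x ^+ (2 ^ m).
Proof.
elim: m x k => [|m IHm] x k xm xm' xk xk2.
  by move: xk; rewrite -(odd_double_half k) expgnDr -mul2n expgnA xm expg1n mulg1; case: odd.
have [ko|ke] := boolP (odd k).
  case: xm'; rewrite expnS expgnA; suff -> : x ^+ 2 = 1 by rewrite expg1n.
  apply: (odd_power_trivial (m := m.+1) _ ko); first by rewrite -expgnA -expnS.
  by rewrite -expgnA mulnC expgnA.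
move: xk xk2; rewrite -(odd_double_half k) (negPf ke) add0n -mul2n expgnA => xk xk2.
have sqX j : x ^+ 2 ^+ (2 ^ j) = x ^+ (2 ^ j.+1) by rewrite -expgnA -expnS.
by rewrite -sqX; apply: IHm; rewrite ?sqX.
Qed.

Lemma cyclic_gen x z : (exists n, x ^+ n.+1 = 1) -> gen [:: x] z -> exists k, z = x ^+ k.
Proof.
move=> fin; apply: (gen_words (W := [set z | exists k, z = x ^+ k])).
- by exists 0%N.
- by move=> y w; rewrite inE => /eqP-> [k ->]; exists k.+1; rewrite expgSr.
by move=> y; rewrite inE => /eqP->.
Qed.

Hypothesis ham : hamiltonian2 [set: G].

Let fin2 x : exists m, x ^+ (2 ^ m) = 1. Proof. by case: ham => _ _ h _; apply: h. Qed.

Let conj_power x y : exists k, x ^ y = x ^+ k.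
Proof.
have [m xm] := fin2 x; apply: cyclic_gen.
  by exists (2 ^ m).-1; rewrite prednK ?expn_gt0.
case: ham => _ _ _ /(_ (gen [:: x])) h; apply: h => //; first exact: subgroup_gen.
by apply: mem_gen; rewrite mem_head.
Qed.

Let Q8_exists := exists x y : G, ~ commute x y /\ Q8pair x y.

(** In a noncommuting pair of minimal orders, the squares commute with the other
    element and both cyclic groups end with the commutator. Unless both orders
    are 4, some product of powers then has a smaller order. *)
Let descent_step p x y m n : (n <= m)%N -> (m.+1 + n.+1 <= p.+1)%N ->
  (forall x y m n, (m + n <= p)%N -> x ^+ (2 ^ m) = 1 -> y ^+ (2 ^ n) = 1 ->
     ~ commute x y -> Q8_exists) ->
  x ^+ (2 ^ m.+1) = 1 -> y ^+ (2 ^ n.+1) = 1 -> ~ commute x y -> Q8_exists.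
Proof.
move=> nm mnp IHp xm yn xy.
have [xm'|xm'] := pselect (x ^+ (2 ^ m) = 1); first exact: (IHp x y m n.+1).
have [yn'|yn'] := pselect (y ^+ (2 ^ n) = 1).
  by apply: (IHp x y m.+1 n) => //; rewrite -ltnS -addnS.
have [x2y|x2y] := pselect (commute (x ^+ 2) y); last first.
  by apply: (IHp (x ^+ 2) y m n.+1) => //; rewrite -expgnA -expnS.
have [y2x|y2x] := pselect (commute x (y ^+ 2)); last first.
  by apply: (IHp x (y ^+ 2) m.+1 n) => //; rewrite -?expgnA -?expnS // -ltnS -addnS.
pose z := [~ x, y]; have xyE : x ^ y = x * z by rewrite /z commgEl mulVKg.
have yxE : y ^ x = y * z^-1 by rewrite /z invgR commgEl mulVKg.
have [k xk] := conj_power x y; have [l yl] := conj_power y x.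
have zx : commute z x.
  by rewrite -(mulKg x z) -xyE xk; apply/commute_sym/commuteM; [apply: commuteV|apply: commuteX].
have zy : commute z y.
  rewrite -[z]invgK -(mulKg y z^-1) -yxE yl; apply/commute_sym/commuteV/commuteM.
    exact: commuteV.
  exact: commuteX.
have z1 : z <> 1 by move=> ze; apply: xy; apply/conj_commute; rewrite xyE ze mulg1.
have z2 : z ^+ 2 = 1.
  have := conjXg x y 2; rewrite (conj_commute _ _).2 // xyE expgMn; last exact/commute_sym.
  by rewrite -{1}[x ^+ 2]mulg1 => /mulgI.
have zV := (sqg1 z).1 z2.
have pow_inv (w : G) e j : w ^+ (2 ^ e) = 1 -> w^-1 * w ^+ j = w ^+ ((2 ^ e).-1 + j).
  move=> we; rewrite expgnDr; congr (_ * _); apply: mulg1_eq.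
  by rewrite -expgS prednK ?expn_gt0.
have zX : z = x ^+ (2 ^ m).
  have zE : z = x ^+ ((2 ^ m.+1).-1 + k) by rewrite -pow_inv // -xk xyE mulKg.
  by rewrite zE; apply: cyclic_involution; rewrite -?zE.
have zY : z = y ^+ (2 ^ n).
  have zE : z = y ^+ ((2 ^ n.+1).-1 + l) by rewrite -pow_inv // -yl yxE mulKg zV.
  by rewrite zE; apply: cyclic_involution; rewrite -?zE.
have finish (v : G) : v ^+ (2 ^ n) = 1 -> ~ commute x v -> Q8_exists.
  by move=> vn; apply: (IHp x v m.+1 n) => //; rewrite -ltnS -addnS.
have xX j : commute x (x ^+ j) by apply: commuteX.
have [n_m|m_n] := ltnP n m.
  have wn : x ^+ (2 ^ (m - n)) ^+ (2 ^ n) = z by rewrite -expgnA -expnD subnK.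
  move: (subn_gt0 n m) wn; rewrite n_m; case: (m - n)%N => // j _.
  rewrite expnS expgnA => wn; pose w := x ^+ 2 ^+ (2 ^ j).
  have xw : commute x w by apply/commuteX/xX.
  have yw : commute y w by apply/commuteX/commute_sym.
  apply: (finish (y * w^-1)); last first.
    move=> xyw; apply: xy; rewrite -(mulgVK w y); exact: commuteM.
  by rewrite expgMn ?expVgn ?wn -?zY ?mulgV //; apply: commuteV.
have {m_n nm} mn : m = n by apply/eqP; rewrite eqn_leq m_n nm.
move: xm xm' zX; rewrite {}mn {IHp mnp} => xm xm' zX.
case: n => [|[|n]] in yn yn' xm xm' zX zY finish *.
- by case: xy; rewrite -[y]zY; apply/commute_sym.
- exists x, y; split=> //; right; split=> //; last by rewrite -zX -zY.
  by apply/conj_inverts; rewrite xyE zX; apply/esym/mulg1_eq; rewrite -!expgS.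
apply: (finish (y * x^-1)); last first.
  move=> xyx; apply: xy; rewrite -(mulgVK x y); exact: commuteM.
have xVy : x^-1 * y = y * z * x^-1.
  by rewrite -[X in y * X]zV -yxE conjgE mulgA mulgK.
clearbody z.
have v2 : (y * x^-1) ^+ 2 = z * (y ^+ 2 * x^-1 ^+ 2).
  rewrite !expg2 -!mulgA (mulgA x^-1) xVy -!mulgA.
  by rewrite (mulgA z y) zy -(mulgA y z) (mulgA z y) zy -!mulgA.
have y2xV : commute (y ^+ 2) (x^-1 ^+ 2).
  by apply/commuteX/commuteV/commute_sym.
have zyx : commute z (y ^+ 2 * x^-1 ^+ 2).
  by apply: commuteM; [exact: commuteX | apply/commuteX/commuteV].
rewrite expnS expgnA v2 expgMn // expgMn // -!expgnA -!expnS expVgn -zX -zY mulgV.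
by rewrite mulg1 expnS expgnA z2 expg1n.
Qed.

Let descent p x y m n : (m + n <= p)%N -> x ^+ (2 ^ m) = 1 -> y ^+ (2 ^ n) = 1 ->
  ~ commute x y -> Q8_exists.
Proof.
elim: p x y m n => [|p IHp] x y m n mnp xm yn xy.
  by move: mnp xm; rewrite leqn0 addn_eq0 => /andP[/eqP-> _] /= x1; case: xy;
     rewrite (x1 : x = 1); apply/commute_sym/commute1.
case: m mnp xm => [_ x1|m mnp xm].
  by case: xy; rewrite (x1 : x = 1); apply/commute_sym/commute1.
case: n mnp yn => [_ y1|n mnp yn].
  by case: xy; rewrite (y1 : y = 1); apply: commute1.
have [nm|/ltnW mn] := leqP n m; first exact: (descent_step nm mnp IHp xm yn xy).
by apply: (descent_step mn _ IHp yn xm) => [|/commute_sym//]; rewrite addnC.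
Qed.

Let involution_central x g : x ^+ 2 = 1 -> x ^ g = x.
Proof.
move=> x2; have [k xk] := conj_power x g.
have E b : x ^+ (b + k./2.*2) = x ^+ b by rewrite expgnDr -mul2n expgnA x2 expg1n mulg1.
move: xk; rewrite -(odd_double_half k) E; case: odd => //= xg.
by rewrite xg -(conjgK g x) xg conj1g.
Qed.

Let conj_order4 x g : x ^+ 4 = 1 -> x ^+ 2 <> 1 -> x ^ g = x \/ x ^ g = x^-1.
Proof.
move=> x4 x2; have [k xk] := conj_power x g; move: xk.
have -> : x ^+ k = x ^+ (k %% 4).
  by rewrite {1}(divn_eq k 4) expgnDr mulnC expgnA x4 expg1n mul1g.
have xg2 : (x ^ g) ^+ 2 <> 1.
  by rewrite -conjXg => e; apply: x2; rewrite -(conjgK g (x ^+ 2)) e conj1g.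
have := ltn_pmod k (isT : (0 < 4)%N); case: (k %% 4)%N => [|[|[|[|//]]]] _ xg.
- by case: xg2; rewrite xg expg1n.
- by left.
- by case: xg2; rewrite xg -expgnA.
by right; rewrite xg; apply/esym/mulg1_eq; rewrite -expgS.
Qed.

(** The group is the product of any of its quaternion subgroups of order 8 with
    its centralizer; the latter has exponent 2 because [<c * x>] is normal for
    each [c] in it. *)
Lemma hamiltonian_Q8pair (g h : G) : Q8pair g h.
Proof.
have [x [y [xy q8]]] : Q8_exists.
  have [_ nab _ _] := ham; apply: contrapT => nex; apply: nab => x y _ _.
  apply: contrapT => xy; apply: nex; have [m xm] := fin2 x; have [n yn] := fin2 y.
  exact: (descent (leqnn _) xm yn xy).
have [//|[yx xy2 x4]] := q8; have [/commute_sym//|[xy' _ y4]] := Q8pair_sym q8.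
have x2 : x ^+ 2 <> 1.
  by move=> e; apply: xy; rewrite /commute yx ((sqg1 x).1 e).
have y2 : y ^+ 2 <> 1 by rewrite -xy2.
have /conj_inverts xyV := yx; have /conj_inverts yxV := xy'.
have xx : x ^ x = x by apply/conj_commute.
have yy : y ^ y = y by apply/conj_commute.
pose cent c := x ^ c = x /\ y ^ c = y.
have centC c : cent c -> commute c x /\ commute c y.
  by case=> /conj_commute/commute_sym cx /conj_commute/commute_sym cy.
have cent2 c : cent c -> c ^+ 2 = 1.
  have [m cm] := fin2 c; elim: m c cm => [|m IHm] c cm cC.
    by rewrite (cm : c = 1) expg1n.
  have [cx cy] := centC c cC.
  have c4 : c ^+ 4 = 1.
    rewrite (expgnA c 2 2) IHm -?expgnA -?expnS //.
    by split; apply/conj_commute; apply: commuteX; apply/commute_sym.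
  have cxy : (c * x) ^ y = c * x^-1.
    by rewrite conjMg xyV; congr (_ * _); apply/conj_commute.
  have cx_x : c * x^-1 = c * x -> x ^+ 2 = 1 by move=> /mulgI/sqg1.
  have [w2|w2] := pselect ((c * x) ^+ 2 = 1).
    by case: x2; apply: cx_x; rewrite -cxy involution_central.
  have w4 : (c * x) ^+ 4 = 1 by rewrite expgMn // c4 x4 mulg1.
  case: (conj_order4 y w4 w2); rewrite cxy; first by move/cx_x.
  rewrite invgM (commuteV cx) => /mulgI/esym e; exact/sqg1.
have centM c d : cent c -> cent d -> cent (c * d).
  by move=> [xc yc] [xd yd]; split; rewrite conjgM ?xc ?yc.
have centab c d : cent c -> cent d -> commute c d.
  move=> cC dC; have /sqg1 := cent2 _ (centM c d cC dC).
  by rewrite invgM ((sqg1 c).1 (cent2 c cC)) ((sqg1 d).1 (cent2 d dC)).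
have dec k : exists c q, [/\ cent c, q \in [:: 1; x; y; x * y] & k = c * q].
  have [q qin qC] : exists2 q, q \in [:: 1; x; y; x * y] & cent (q * k^-1).
    case: (conj_order4 k^-1 x4 x2) => xk; case: (conj_order4 k^-1 y4 y2) => yk.
    - by exists 1; rewrite ?inE ?eqxx // mul1g.
    - exists x; first by rewrite !inE eqxx orbT.
      by split; rewrite conjgM ?xx // yxV conjVg yk invgK.
    - exists y; first by rewrite !inE eqxx !orbT.
      by split; rewrite conjgM ?yy // xyV conjVg xk invgK.
    exists (x * y); first by rewrite !inE eqxx !orbT.
    by split; rewrite !conjgM ?xx ?xyV ?yxV !conjVg ?yy ?xk ?yk invgK.
  exists (q * k^-1), q; split=> //; have /sqg1 <- := cent2 _ qC.
  by rewrite invgM invgK mulgVK.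
have qC c q : cent c -> q \in [:: 1; x; y; x * y] -> commute c q.
  move=> /centC[cx cy]; rewrite !inE => /or4P[] /eqP-> //; first exact: commute1.
  exact: commuteM.
have [c [q [cC qin ->]]] := dec g; have [d [r [dC rin ->]]] := dec h.
apply: Q8pair_mul; try exact: cent2.
- by move=> k; rewrite inE => /orP[/eqP->|]; [exact: centab | rewrite !inE => /orP[] /eqP->; exact: qC].
- by move=> k; rewrite !inE => /orP[] /eqP->; exact: qC.
have qxy := Q8pair_mulr q8; have qyx := Q8pair_mull (Q8pair_sym q8).
have one (k : G) : Q8pair 1 k by left; apply/commute_sym/commute1.
have refl (k : G) : Q8pair k k by left.
by move: qin rin; rewrite !inE => /or4P[] /eqP-> /or4P[] /eqP->; try by []; exact: Q8pair_sym.
Qed.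

End Dedekind.

(** * The two cases without a presentation *)

Lemma elementary_commute (G : groupType) (N : pred G) (c : Prop) :
  (forall g h, N (g * h) = (N g == N h)) -> (forall n, N n -> n ^+ 2 = 1) ->
  skew_commute False c N.
Proof.
move=> NM N2; have N1 := kernel1 NM.
have NV := kernelV NM.
split=> // [x y Nx Ny|x n Nx Nn|g h Ng _ []]; last exact: N2.
  by constructor 4; split; apply: N2; rewrite NM ?NV (negPf Nx) (negPf Ny).
by constructor 4; apply: N2.
Qed.

(** Noncommuting elements invert each other and have the same square; only those
    of [N] ask for [c]. *)
Lemma hamiltonian_commute (G : groupType) (N : pred G) (c : Prop) :
  hamiltonian2 [set: G] -> comm_set [set x | N x] \/ c ->
  skew_commute False c N /\ involutions_central N.
Proof.
move=> /hamiltonian_Q8pair q8 Nc; split=> [|g h _ g2]; last first.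
  by case: (q8 g h) => // -[]; rewrite /inverts ((sqg1 g).1 g2).
split=> // [x y _ _|x n _ _|g h Ng Nh _ _].
- by case: (q8 x y) => [|[e _ _]]; [constructor 1 | constructor 2].
- by case: (q8 x n) => [|[e _ _]]; [constructor 1 | constructor 2].
case: (q8 g h) => [|[e gh g4]]; first by constructor 1.
by case: Nc => [ab|hc]; [constructor 1; apply: ab | constructor 3].
Qed.

(** * Torsion and characteristic of the ring *)

Section Characteristic.
Variable R : comNzRingType.
Local Open Scope ring_scope.

Lemma two_neq0 : ~ has_char R 2 -> 2%:R != 0 :> R.
Proof.
move=> nc; apply/eqP => two0; apply: nc => m; rewrite dvdn2.
have -> : m%:R = (odd m)%:R :> R.
  by rewrite -{1}(odd_double_half m) natrD -muln2 natrM two0 mulr0 addr0.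
by case: odd; split=> // /eqP; rewrite oner_eq0.
Qed.

Lemma has_char4P : 2%:R != 0 :> R -> has_char R 4 <-> 4%:R = 0 :> R.
Proof.
move=> two0; split=> [->//|four0] m.
have -> : m%:R = (m %% 4)%:R :> R.
  by rewrite {1}(divn_eq m 4) natrD natrM four0 mulr0 add0r.
rewrite /dvdn; have := ltn_pmod m (isT : (0 < 4)%N).
case: (m %% 4)%N => [|[|[|[|//]]]] _; split=> // e.
- by have := oner_neq0 R; rewrite -e eqxx.
- by rewrite e eqxx in two0.
have : 3%:R + 1%:R = 0 :> R by rewrite -natrD.
by rewrite e add0r => /eqP; rewrite oner_eq0.
Qed.

Lemma torsion2P : torsion2 R = [set 0] <-> ~ exists2 r : R, r != 0 & r *+ 2 = 0.
Proof.
split=> [e [r r0 r2]|nr].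
  by have : torsion2 R r by []; rewrite e /= => re; rewrite re eqxx in r0.
apply/seteqP; split=> r /=; last by move=> ->; rewrite /torsion2 /= mul0rn.
by move=> r2; apply: contrapT => /eqP r0; apply: nr; exists r.
Qed.

End Characteristic.

Theorem theorem1p1 (R : comNzRingType) (G : groupType) (sigma : G -> int)
    (charR : ~ has_char R 2)
    (nonabelianG : ~ comm_set [set: G])
    (orient_sigma : is_orientation sigma)
    (nontriv_sigma : exists g : G, sigma g <> 1%R) :
  let N := oker sigma in
  (forall x y : group_ring R G,
     antisym sigma x -> antisym sigma y -> (x * y = y * x)%R)
  <->
  (* 1 *)
  (torsion2 R = [set 0%R] /\
   exists (a b : G) (E : set G),
     [/\ elem_abelian2 E,
         [:: a; b] \presents
           Grp (a : b : a ^+ 8 = 1, b ^+ 2 = a ^+ 4, a * b = b * a ^+ 3),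
         [set: G] = dprod (gen [:: a; b]) E
       & N = dprod (gen [:: a ^+ 2; a * b]) E]) \/
  (* 2 *)
  (has_char R 4 /\
   exists (a b : G) (E : set G),
     [/\ elem_abelian2 E,
         [:: a; b] \presents
           Grp (a : b : a ^+ 8 = 1, b ^+ 2 = a ^+ 4, a * b = b * a ^-1),
         [set: G] = dprod (gen [:: a; b]) E
       & N = dprod (gen [:: a ^+ 2; b]) E \/
         N = dprod (gen [:: a ^+ 2; a * b]) E]) \/
  (* 3 *)
  (torsion2 R = [set 0%R] /\ elem_abelian2 N) \/
  (* 4 *)
  (hamiltonian2 [set: G] /\
   (comm_set N \/ (hamiltonian2 N /\ has_char R 4))) \/
  (* 5 *)
  (exists (a b : G) (E : set G),
     [/\ elem_abelian2 E,
         [:: a; b] \presents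
           Grp (a : b : a ^+ 4 = b ^+ 4 = 1, a * b = b ^-1 * a),
         [set: G] = dprod (gen [:: a; b]) E
       & N = dprod (gen [:: a; b ^+ 2]) E \/
         N = dprod (gen [:: a * b; b ^+ 2]) E]) \/
  (* 6 *)
  (has_char R 4 /\
   exists (a b c : G) (E : set G),
     [/\ elem_abelian2 E,
         [:: a; b; c] \presents
           Grp (a : b : c : a ^+ 4 = b ^+ 4 = 1, c ^+ 2 = a ^+ 2,
                a * b = b * a, a * c = c * a ^-1, b * c = c * b ^-1),
         [set: G] = dprod (gen [:: a; b; c]) E
       & N = dprod (dprod (gen [:: a; c]) (gen [:: b ^+ 2])) E \/
         N = dprod (dprod (gen [:: a; b * c]) (gen [:: b ^+ 2])) E]) \/
  (* 7 *)
  (torsion2 R = [set 0%R] /\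
   exists (a b c : G) (E : set G),
     [/\ elem_abelian2 E,
         [:: a; b; c] \presents
           Grp (a : b : c : a ^+ 2 = 1, b ^+ 2 = 1, c ^+ 2 = 1,
                a * b * c = b * c * a = c * a * b),
         [set: G] = dprod (gen [:: a; b; c]) E
       & [\/ N = dprod (gen [:: a; b]) E,
             N = dprod (gen [:: a; c]) E
           | N = dprod (gen [:: b; c]) E]]) \/
  (* 8 *)
  (torsion2 R = [set 0%R] /\
   exists (a b c d : G) (E : set G),
     [/\ elem_abelian2 E,
         [:: a; b; c; d] \presents
           Grp (a : b : c : d :
                a ^+ 4 = 1, b ^+ 2 = 1, c ^+ 2 = 1, d ^+ 2 = 1,
                a * b = b * a, a * c = c * a, a * d = d * a * b,
                b * c = c * b, b * d = d * b, c * d = d * a ^+ 2 * c),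
         [set: G] = dprod (gen [:: a; b; c; d]) E
       & N = dprod (dprod (gen [:: b]) (gen [:: c; d])) E]) \/
  (* 9 *)
  (torsion2 R = [set 0%R] /\
   exists (a b c : G) (E : set G),
     [/\ elem_abelian2 E,
         [:: a; b; c] \presents
           Grp (a : b : c : a ^+ 4 = b ^+ 4 = 1, c ^+ 2 = 1,
                a * b = b * a, a * c = c * a ^-1,
                b * c = c * a ^+ 2 * b ^-1),
         [set: G] = dprod (gen [:: a; b; c]) E
       & N = dprod (dprod (gen [:: a; c]) (gen [:: b ^+ 2])) E]) \/
  (* 10 *)
  (torsion2 R = [set 0%R] /\
   exists (a b c : G) (E : set G),
     [/\ elem_abelian2 E,
         [:: a; b; c] \presents
           Grp (a : b : c : a ^+ 4 = b ^+ 4 = 1, c ^+ 2 = 1,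
                a * b = b * a, a * c = c * a, b * c = c * a ^+ 2 * b),
         [set: G] = dprod (gen [:: a; b; c]) E
       & N = dprod (gen [:: b; c]) E \/
         N = dprod (gen [:: a * b; c]) E]).
Proof.
move=> N; pose P := fun g : G => (sigma g == 1)%R.
have NE : N = [set g | P g] by apply/seteqP; split=> g /= /eqP.
have two0 := two_neq0 charR.
pose t := exists2 r : R, (r != 0)%R & (r *+ 2 = 0)%R.
pose c := (4%:R = 0 :> R)%R.
have -> : (torsion2 R = [set 0%R]) = ~ t by apply/propext/torsion2P.
have -> : has_char R 4 = c by apply/propext/has_char4P.
have ct : c -> t.
  (* The element [2] is nonzero, and its double is [4]. *)
  move=> c4; exists 2%:R%R => //; rewrite -mulrnA; exact: c4.
have sN := sigmaM orient_sigma.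
have PM g h : P (g * h) = (P g == P h).
  rewrite /P sN; case: orient_sigma => s1 _.
  by case: (s1 g) => ->; case: (s1 h) => ->.
have nontrivP : exists x, ~~ P x.
  by have [g sg] := nontriv_sigma; exists g; apply/eqP.
rewrite NE; split=> [/(antisym_commuteE orient_sigma two0) C|].
  have := classification PM nonabelianG C nontrivP ct.
  case=> [[? [a [b [E [? ? ? ?]]]]]|]; first by left; split=> //; exists a, b, E.
  case=> [[? [a [b [E [? ? ? ?]]]]]|].
    by right; left; split=> //; exists a, b, E; split=> //; left.
  case=> [?|]; first by do 2!right; left.
  case=> [?|]; first by do 3!right; left.
  case=> [[a [b [E [? ? ? ?]]]]|].
    by do 4!right; left; exists a, b, E; split=> //; left.
  case=> [[? [a [b [d [E [? ? ? ?]]]]]]|].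
    by do 5!right; left; split=> //; exists a, b, d, E; split=> //; left.
  case=> [[? [a [b [d [E [? ? ? ?]]]]]]|].
    by do 6!right; left; split=> //; exists a, b, d, E; split=> //; constructor 1.
  case=> [[? [a [b [d [e [E [? ? ? ?]]]]]]]|].
    by do 7!right; left; split=> //; exists a, b, d, e, E.
  case=> [[? [a [b [d [E [? ? ? ?]]]]]]|[? [a [b [d [E [? ? ? ?]]]]]]].
    by do 8!right; left; split=> //; exists a, b, d, E.
  by do 9!right; split=> //; exists a, b, d, E; split=> //; left.
have nt_commute : ~ t -> skew_commute False c P -> forall x y : group_ring R G,
    antisym sigma x -> antisym sigma y -> (x * y = y * x)%R.
  by move=> nt C; apply: (antisym_commute orient_sigma C).
have inv_commute : skew_commute False c P /\ involutions_central P ->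
    forall x y : group_ring R G,
    antisym sigma x -> antisym sigma y -> (x * y = y * x)%R.
  by case=> C inv; apply: (antisym_commute orient_sigma C) => // _ g h; apply: inv.
have mg (s : seq G) x : x \in s -> gen s x by apply: mem_gen.
case=> [[nt [a [b [E [eE pr GE LE]]]]]|].
  apply: nt_commute nt _; apply: (pres1_commute c PM nontrivP eE LE pr GE).
  by apply: mg; rewrite !inE eqxx orbT.
case=> [[hc [a [b [E [eE pr GE LL]]]]]|].
  apply: inv_commute; case: LL => LE; apply: (pres2_commute PM nontrivP eE LE pr GE) => //.
    by left; apply: mg; rewrite !inE eqxx orbT.
  by right; apply: mg; rewrite !inE eqxx orbT.
case=> [[nt [_ _ N2]]|]; first by apply: nt_commute nt _; apply: elementary_commute.
case=> [[ham Nc]|].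
  apply: inv_commute; apply: hamiltonian_commute => //.
  by case: Nc => [|[]]; [left | right].
case=> [[a [b [E [eE pr GE LL]]]]|].
  apply: inv_commute; case: LL => LE; apply: (pres5_commute c PM nontrivP eE LE pr GE).
    by left; apply: mg; rewrite !inE eqxx.
  by right; apply: mg; rewrite !inE eqxx.
have factor1 (A B E : set G) : [set g | P g] = dprod (dprod A B) E -> dprod A B 1.
  have : [set g | P g] 1 by have := PM 1 1; rewrite mulg1 eqxx.
  by move=> + e; rewrite e => -[[]].
case=> [[hc [a [b [d [E [eE pr GE LL]]]]]]|].
  apply: inv_commute; case: LL => LE; have L1 := factor1 _ _ _ LE;
    apply: (pres6_commute PM nontrivP eE LE pr GE) => //;
    try (left; apply: (dprod_left L1); apply: mg; rewrite !inE eqxx ?orbT //);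
    try (right; apply: (dprod_left L1); apply: mg; rewrite !inE eqxx ?orbT //);
    by apply: (dprod_left L1); apply: mg; rewrite !inE eqxx.
case=> [[nt [a [b [d [E [eE pr GE LL]]]]]]|].
  apply: nt_commute nt _; case: LL => LE;
    apply: (pres7_commute c PM nontrivP eE LE pr GE);
    [constructor 1 | constructor 2 | constructor 3];
    by split; apply: mg; rewrite !inE eqxx ?orbT.
case=> [[nt [a [b [d [e [E [eE pr GE LE]]]]]]]|].
  have L1 := factor1 _ _ _ LE; apply: nt_commute nt _.
  apply: (pres8_commute c PM nontrivP eE LE pr GE);
    [apply: (dprod_left L1) | apply: (dprod_right L1)..];
    by apply: mg; rewrite !inE eqxx ?orbT.
case=> [[nt [a [b [d [E [eE pr GE LE]]]]]]|[nt [a [b [d [E [eE pr GE LL]]]]]]].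
  have L1 := factor1 _ _ _ LE; apply: nt_commute nt _.
  apply: (pres9_commute c PM nontrivP eE LE pr GE); apply: (dprod_left L1);
    by apply: mg; rewrite !inE eqxx ?orbT.
apply: nt_commute nt _; case: LL => LE;
  apply: (pres10_commute c PM nontrivP eE LE pr GE); [left | | right |];
  by apply: mg; rewrite !inE eqxx ?orbT.
Qed.
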